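(* Let $M$ be a real hypersurface in $\mathbb{C}P^m$, $m\geq 3$. Then $A_F(\phi X,Y)=\phi A_F(X,Y)$ for any $X,Y\in\mathbb{D}$ if and only if $M$ is locally congruent to a ruled real hypersurface.
   Context: $\mathbb{C}P^m$ is complex projective space with its Kaehlerian structure $(J,g)$, where $g$ is the Fubini-Study metric of constant holomorphic sectional curvature $4$. All manifolds, vector fields, etc. are of class $C^\infty$. A real hypersurface $M$ is connected and without boundary; $g$ also denotes the induced metric on $M$ and $\nabla$ the Levi-Civita connection of $M$. $N$ is a locally defined unit normal vector field on $M$, $A$ is the shape operator of $M$ associated to $N$ (so $AX=-\overline{\nabla}_XN$, with $\overline{\nabla}$ the Levi-Civita connection of $\mathbb{C}P^m$), and $\xi=-JN$ is the structure (Reeb) vector field. For $X$ tangent to $M$ write $JX=\phi X+\eta(X)N$, where $\phi X$ is the tangential component of $JX$ and $\eta(X)=g(X,\xi)$; $\phi$ is called the structure tensor. $\mathbb{D}$ is the maximal holomorphic distribution on $M$, consisting at each point of the tangent vectors orthogonal to $\xi$. For a nonzero real number $k$ and $X,Y$ tangent to $M$, set $F^{(k)}_XY=g(\phi AX,Y)\xi-\eta(Y)\phi AX-k\eta(X)\phi Y$ (the $k$-th Cho operator). If $X\in\mathbb{D}$ this does not depend on $k$ and is written $F_XY=g(\phi AX,Y)\xi-\eta(Y)\phi AX$. For $X\in\mathbb{D}$ and $Y$ tangent to $M$, $A_F(X,Y)=[F_X,A]Y=F_XAY-AF_XY$. A real hypersurface of $\mathbb{C}P^m$ is ruled if $\mathbb{D}$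 is integrable and its integral manifolds are totally geodesic $\mathbb{C}P^{m-1}$'s (open parts thereof); equivalently, $g(AX,Y)=0$ for all $X,Y\in\mathbb{D}$. *)

(* Defs.v *)
From HB Require Import structures.
From mathcomp Require Import all_boot all_order all_algebra.
From mathcomp Require Import sesquilinear spectral complex.
From mathcomp Require Import all_classical all_reals all_analysis.

Set Implicit Arguments.
Unset Strict Implicit.
Unset Printing Implicit Defensive.

Import Order.TTheory GRing.Theory Num.Theory.
Import numFieldNormedType.Exports.

Local Open Scope classical_set_scope.
Local Open Scope ring_scope.
Local Open Scope complex_scope.
Local Open Scope sesquilinear_scope.

Section Smooth.
Context {R : realType} {d n : nat}.

Fixpoint of_class_C (k : nat) (Om : set 'rV[R]_d) (f : 'rV[R]_d -> R) : Prop :=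
  match k with
  | 0%N => forall u, Om u -> {for u, continuous f}
  | k'.+1 => forall v, (forall u, Om u -> derivable f u v) /\
                       of_class_C k' Om (fun u => 'D_v f u)
  end.

Definition smooth_on (Om : set 'rV[R]_d) (f : 'rV[R]_d -> 'M[R[i]]_n) : Prop :=
  forall k i j, of_class_C k Om (fun u => complex.Re (f u i j)) /\
                of_class_C k Om (fun u => complex.Im (f u i j)).

(* R[i] carries no normed module structure over R, so the derivative of a
   matrix-valued map is taken on the real and imaginary parts of the entries. *)
Definition mxderive (v : 'rV[R]_d) (f : 'rV[R]_d -> 'M[R[i]]_n)
    (u : 'rV[R]_d) : 'M[R[i]]_n :=
  \matrix_(i, j) ('D_v (fun t => complex.Re (f t i j)) u
                  +i* 'D_v (fun t => complex.Im (f t i j)) u).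

End Smooth.

Section ProjectiveSpace.
Context {R : realType} {m : nat}.
Local Notation E := ('M[R[i]]_m.+1).

(* A complex line of C^(m+1), spanned by a unit column z, is represented by the
   orthogonal projection P = z z^* onto it.  A vector v orthogonal to z, i.e.
   an element of Hom(C z, z^perp), is the tangent vector X = v z^* + z v^* at
   P.  In these terms [JCP P] maps v to iv, and g(X, X) = |v|^2: it is the
   metric making the Hopf fibration of the unit sphere S^(2m+1) a Riemannian
   submersion, which has constant holomorphic sectional curvature 4. *)
Definition CP : set E := [set P | [/\ P ^t* = P, P *m P = P & \tr P = 1]].

Definition tangentCP (P : E) : set E :=
  [set X | X ^t* = X /\ P *m X + X *m P = X].

Definition g (X Y : E) : R := complex.Re (\tr (X *m Y)) / 2.

Definition JCP (P X : E) : E := (Complex 0 1) *: (X *m P - P *m X).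

(* The orthogonal projection of the Hermitian matrices onto the tangent space
   at P.  As g is induced by the Euclidean metric of the space of Hermitian
   matrices, the Levi-Civita connection of CP is the flat derivative followed
   by this projection. *)
Definition projCP (P Z : E) : E :=
  P *m Z *m (1%:M - P) + (1%:M - P) *m Z *m P.

(* The isometry group of CP^m: the unitary transformations and their composites
   with the complex conjugation. *)
Definition isometryCP (f : E -> E) : Prop :=
  exists2 u : E, u \is unitarymx &
    (forall P, f P = u *m P *m u ^t*) \/
    (forall P, f P = u *m map_mx conjc P *m u ^t*).

(* For w != 0, the totally geodesic CP^(m-1) of the lines orthogonal to w. *)
Definition subCP (w : 'cV[R[i]]_m.+1) : set E :=
  [set P | CP P /\ P *m w = 0].

Definition tangent_subCP (w : 'cV[R[i]]_m.+1) (P : E) : set E :=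
  [set X | tangentCP P X /\ X *m w = 0].

End ProjectiveSpace.

Arguments CP {R m}.

(* A hypersurface is an immersion iota of a topological space M; its smooth
   structure is given by the charts c in which iota \o c is smooth with
   injective differential.  (Transition maps between such charts are
   automatically smooth.)  Tangent vectors of M at p are identified with their
   images under the differential of iota. *)
Section Hypersurface.
Context {R : realType} {m : nat} {M : topologicalType}.
Local Notation E := ('M[R[i]]_m.+1).
Local Notation V := ('rV[R]_(m.*2.-1)).
Variable iota : M -> E.

Definition chart (Om : set V) (c : V -> M) : Prop :=
  [/\ open Om,
      (forall u v, Om u -> Om v -> c u = c v -> u = v),
      (forall u, Om u -> {for u, continuous c}),
      (forall O, open O -> O `<=` Om -> open (c @` O)) &
      smooth_on Om (iota \o c) /\
      (forall u v, Om u -> mxderive v (iota \o c) u = 0 -> v = 0)].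

Definition real_hypersurface : Prop :=
  [/\ connected [set: M], hausdorff_space M, @second_countable M,
      (forall p, CP (iota p)) &
      (forall p, exists Om c u, [/\ chart Om c, Om u & c u = p])].

Definition tangent (p : M) : set E :=
  [set X | exists Om c u v, [/\ chart Om c, Om u, c u = p &
                                X = mxderive v (iota \o c) u]].

(* The derivative at p, along a tangent vector X, of a map F : M -> E. *)
Definition derive_along (F : M -> E) (p : M) (X : E) : E :=
  xget 0 [set Z | exists Om c u v,
    [/\ chart Om c, Om u, c u = p, X = mxderive v (iota \o c) u &
        Z = mxderive v (F \o c) u]].

Definition unit_normal (p : M) (n : E) : Prop :=
  [/\ tangentCP (iota p) n, g n n = 1 & forall X, tangent p X -> g n X = 0].

Definition unit_normal_field (U : set M) (N : M -> E) : Prop :=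
  [/\ open U,
      (forall Om c, chart Om c -> smooth_on (Om `&` c @^-1` U) (N \o c)) &
      (forall q, U q -> unit_normal q (N q))].

(* The maximal holomorphic distribution; its definition does not depend on the
   choice of the unit normal. *)
Definition DD (p : M) : set E :=
  [set X | tangent p X /\
           forall n, unit_normal p n -> g X (- JCP (iota p) n) = 0].

Section Operators.
Variables (N : M -> E) (p : M).

Definition shape (X : E) : E := - projCP (iota p) (derive_along N p X).

Definition xi : E := - JCP (iota p) (N p).

Definition eta (X : E) : R := g X xi.

Definition phi (X : E) : E := JCP (iota p) X - (eta X)%:C *: N p.

Definition F_op (X Y : E) : E :=
  (g (phi (shape X)) Y)%:C *: xi - (eta Y)%:C *: phi (shape X).

Definition A_F (X Y : E) : E := F_op X (shape Y) - shape (F_op X Y).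

End Operators.

(* Through every point of M passes an integral manifold L of DD which iota maps
   onto an open part of a totally geodesic CP^(m-1).  The third condition says
   that iota : L -> subCP w is open, for the subspace topology on L and the
   topology of subCP w given by the norm of g; iota being continuous and locally
   injective, it is then a local homeomorphism from L to subCP w. *)
Definition ruled : Prop :=
  forall p, exists w : 'cV[R[i]]_m.+1, exists L : set M,
    [/\ w != 0, L p,
        (forall q (O : set M), L q -> open O -> O q ->
           exists2 e : R, 0 < e &
             forall P, subCP w P -> g (P - iota q) (P - iota q) < e ->
               exists2 q', (L `&` O) q' & iota q' = P) &
        (forall q, L q -> subCP w (iota q) /\
                          DD q = tangent_subCP w (iota q))].

End Hypersurface.

(* Every point of M has a neighbourhood U which some isometry f of CP^m carries,
   through an open embedding j, onto an open part of M'. *)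
Definition locally_congruent {R : realType} {m : nat} {M M' : topologicalType}
    (iota : M -> 'M[R[i]]_m.+1) (iota' : M' -> 'M[R[i]]_m.+1) : Prop :=
  forall p, exists (U : set M) (f : 'M[R[i]]_m.+1 -> 'M[R[i]]_m.+1)
                   (j : M -> M'),
    [/\ open U /\ U p,
        isometryCP f,
        (forall q q', U q -> U q' -> j q = j q' -> q = q') /\
        (forall q, U q -> {for q, continuous j}),
        (forall O, open O -> O `<=` U -> open (j @` O)) &
        (forall q, U q -> iota' (j q) = f (iota q))].

(* Main.v *)
(* Let S be the second fundamental form restricted to the maximal holomorphic
   distribution D.  Both conditions amount to S = 0.

   Put b(Y) = eta(AY).  For X, Y, V in D the D-component of the hypothesis reads
     b(Y) (S(X, V) - S(phi X, phi V)) = S(phi X, phi Y) b(V) + S(X, phi Y) b(phi V),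
   and forces S = 0 wherever xi is not principal.  Where A xi = alpha xi, the
   xi-component gives g(phi A X, AY) = alpha g(phi A X, Y); if this held on an
   open set, the exterior derivative of g(A xi, .) = alpha eta would give
   g(phi X, Y) = 0 on D.  So S vanishes on a dense set, hence everywhere.

   If S = 0, the complex line W = n P n spanned by the normal n is stationary in
   the directions of D, so its derivative along a curve in M is proportional to
   the component of the velocity along xi.  Fix a point P0 with line W0.  Every
   line near P0 in the hyperplane orthogonal to W0 is, in an affine coordinate
   and up to a displacement along W0, the end of a curve in M whose velocity has
   a xi-component linear in W - W0.  By Gronwall's inequality W = W0 along this
   curve, the displacement vanishes, and the curve stays in the hyperplane.
   Hence the sets on which W is constant are the leaves.

   Conversely, a curve in a leaf lifts differentiably to M.  Along it the
   compression of the normal to the hyperplane containing the leaf vanishes, and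
   differentiating this gives S = 0.  This property is invariant under
   isometries of the ambient space; it implies phi A X = 0 for X in D, so that
   both sides of the commutation identity vanish. *)
Require Import Defs.
From HB Require Import structures.
From mathcomp Require Import all_boot all_order all_algebra.
From mathcomp Require Import sesquilinear spectral complex.
From mathcomp Require Import ring lra.
From mathcomp Require Import all_classical all_reals all_analysis.

Set Implicit Arguments.
Unset Strict Implicit.
Unset Printing Implicit Defensive.

Import Order.TTheory GRing.Theory Num.Theory.
Import numFieldNormedType.Exports.

Local Open Scope classical_set_scope.
Local Open Scope ring_scope.
Local Open Scope complex_scope.
Local Open Scope sesquilinear_scope.

(** * Differential calculus in coordinates *)

(** Two devices shape the proof. A condition on the maximal holomorphic distribution concerns
    vectors that move with the point, so it can neither be differentiated nor passed to a limit as
    it stands. The Hopf condition and the vanishing of the second fundamental form are therefore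
    rewritten as identities between [reeb_form], [reeb_shape] and [second_form] for all constant
    coordinate vectors: the first can then be differentiated, and the second is closed under limits.
    The leaves do not come from an integrability theorem: the end point is prescribed, and the path
    to it is the lift of a straight segment through a local diffeomorphism, not the solution of a
    differential equation. Curves in charts are chosen pointwise and shown to be continuous; they
    are differentiable because an immersion has a locally Lipschitz left inverse. The matrix
    [normal_line] replaces the normal because it does not see its sign: it is defined at every point
    without an orientation, and the tangent vectors that it annihilates are the holomorphic ones. *)

Section DirectionalDerivative.
Context {R : realType} {V W : normedModType R}.

(** Multiplying the difference quotient by [h] removes the punctured neighbourhood: the estimate is
    trivial at [h = 0], and estimates can be added and composed without dividing. *)
Lemma is_derive_epsP (f : V -> W) a v l :
  is_derive a v f l <->
  forall e, 0 < e -> \forall h \near (0 : R),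
    `|f (h *: v + a) - f a - h *: l| <= e * `|h|.
Proof.
split.
- move=> [/derivable_nbhs df <-] e e0.
  have /eqaddoP /(_ e e0) := df.
  rewrite nearE /=; apply: filterS => h /=.
  by rewrite /cst /= opprD !fctE addrA.
- move=> H.
  have cv : (fun h => h^-1 *: ((f \o shift a) (h *: v) - f a)) @ 0^' --> l.
    apply/cvgrPdist_le => e e0.
    have := H e e0; rewrite !near_withinE; apply: filterS => h /= hb hN0.
    rewrite -[X in X - _]scale1r -(@mulVf _ h) // -scalerA -scalerBr normrZ normfV.
    rewrite ler_pdivrMl ?normr_gt0// distrC mulrC.
    by [].
  by apply: DeriveDef; [apply/cvg_ex; exists l | apply/cvg_lim].
Qed.

End DirectionalDerivative.

Section DirectionalDerivativeLine.
Context {R : realType} {V W : normedModType R}.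

Lemma is_derive_line (f : V -> W) u v (s : R) l :
  is_derive (s *: v + u) v f l ->
  is_derive s 1 (fun t : R => f (t *: v + u)) l.
Proof.
move=> /is_derive_epsP H; apply/is_derive_epsP => e e0.
have := H e e0; apply: filterS => h.
by rewrite scalerDl addrA [h *: (1 : R^o)]mulr1.
Qed.

Lemma is_deriveZdir (f : V -> W) a v l (k : R) :
  is_derive a v f l -> is_derive a (k *: v) f (k *: l).
Proof.
have [->|k0] := eqVneq k 0.
  by move=> _; rewrite !scale0r; exact: is_derive0.
move=> /is_derive_epsP H; apply/is_derive_epsP => e e0.
have e'0 : 0 < e / `|k| by rewrite divr_gt0// normr_gt0.
have := H _ e'0 => /nbhs_ballP[r /= r0 Hr].
apply/nbhs_ballP; exists (r / `|k|) => /=; first by rewrite divr_gt0// normr_gt0.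
move=> h; rewrite -ball_normE /= sub0r normrN ltr_pdivlMr ?normr_gt0// => hr.
have := Hr (h * k); rewrite -ball_normE /= sub0r normrN normrM => /(_ hr).
by rewrite !scalerA [`|h| * _]mulrC mulrA divfK ?normr_eq0.
Qed.

End DirectionalDerivativeLine.

Section RowNorm.
Context {R : realType} {d : nat}.
Local Notation V := 'rV[R]_d.

Lemma row_norm_ge (v : V) j : `|v 0 j| <= `|v|.
Proof.
rewrite [leRHS]/Num.Def.normr/= mx_normrE.
exact: (@le_bigmax _ _ _ _ (fun i : 'I_1 * 'I_d => `|v i.1 i.2|) (0, j)).
Qed.

Lemma row_norm_le (v : V) e : 0 <= e -> (forall j, `|v 0 j| <= e) -> `|v| <= e.
Proof.
move=> e0 H; rewrite [leLHS]/Num.Def.normr/= mx_normrE.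
by apply: bigmax_le => // -[i j] _ /=; rewrite ord1.
Qed.

Lemma row_norm_sum_le (v : V) (F : 'I_d -> R) e : 0 <= e ->
  (forall j, `|F j| <= e) -> `|\sum_j v 0 j * F j| <= e *+ d * `|v|.
Proof.
move=> e0 H; apply: le_trans (ler_norm_sum _ _ _) _.
have -> : e *+ d * `|v| = \sum_(j < d) e * `|v|.
  by rewrite sumr_const card_ord mulrnAl.
by apply: ler_sum => j _; rewrite normrM mulrC; apply: ler_pM => //; exact: row_norm_ge.
Qed.

End RowNorm.

Section MeanValue.
Context {R : realType} {V : normedModType R}.

Lemma mean_value_direction (f : V -> R) u v :
  (forall t : R, 0 <= t <= 1 -> derivable f (t *: v + u) v) ->
  exists2 c : R, 0 <= c <= 1 & f (v + u) - f u = 'D_v f (c *: v + u).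
Proof.
move=> df; pose g (t : R) : R := f (t *: v + u).
have dg (t : R) : 0 <= t <= 1 -> is_derive t 1 g ('D_v f (t *: v + u)).
  by move=> ht; apply: is_derive_line; apply/derivableP/df.
have [||c] := @MVT_segment R g (fun t => 'D_v f (t *: v + u)) 0 1 ler01.
- by move=> t /subset_itv_oo_cc; rewrite in_itv /= => /dg.
- apply: derivable_within_continuous => t; rewrite in_itv /= => /dg dgt.
  exact: ex_derive.
by rewrite in_itv /= => c01; rewrite /g scale1r scale0r add0r subr0 mulr1; exists c.
Qed.

End MeanValue.

Section StrictDerivative.
Context {R : realType} {d : nat}.
Local Notation V := 'rV[R]_d.
Local Notation e_ j := (delta_mx 0 j : V).

Definition coord_patch (u u' : V) (k : nat) : V :=
  \row_j (if (j < k)%N then u 0 j else u' 0 j).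

Lemma coord_patchS u u' (k : 'I_d) :
  coord_patch u u' k.+1 = (u - u') 0 k *: e_ k + coord_patch u u' k.
Proof.
apply/rowP => j; rewrite !mxE ltnS /=.
have [->|jk] := eqVneq j k; first by rewrite leqnn ltnn /= mulr1 subrK.
by rewrite leq_eqVlt (inj_eq val_inj) (negbTE jk) /= mulr0 add0r.
Qed.

(* Telescoping from [u'] to [u] one coordinate at a time and applying the mean
   value theorem to each step. *)
Lemma strict_derivative (f : V -> R) (Om : set V) u0 :
  open Om -> Om u0 -> of_class_C 1 Om f ->
  forall e, 0 < e -> exists2 r, 0 < r & forall u u', ball u0 r u -> ball u0 r u' ->
    `|f u - f u' - \sum_j (u - u') 0 j * 'D_(e_ j) f u0| <= e * `|u - u'|.
Proof.
move=> oOm Omu0 fC1 e e0.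
(* The error is shared among the [d] coordinates; [d.+1] keeps the divisor nonzero when [d = 0]. *)
pose e' := e / d.+1%:R.
have e'0 : 0 < e' by rewrite divr_gt0.
have [r r0 Hr] : exists2 r, 0 < r & forall u, ball u0 r u ->
    Om u /\ forall j, `|'D_(e_ j) f u - 'D_(e_ j) f u0| <= e'.
  have : \forall u \near u0, Om u /\ forall j, `|'D_(e_ j) f u - 'D_(e_ j) f u0| <= e'.
    near=> u; split; first by near: u; exact: open_nbhs_nbhs.
    move=> j; move: j; near: u; apply: filter_forall => j.
    have [_ /(_ u0 Omu0)] := fC1 (e_ j).
    move=> /cvgrPdist_le /(_ e' e'0); apply: filterS => u.
    by rewrite distrC.
  by move/nbhs_ballP => [r r0 Hr]; exists r.
exists r => // u u' bu bu'.
have patch0 : coord_patch u u' 0 = u' by apply/rowP => j; rewrite !mxE.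
have patchd : coord_patch u u' d = u by apply/rowP => j; rewrite !mxE ltn_ord.
have inball (w : V) : (forall j, `|u0 0 j - w 0 j| < r) -> ball u0 r w.
  move=> H; rewrite -ball_normE /=.
  rewrite [ltLHS]/Num.Def.normr/= mx_normrE.
  by apply: bigmax_lt => // -[i j] _ /=; rewrite !mxE ord1.
have cball w j : ball u0 r w -> `|u0 0 j - w 0 j| < r.
  rewrite -ball_normE /=; apply: le_lt_trans.
  by have := row_norm_ge (u0 - w) j; rewrite !mxE.
have pball k : ball u0 r (coord_patch u u' k).
  by apply: inball => j; rewrite mxE; case: ifP => _; exact: cball.
have step (k : 'I_d) : exists2 w, ball u0 r w &
    f (coord_patch u u' k.+1) - f (coord_patch u u' k) = (u - u') 0 k * 'D_(e_ k) f w.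
  have segball t : 0 <= t <= 1 -> ball u0 r ((t * (u - u') 0 k) *: e_ k + coord_patch u u' k).
    move=> /andP[t0 t1]; apply: inball => j; rewrite !mxE /=.
    have [->|jk] := eqVneq j k; last by rewrite mulr0 add0r; have := cball _ j (pball k); rewrite mxE.
    rewrite mulr1 ltnn.
    (* The [k]-th coordinate of the segment is a convex combination of those of [u] and [u'], and
       the ball is a product of intervals. *)
    have -> : u0 0 k - (t * (u 0 k - u' 0 k) + u' 0 k) =
      t * (u0 0 k - u 0 k) + (1 - t) * (u0 0 k - u' 0 k) by ring.
    have hu := cball _ k bu; have hu' := cball _ k bu'.
    apply: le_lt_trans (ler_normD _ _) _; rewrite !normrM (ger0_norm t0) (@ger0_norm _ (1 - t)) ?subr_ge0//.
    have [->|tn0] := eqVneq t 0; first by rewrite mul0r add0r subr0 mul1r.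
    have tp : 0 < t by rewrite lt_neqAle eq_sym tn0.
    have -> : r = t * r + (1 - t) * r by ring.
    by apply: ltr_leD; [rewrite ltr_pM2l | rewrite ler_wpM2l ?subr_ge0// ltW].
  set s := (u - u') 0 k.
  have [s0|sn0] := eqVneq s 0.
    exists u0; first exact: ballxx.
    by rewrite coord_patchS -/s s0 scale0r add0r subrr mul0r.
  have [t t01|c c01] := @mean_value_direction R V f (coord_patch u u' k) (s *: e_ k).
    have [Omt _] := Hr _ (segball t t01).
    have [dt _] := fC1 (e_ k).
    have := is_deriveZdir s (derivableP (dt _ Omt)).
    by rewrite scalerA => -[].
  rewrite -coord_patchS => ->; rewrite scalerA.
  exists ((c * s) *: e_ k + coord_patch u u' k); first exact: segball.
  have [Omc _] := Hr _ (segball c c01).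
  have [dt _] := fC1 (e_ k).
  by have [_ ->] := is_deriveZdir s (derivableP (dt _ Omc)).
have -> : f u - f u' = \sum_(k < d) (f (coord_patch u u' k.+1) - f (coord_patch u u' k)).
  rewrite -(big_mkord xpredT (fun k => f (coord_patch u u' k.+1) - f (coord_patch u u' k))).
  by rewrite telescope_sumr// patchd patch0.
rewrite -sumrB.
apply: (@le_trans _ _ (e' *+ d * `|u - u'|)).
  have /all_sig2[w bw wE] : forall k : 'I_d, {w | ball u0 r w &
      f (coord_patch u u' k.+1) - f (coord_patch u u' k) = (u - u') 0 k * 'D_(e_ k) f w}.
    by move=> k; apply: cid2; exact: step.
  rewrite (eq_bigr (fun k => (u - u') 0 k * ('D_(e_ k) f (w k) - 'D_(e_ k) f u0))).
    apply: row_norm_sum_le (ltW e'0) _ => k.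
    by have [_] := Hr _ (bw k); apply.
  by move=> k _; rewrite wE mulrBr.
apply: ler_wpM2r => //; rewrite /e' -[_ *+ d]mulr_natr -mulrA ler_piMr//; first exact: ltW.
by rewrite ler_pdivrMl ?mulr1 ?ler_nat.
Unshelve. all: by end_near. Qed.

End StrictDerivative.

Section C1Calculus.
Context {R : realType} {d : nat}.
Local Notation V := 'rV[R]_d.
Local Notation e_ j := (delta_mx 0 j : V).

Definition grad (f : V -> R) (u v : V) : R := \sum_j v 0 j * 'D_(e_ j) f u.

Lemma grad_scale f u v (h : R) : grad f u (h *: v) = h * grad f u v.
Proof.
by rewrite /grad mulr_sumr; apply: eq_bigr => j _; rewrite mxE mulrA.
Qed.

Lemma gradD f u v w : grad f u (v + w) = grad f u v + grad f u w.
Proof.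
by rewrite /grad -big_split; apply: eq_bigr => j _; rewrite mxE mulrDl.
Qed.

Lemma grad_bound f u : exists2 C, 0 <= C & forall v, `|grad f u v| <= C * `|v|.
Proof.
exists ((\sum_j `|'D_(e_ j) f u|) *+ d); first by rewrite mulrn_wge0// sumr_ge0.
move=> v; apply: row_norm_sum_le; first exact: sumr_ge0.
by move=> j; rewrite (bigD1 j) //= lerDl sumr_ge0.
Qed.

(** Strict differentiability for the pair [h *: v + u], [u]. It shows that the directional
    derivative is linear in [v], which [of_class_C] does not assert. *)
Lemma is_derive_grad (f : V -> R) Om u v : open Om -> Om u -> of_class_C 1 Om f ->
  is_derive u v f (grad f u v).
Proof.
move=> oOm Omu fC; apply/is_derive_epsP => e e0.
have e'0 : 0 < e / (`|v| + 1) by rewrite divr_gt0// ltr_wpDl.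
have [r r0 Hr] := strict_derivative oOm Omu fC e'0.
have r'0 : 0 < r / (`|v| + 1) by rewrite divr_gt0// ltr_wpDl.
apply/nbhs_ballP; exists (r / (`|v| + 1)) => //= h.
rewrite -ball_normE /= sub0r normrN ltr_pdivlMr ?ltr_wpDl// => hr.
have hv : `|h *: v| < r.
  by apply: le_lt_trans hr; rewrite normrZ; apply: ler_wpM2l => //; rewrite lerDl.
have := Hr (h *: v + u) u; rewrite addrK => /(_ _ (ballxx _ r0)) H.
have {}H := H _.
rewrite -/(grad f u (h *: v)) grad_scale in H.
apply: le_trans (H _) _.
  by rewrite -ball_normE /= opprD addrCA subrr addr0 normrN.
rewrite normrZ mulrAC ler_pdivrMr ?ltr_wpDl// -mulrA; apply: ler_wpM2l; first exact: ltW.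
by apply: ler_wpM2l => //; rewrite lerDl.
Qed.

Lemma deriveE_grad (f : V -> R) Om u v : open Om -> Om u -> of_class_C 1 Om f ->
  'D_v f u = grad f u v.
Proof. by move=> oOm Omu fC; have [] := is_derive_grad v oOm Omu fC. Qed.

Lemma continuous_epsP (f : V -> R) (u : V) : {for u, continuous f} <->
  forall e, 0 < e -> exists2 r, 0 < r & forall t, ball u r t -> `|f u - f t| <= e.
Proof.
split.
  move=> /cvgrPdist_le H e e0; have /nbhs_ballP[r /= r0 Hr] := H e e0.
  by exists r.
move=> H; apply: (iffRL (@cvgrPdist_le _ _ _ (nbhs u) _ _ _)) => e e0.
have [r r0 Hr] := H e e0.
by apply/nbhs_ballP; exists r.
Qed.

Lemma C1_continuous (f : V -> R) Om u : open Om -> Om u -> of_class_C 1 Om f ->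
  {for u, continuous f}.
Proof.
move=> oOm Omu fC; apply/continuous_epsP => e e0.
have [r r0 Hr] := strict_derivative oOm Omu fC ltr01.
have [C C0 HC] := grad_bound f u.
have e'0 : 0 < e / (C + 1) by rewrite divr_gt0// ltr_wpDl.
exists (Num.min r (e / (C + 1))); first by rewrite lt_min r0.
move=> t; rewrite -ball_normE /= lt_min => /andP[h1 h2].
have := Hr u t (ballxx _ r0); rewrite -ball_normE /= => /(_ h1).
rewrite -/(grad f u (u - t)) mul1r => H.
have -> : f u - f t = (f u - f t - grad f u (u - t)) + grad f u (u - t) by ring.
apply: le_trans (ler_normD _ _) _.
apply: (@le_trans _ _ ((C + 1) * `|u - t|)).
  by rewrite mulrDl mul1r addrC; apply: lerD => //.
by rewrite mulrC -ler_pdivlMr ?ltr_wpDl// ltW.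
Qed.

(** Strict differentiability of [f] needs only a linear bound on the secants of [c]; half of the
    error comes from [f] and half from [c]. *)
Lemma is_derive_comp_curve (f : V -> R) Om (c : R -> V) t v : open Om -> Om (c t) ->
  of_class_C 1 Om f -> is_derive t 1 c v ->
  is_derive t 1 (fun s => f (c s)) (grad f (c t) v).
Proof.
move=> oOm Omu fC /is_derive_epsP dc; apply/is_derive_epsP => e e0.
have [C C0 HC] := grad_bound f (c t).
pose M := `|v| + 1.
have M0 : 0 < M by rewrite ltr_wpDl.
pose e1 := e / 2 / M.
have e10 : 0 < e1 by rewrite !divr_gt0.
have [r r0 Hr] := strict_derivative oOm Omu fC e10.
(* The bound 1 yields the secant bound [M * |h|]; the other one keeps the error of [c], amplified by
   the bound [C] on the gradient, below half of [e]. *)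
pose e2 := Num.min 1 (e / 2 / (C + 1)).
have C10 : 0 < C + 1 by rewrite ltr_wpDl.
have e20 : 0 < e2 by rewrite lt_min ltr01 !divr_gt0.
have := dc e2 e20.
have r'0 : 0 < r / (M + 1) by rewrite divr_gt0// ltr_wpDl ?ltW.
move=> H; near=> h.
have hr : `|h| < r / M.
  near: h; apply/nbhs_ballP; exists (r / M) => /=; first by rewrite divr_gt0.
  by move=> h; rewrite -ball_normE /= sub0r normrN.
have : `|c (h *: 1 + t) - c t - h *: v| <= e2 * `|h| by near: h.
set D := c _ - c t => Hh.
have DE : D = h *: v + (D - h *: v) by rewrite addrC subrK.
have Dn : `|D| <= M * `|h|.
  rewrite DE; apply: le_trans (ler_normD _ _) _; rewrite normrZ /M mulrDl mul1r mulrC.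
  rewrite lerD2l; apply: le_trans Hh _; rewrite ler_piMl// /e2 ge_min lexx.
  by [].
have cb : ball (c t) r (c (h *: 1 + t)).
  rewrite -ball_normE /= distrC; apply: le_lt_trans Dn _.
  by rewrite mulrC -ltr_pdivlMr.
have := Hr _ _ cb (ballxx _ r0); rewrite -/(grad f (c t) D) => Hs.
have gD : grad f (c t) D = h * grad f (c t) v + grad f (c t) (D - h *: v).
  by rewrite -grad_scale -gradD -DE.
have -> : f (c (h *: 1 + t)) - f (c t) - h *: grad f (c t) v =
   (f (c (h *: 1 + t)) - f (c t) - grad f (c t) D) + grad f (c t) (D - h *: v).
  by rewrite gD /GRing.scale /=; ring.
apply: le_trans (ler_normD _ _) _; rewrite [e]splitr mulrDl; apply: lerD.
  apply: le_trans Hs _; apply: (@le_trans _ _ (e1 * (M * `|h|))).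
    by apply: ler_wpM2l => //; exact: ltW.
  by rewrite /e1 mulrA divfK// gt_eqF.
apply: le_trans (HC _) _; apply: (@le_trans _ _ ((C + 1) * (e2 * `|h|))).
  by apply: ler_pM => //; rewrite lerDl.
rewrite mulrA ler_wpM2r// mulrC -ler_pdivlMr//.
by rewrite /e2 ge_min lexx orbT.
Unshelve. all: by end_near. Qed.

End C1Calculus.

(** * Immersions and the inverse function theorem *)

Section LocalInverse.
Context {R : realType} {d K : nat}.
Local Notation V := 'rV[R]_d.
Local Notation e_ j := (delta_mx 0 j : V).

Definition jacobian_mx (f : V -> 'rV[R]_K) (u : V) : 'M[R]_(d, K) :=
  \matrix_(i, j) 'D_(e_ i) (fun t => f t 0 j) u.

Lemma row_norm_mulmx_le (p q : nat) (G : 'M[R]_(p, q)) :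
  exists2 C, 0 <= C & forall w : 'rV[R]_p, `|w *m G| <= C * `|w|.
Proof.
exists ((\sum_i \sum_j `|G i j|) *+ p).
  by rewrite mulrn_wge0// sumr_ge0// => i _; rewrite sumr_ge0.
move=> w; apply: row_norm_le => [|j].
  by rewrite mulr_ge0// mulrn_wge0// sumr_ge0// => i _; rewrite sumr_ge0.
rewrite mxE; apply: row_norm_sum_le.
  by rewrite sumr_ge0// => i _; rewrite sumr_ge0.
move=> i; rewrite (bigD1 i) //= (bigD1 j) //= -addrA lerDl addr_ge0//.
  by rewrite sumr_ge0.
by rewrite sumr_ge0// => k _; rewrite sumr_ge0.
Qed.

Lemma grad_jacobian (f : V -> 'rV[R]_K) u v j :
  (v *m jacobian_mx f u) 0 j = grad (fun t => f t 0 j) u v.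
Proof. by rewrite mxE; apply: eq_bigr => i _; rewrite mxE. Qed.

(** After multiplication by a left inverse of the Jacobian matrix, [f] differs from the identity by
    a map of small Lipschitz constant. Local injectivity, the lifting of curves and the inverse
    function theorem rest on this estimate. *)
Lemma strict_left_inverse (f : V -> 'rV[R]_K) (Om : set V) u0 (G : 'M[R]_(K, d)) :
  open Om -> Om u0 -> (forall j, of_class_C 1 Om (fun u => f u 0 j)) ->
  jacobian_mx f u0 *m G = 1%:M ->
  forall e, 0 < e -> exists2 r, 0 < r & forall u u', ball u0 r u -> ball u0 r u' ->
    `|(f u - f u') *m G - (u - u')| <= e * `|u - u'|.
Proof.
move=> oOm Om0 fC JG e e0.
have [C C0 HC] := row_norm_mulmx_le G.
have C10 : 0 < C + 1 by rewrite ltr_wpDl.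
have e'0 : 0 < e / (C + 1) by rewrite divr_gt0.
have [r r0 Hr] : exists2 r, 0 < r & forall u, ball u0 r u -> forall u', ball u0 r u' ->
   forall j, `|f u 0 j - f u' 0 j - grad (fun t => f t 0 j) u0 (u - u')| <= e / (C + 1) * `|u - u'|.
  have /all_sig2[r r0 Hr] : forall j, {r | 0 < r & forall u u', ball u0 r u -> ball u0 r u' ->
     `|f u 0 j - f u' 0 j - grad (fun t => f t 0 j) u0 (u - u')| <= e / (C + 1) * `|u - u'|}.
    by move=> j; apply: cid2; exact: strict_derivative oOm Om0 (fC j) _ e'0.
  exists (\big[Num.min/1]_j r j).
    by apply: lt_bigmin => // j _; exact: r0.
  have le_r j : \big[Num.min/1]_j r j <= r j by exact: bigmin_le.
  move=> u bu u' bu' j; apply: Hr.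
    exact: le_ball (le_r j) _ bu.
  exact: le_ball (le_r j) _ bu'.
exists r => // u u' bu bu'.
have -> : (f u - f u') *m G - (u - u') =
    (f u - f u' - (u - u') *m jacobian_mx f u0) *m G.
  by rewrite [RHS]mulmxBl -mulmxA JG mulmx1.
apply: le_trans (HC _) _.
apply: (@le_trans _ _ ((C + 1) * (e / (C + 1) * `|u - u'|))); last first.
  by rewrite mulrA mulrCA divff ?mulr1// gt_eqF.
apply: ler_pM => //; first by rewrite lerDl.
apply: row_norm_le; first by rewrite mulr_ge0// ltW.
by move=> j; rewrite [X in `|X|]mxE [X in _ + X]mxE grad_jacobian !mxE; exact: Hr.
Qed.

(** With Lipschitz error 1/2 the displacement of [c] is at most twice that of [f] along [c]
    multiplied by [G], hence of order [h]; a smaller error then identifies it with [h *: (w *m G)]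
    to first order. Only continuity of [c] at [t] is assumed. *)
Lemma is_derive_lift (f : V -> 'rV[R]_K) (Om : set V) (c : R -> V) t
    (G : 'M[R]_(K, d)) (w : 'rV[R]_K) :
  open Om -> Om (c t) -> (forall j, of_class_C 1 Om (fun u => f u 0 j)) ->
  jacobian_mx f (c t) *m G = 1%:M ->
  (forall r, 0 < r -> \forall h \near (0 : R), ball (c t) r (c (h *: 1 + t))) ->
  is_derive t 1 (fun s => f (c s)) w ->
  is_derive t 1 c (w *m G).
Proof.
move=> oOm Om0 fC JG cc /is_derive_epsP df; apply/is_derive_epsP => e e0.
have [C C0 HC] := row_norm_mulmx_le G.
have C10 : 0 < C + 1 by rewrite ltr_wpDl.
have half0 : 0 < 1 / 2 :> R by lra.
have [r1 r10 Hr1] := strict_left_inverse oOm Om0 fC JG half0.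
pose M := 2 * (C * (`|w| + 1)) + 1.
have M0 : 0 < M by rewrite ltr_wpDl// !mulr_ge0// addr_ge0.
have e10 : 0 < e / 2 / M by rewrite !divr_gt0.
have [r2 r20 Hr2] := strict_left_inverse oOm Om0 fC JG e10.
have e20 : 0 < Num.min 1 (e / 2 / (C + 1)) by rewrite lt_min ltr01 !divr_gt0.
have dfe := df _ e20; have c1 := cc _ r10; have c2 := cc _ r20.
near=> h.
have b1 : ball (c t) r1 (c (h *: 1 + t)) by near: h.
have b2 : ball (c t) r2 (c (h *: 1 + t)) by near: h.
have : `|f (c (h *: 1 + t)) - f (c t) - h *: w| <= Num.min 1 (e / 2 / (C + 1)) * `|h|.
  by near: h.
set D := c _ - c t; set F := f _ - f _ => Hh.
have := Hr1 _ _ b1 (ballxx _ r10); rewrite -/D -/F => H1.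
have := Hr2 _ _ b2 (ballxx _ r20); rewrite -/D -/F => H2.
have nF : `|F| <= (`|w| + 1) * `|h|.
  have -> : F = (F - h *: w) + h *: w by rewrite subrK.
  apply: le_trans (ler_normD _ _) _; rewrite normrZ mulrDl mul1r addrC mulrC lerD2l.
  by apply: le_trans Hh _; rewrite ler_piMl// ge_min lexx.
have nD : `|D| <= M * `|h|.
  have : `|D| <= `|F *m G| + `|D| / 2.
    have {1}-> : D = F *m G - (F *m G - D) by rewrite opprB addrC subrK.
    apply: le_trans (ler_normB _ _) _; rewrite lerD2l.
    by apply: le_trans H1 _; rewrite mul1r mulrC.
  have := HC F => HCF.
  have : C * `|F| <= C * ((`|w| + 1) * `|h|) by rewrite ler_wpM2l.
  rewrite /M; have := normr_ge0 h; nra.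
have -> : D - h *: (w *m G) = (F - h *: w) *m G - (F *m G - D).
  by rewrite mulmxBl -scalemxAl; apply/rowP => j; rewrite !mxE; ring.
apply: le_trans (ler_normB _ _) _; rewrite [e]splitr mulrDl; apply: lerD.
  apply: le_trans (HC _) _; apply: (@le_trans _ _ ((C + 1) * (e / 2 / (C + 1) * `|h|))).
    apply: ler_pM => //; first by rewrite lerDl.
    by apply: le_trans Hh _; rewrite ler_wpM2r// ge_min lexx orbT.
  by rewrite mulrA mulrCA divff ?mulr1// gt_eqF.
apply: le_trans H2 _; apply: (@le_trans _ _ (e / 2 / M * (M * `|h|))).
  by apply: ler_wpM2l => //; exact: ltW.
by rewrite mulrA divfK// gt_eqF.
Unshelve. all: by end_near. Qed.

End LocalInverse.

Section InverseFunction.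
Context {R : realType} {d : nat}.
Local Notation V := 'rV[R]_d.

(** A point [p] of the closed ball of radius [r / 2] that minimizes the distance from [f p] to [y]
    is a solution: the Newton step [p + (y - f p)] stays in the ball and at least halves the
    distance. *)
Lemma inverse_function (f : V -> V) u0 r : 0 < r ->
  (forall u u', ball u0 r u -> ball u0 r u' ->
    `|f u - f u' - (u - u')| <= 1 / 2 * `|u - u'|) ->
  (forall u, ball u0 r u -> {for u, continuous f}) ->
  forall y, `|y - f u0| <= r / 16 -> exists2 u, `|u - u0| <= r / 2 & f u = y.
Proof.
move=> r0 Hf cf y hy.
have r20 : 0 < r / 2 by rewrite divr_gt0.
pose U : set V := closed_ball u0 (r / 2).
have UE u : U u <-> `|u - u0| <= r / 2.
  by rewrite /U closed_ballE// /closed_ball_ /= distrC.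
have Ub u : U u -> ball u0 r u.
  by move=> /UE h; rewrite -ball_normE /= distrC; apply: le_lt_trans h _; lra.
have U0 : U u0 by apply/UE; rewrite subrr normr0 ltW.
have cU : compact U.
  apply: bounded_closed_compact; last exact: closed_ball_closed.
  exists (r / 2 + `|u0|); split; first exact: num_real.
  move=> M hM u /UE h; apply: le_trans (ltW hM).
  by rewrite -[u](subrK u0); apply: le_trans (ler_normD _ _) _; rewrite lerD2r.
have cU' : {within U, continuous (fun u => `|f u - y|)}.
  apply: continuous_in_subspaceT => u /set_mem /Ub bu.
  apply: (@continuous_comp _ _ _ (fun u => f u - y) (@Num.norm _ _)); last exact: norm_continuous.
  by apply: continuousB; [exact: cf|exact: cst_continuous].
have neU : U !=set0 by exists u0.
have [p /set_mem Up pmin] := EVT_min_rV neU cU cU'.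
have bp := Ub _ Up; have b0 := Ub _ U0.
have hp : `|f p - y| <= r / 16.
  by apply: le_trans (pmin u0 (mem_set U0)) _; rewrite distrC.
(* Two bounds [r / 16] add up to [r / 8], doubled by the Lipschitz error 1/2. This leaves room in
   the ball for a step of length [r / 16]. *)
have pu0 : `|p - u0| <= r / 4.
  have := Hf _ _ bp b0.
  have : `|p - u0| <= `|f p - f u0| + `|f p - f u0 - (p - u0)|.
    have {1}-> : p - u0 = (f p - f u0) - (f p - f u0 - (p - u0)).
      by apply/rowP => j; rewrite !mxE; ring.
    exact: ler_normB.
  have : `|f p - f u0| <= `|f p - y| + `|y - f u0|.
    have -> : f p - f u0 = (f p - y) + (y - f u0) by rewrite addrA subrK.
    exact: ler_normD.
  lra.
pose q := p + (y - f p).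
have Uq : U q.
  apply/UE; rewrite /q addrAC; apply: le_trans (ler_normD _ _) _.
  by rewrite [X in _ + X]distrC; lra.
have := pmin q (mem_set Uq).
have := Hf _ _ (Ub _ Uq) bp.
have -> : f q - f p - (q - p) = f q - y.
  by rewrite /q; apply/rowP => j; rewrite !mxE; ring.
have -> : q - p = y - f p by rewrite /q addrAC subrr add0r.
rewrite (distrC y) => h1 h2; exists p; first exact/UE.
apply/eqP; rewrite -subr_eq0 -normr_le0; have := normr_ge0 (f p - y); lra.
Qed.

End InverseFunction.

(** * Gronwall's inequality *)

Section Gronwall.
Context {R : realType}.

(** [S t * expR (- C * t)] has nonpositive derivative and starts at 0, while [S] is nonnegative. *)
Lemma gronwall_zero (S dS : R -> R) (C : R) :
  (forall t : R, t \in `[0, 1] -> is_derive t 1 S (dS t)) ->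
  (forall t : R, t \in `[0, 1] -> 0 <= S t) ->
  (forall t : R, t \in `[0, 1] -> dS t <= C * S t) ->
  S 0 = 0 -> forall t : R, t \in `[0, 1] -> S t = 0.
Proof.
move=> dSE S0 Sle S00 t t01.
pose G s : R := S s * expR (- C * s).
have dG (s : R) : s \in `[0, 1] ->
    is_derive s 1 G ((dS s - C * S s) * expR (- C * s)).
  move=> s01; have dSs := dSE s s01.
  have de : is_derive s 1 (fun s : R => expR (- C * s)) (- C * expR (- C * s)).
    by apply: is_derive_eq; rewrite /GRing.scale /= mulr1 mulrC.
  by apply: is_derive_eq; rewrite /GRing.scale /=; ring.
have : G t <= G 0.
  have t0 : 0 <= t <= 1 by move: t01; rewrite in_itv.
  have sub01 (s : R) : s \in `[0, t] -> s \in `[0, 1].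
    rewrite !in_itv /= => /andP[-> st]; apply: le_trans st _.
    by case/andP: t0.
  apply: (@ler0_derive1_le_cc _ G 0 t) => //.
  - by move=> s /subset_itv_oo_cc /sub01 /dG [].
  - move=> s /subset_itv_oo_cc /sub01 s01.
    have [_ dGs] := dG s s01; rewrite derive1E dGs.
    by rewrite pmulr_lle0 ?expR_gt0// subr_le0 Sle.
  - apply: derivable_within_continuous => s /sub01 /dG []; done.
  - by rewrite in_itv /= lexx andbT; case/andP: t0.
  - by rewrite in_itv /= lexx; case/andP: t0.
  - by case/andP: t0.
rewrite /G S00 mul0r pmulr_lle0 ?expR_gt0// => Sle0.
by apply/eqP; rewrite eq_le Sle0 S0.
Qed.

End Gronwall.

(** * Closure properties of smooth functions and symmetry of second derivatives *)

Section Smoothness.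
Context {R : realType} {d : nat}.
Local Notation V := 'rV[R]_d.
Implicit Types (f g : V -> R) (Om : set V).

Lemma near_open_eq Om f g u : open Om -> Om u -> (forall t, Om t -> f t = g t) ->
  \forall t \near u, f t = g t.
Proof.
move=> oOm Omu fg; have : nbhs u Om by exact: open_nbhs_nbhs.
by apply: filterS.
Qed.

Lemma of_class_C_eq k Om f g : open Om -> (forall u, Om u -> f u = g u) ->
  of_class_C k Om f -> of_class_C k Om g.
Proof.
move=> oOm; elim: k f g => [|k IH] f g fg /=.
  move=> cf u Omu; apply/continuous_epsP => e e0.
  have /continuous_epsP /(_ e e0)[r r0 Hr] := cf u Omu.
  have /nbhs_ballP[r' /= r'0 Hr'] : nbhs u Om by exact: open_nbhs_nbhs.
  exists (Num.min r r'); first by rewrite lt_min r0.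
  move=> t; rewrite -ball_normE /= lt_min => /andP[h1 h2].
  by rewrite -!fg//; [apply: Hr|apply: Hr']; rewrite -ball_normE.
move=> Cf v; have [df Cdf] := Cf v; split.
  move=> u Omu; apply: near_eq_derivable (df u Omu).
  exact: near_open_eq oOm Omu fg.
apply: (IH ('D_v f)) => // u Omu.
by apply: near_eq_derive; exact: near_open_eq oOm Omu fg.
Qed.

Lemma of_class_C_sub k Om Om' f : Om' `<=` Om -> of_class_C k Om f -> of_class_C k Om' f.
Proof.
move=> sub; elim: k f => [|k IH] f /=; first by move=> cf u /sub /cf.
by move=> Cf v; have [df Cdf] := Cf v; split=> [u /sub /df //|]; exact: IH.
Qed.

Lemma of_class_CW k Om f : open Om -> of_class_C k.+1 Om f -> of_class_C k Om f.
Proof.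
move=> oOm; elim: k f => [|k IH] f Cf.
  by move=> u Omu; exact: C1_continuous oOm Omu Cf.
by move=> v; have [df Cdf] := Cf v; split=> //; exact: IH.
Qed.

Lemma of_class_C1 k Om f : open Om -> of_class_C k.+1 Om f -> of_class_C 1 Om f.
Proof.
by move=> oOm; elim: k => // k IH /(of_class_CW oOm); exact: IH.
Qed.

Lemma of_class_C_cst k Om (a : R) : of_class_C k Om (fun _ : V => a).
Proof.
elim: k a => [|k IH] a /=; first by move=> u _; exact: cst_continuous.
move=> v; split; first by move=> u _; exact: derivable_cst.
have -> : 'D_v (fun _ : V => a) = fun=> 0 by apply/funext => u; exact: derive_cst.
exact: IH.
Qed.

Lemma of_class_CD k Om f g : open Om ->
  of_class_C k Om f -> of_class_C k Om g -> of_class_C k Om (fun u => f u + g u).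
Proof.
move=> oOm; elim: k f g => [|k IH] f g Cf Cg /=.
  by move=> u Omu; apply: continuousD; [exact: Cf | exact: Cg].
move=> v; have [df Cdf] := Cf v; have [dg Cdg] := Cg v; split.
  by move=> u Omu; apply: derivableD; [exact: df | exact: dg].
apply: (@of_class_C_eq _ _ (fun u => 'D_v f u + 'D_v g u)) => //; last exact: IH.
by move=> u Omu; rewrite deriveD//; [exact: df | exact: dg].
Qed.

Lemma of_class_CM k Om f g : open Om ->
  of_class_C k Om f -> of_class_C k Om g -> of_class_C k Om (fun u => f u * g u).
Proof.
move=> oOm; elim: k f g => [|k IH] f g Cf Cg.
  by move=> u Omu; apply: continuousM; [exact: Cf | exact: Cg].
have Cf' := of_class_CW oOm Cf; have Cg' := of_class_CW oOm Cg.
move=> v; have [df Cdf] := Cf v; have [dg Cdg] := Cg v; split.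
  by move=> u Omu; apply: derivableM; [exact: df | exact: dg].
apply: (@of_class_C_eq _ _ (fun u => f u * 'D_v g u + g u * 'D_v f u)) => //.
  by move=> u Omu; rewrite deriveM//; [exact: df | exact: dg].
by apply: of_class_CD => //; exact: IH.
Qed.

Lemma of_class_CN k Om f : open Om -> of_class_C k Om f -> of_class_C k Om (fun u => - f u).
Proof.
move=> oOm Cf; apply: (@of_class_C_eq _ _ (fun u => -1 * f u)) => //.
  by move=> u _; rewrite mulN1r.
by apply: of_class_CM => //; exact: of_class_C_cst.
Qed.

(** The derivative is written with the inverse of [f] as a factor, to which the induction hypothesis
    one order lower applies. *)
Lemma of_class_CV k Om f : open Om -> (forall u, Om u -> f u != 0) ->
  of_class_C k Om f -> of_class_C k Om (fun u => (f u)^-1).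
Proof.
move=> oOm f0; elim: k => [|k IH] Cf.
  by move=> u Omu; apply: continuousV; [exact: f0 | exact: Cf].
have Cf' := IH (of_class_CW oOm Cf).
move=> v; have [df Cdf] := Cf v; split.
  by move=> u Omu; apply: derivableV; [exact: f0 | exact: df].
apply: (@of_class_C_eq _ _ (fun u => - ((f u)^-1 * (f u)^-1 * 'D_v f u))) => //.
  move=> u Omu; rewrite deriveV//; [|exact: f0|exact: df].
  by rewrite /GRing.scale /= -exprVn expr2 mulNr.
apply: of_class_CN => //; apply: of_class_CM => //; exact: of_class_CM.
Qed.

Lemma of_class_C_sqrt k Om f : open Om -> (forall u, Om u -> 0 < f u) ->
  of_class_C k Om f -> of_class_C k Om (fun u => Num.sqrt (f u)).
Proof.
move=> oOm f0; elim: k => [|k IH] Cf.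
  move=> u Omu; apply: (@continuous_comp _ _ _ f (@Num.sqrt R)); first exact: Cf.
  exact: sqrt_continuous.
have Cf' := IH (of_class_CW oOm Cf).
have dsq (u v : V) : Om u -> derivable f u v ->
    is_derive u v (fun u => Num.sqrt (f u)) ((2 * Num.sqrt (f u))^-1 * 'D_v f u).
  move=> Omu df.
  have d0 : is_derive (0 : R) 1 (fun t : R => f (t *: v + u)) ('D_v f u).
    by apply: is_derive_line; rewrite scale0r add0r; exact: derivableP.
  have f00 : f (0 *: v + u) = f u by rewrite scale0r add0r.
  have dsqrt : is_derive (f (0 *: v + u)) 1 (@Num.sqrt R) (2 * Num.sqrt (f u))^-1.
    by rewrite f00; apply: is_derive1_sqrt; exact: f0.
  have := @is_derive1_comp R (@Num.sqrt R) (fun t : R => f (t *: v + u)) 0 _ _ dsqrt d0.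
  move=> /is_derive_epsP H; apply/is_derive_epsP => e e0; have := H e e0.
  by apply: filterS => h /=; rewrite f00 addr0 [h *: (1 : R^o)]mulr1.
move=> v; have [df Cdf] := Cf v; split.
  by move=> u Omu; have [] := dsq u v Omu (df u Omu).
apply: (@of_class_C_eq _ _ (fun u => (2 * Num.sqrt (f u))^-1 * 'D_v f u)) => //.
  by move=> u Omu; have [_ ->] := dsq u v Omu (df u Omu).
apply: of_class_CM => //; apply: of_class_CV => //.
  by move=> u Omu; rewrite mulf_neq0// gt_eqF// sqrtr_gt0 f0.
by apply: of_class_CM => //; exact: of_class_C_cst.
Qed.

Lemma of_class_C_sum k Om (I : Type) (s : seq I) (P : pred I) (F : I -> V -> R) : open Om ->
  (forall i, P i -> of_class_C k Om (F i)) ->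
  of_class_C k Om (fun u => \sum_(i <- s | P i) F i u).
Proof.
move=> oOm HF; elim: s => [|i s IH].
  by apply: (of_class_C_eq oOm _ (of_class_C_cst k Om 0)) => u _; rewrite big_nil.
case Pi: (P i).
  apply: (of_class_C_eq oOm _ (of_class_CD oOm (HF i Pi) IH)) => u _.
  by rewrite big_cons Pi.
by apply: (of_class_C_eq oOm _ IH) => u _; rewrite big_cons Pi.
Qed.

Lemma of_class_C_prod k Om (I : Type) (s : seq I) (P : pred I) (F : I -> V -> R) : open Om ->
  (forall i, P i -> of_class_C k Om (F i)) ->
  of_class_C k Om (fun u => \prod_(i <- s | P i) F i u).
Proof.
move=> oOm HF; elim: s => [|i s IH].
  by apply: (of_class_C_eq oOm _ (of_class_C_cst k Om 1)) => u _; rewrite big_nil.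
case Pi: (P i).
  apply: (of_class_C_eq oOm _ (of_class_CM oOm (HF i Pi) IH)) => u _.
  by rewrite big_cons Pi.
by apply: (of_class_C_eq oOm _ IH) => u _; rewrite big_cons Pi.
Qed.

Lemma of_class_C_det k Om n (A : V -> 'M[R]_n) : open Om ->
  (forall i j, of_class_C k Om (fun u => A u i j)) ->
  of_class_C k Om (fun u => \det (A u)).
Proof.
move=> oOm CA; apply: of_class_C_sum => // s _; apply: of_class_CM => //.
  exact: of_class_C_cst.
by apply: of_class_C_prod => // i _; exact: CA.
Qed.

(** Cramer's rule expresses the entries through determinants, which are polynomial. *)
Lemma of_class_C_invmx k Om n (A : V -> 'M[R]_n) : open Om ->
  (forall u, Om u -> A u \in unitmx) ->
  (forall i j, of_class_C k Om (fun u => A u i j)) ->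
  forall i j, of_class_C k Om (fun u => invmx (A u) i j).
Proof.
move=> oOm uA CA i j.
apply: (@of_class_C_eq _ _ (fun u => (\det (A u))^-1 *
    ((-1) ^+ (j + i) * \det (row' j (col' i (A u)))))) => //.
  by move=> u Omu; rewrite /invmx uA// !mxE.
apply: of_class_CM => //.
  apply: of_class_CV => //; last exact: of_class_C_det.
  by move=> u /uA; rewrite unitmxE unitfE.
apply: of_class_CM => //; first exact: of_class_C_cst.
apply: of_class_C_det => // a b.
by apply: (of_class_C_eq oOm _ (CA _ _)) => u _; rewrite !mxE.
Qed.

(** The mean value theorem in direction [v] for the difference of [f] along [w], then in direction
    [w] for ['D_v f]. *)
Lemma second_difference f Om u v w r : open Om -> of_class_C 2 Om f ->
  0 < r -> ball u r `<=` Om -> forall h : R, 0 < h -> h * (`|v| + `|w|) < r ->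
  exists2 p, ball u r p &
    f (h *: v + (h *: w + u)) - f (h *: v + u) - (f (h *: w + u) - f u) =
    h * (h * 'D_w ('D_v f) p).
Proof.
move=> oOm Cf r0 rOm h h0 hr.
have inb (s t : R) : 0 <= s <= 1 -> 0 <= t <= 1 ->
    ball u r (t *: (h *: w) + (s *: (h *: v) + u)).
  move=> /andP[s0 s1] /andP[t0 t1]; rewrite -ball_normE /= addrA [_ + u]addrC opprD addrA subrr sub0r normrN.
  apply: le_lt_trans hr; apply: le_trans (ler_normD _ _) _.
  rewrite mulrDr addrC !normrZ (ger0_norm s0) (ger0_norm t0) (gtr0_norm h0).
  by apply: lerD; rewrite ler_piMl// mulr_ge0// ltW.
have C1f := of_class_C1 oOm Cf.
have [dv C1v] := Cf v; have [dw _] := C1v w.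
pose g x := f (h *: w + x) - f x.
have dsh x : Om (h *: w + x) -> is_derive x v (fun x => f (h *: w + x)) ('D_v f (h *: w + x)).
  move=> Omx; have /is_derive_epsP H := derivableP (dv _ Omx).
  apply/is_derive_epsP => e e0; have := H e e0; apply: filterS => k.
  by rewrite addrCA.
have dg x : Om x -> Om (h *: w + x) ->
    is_derive x v g ('D_v f (h *: w + x) - 'D_v f x).
  move=> Omx Omx'; have d1 := dsh x Omx'; have d2 := derivableP (dv _ Omx).
  exact: is_deriveB.
have hin (s : R) : 0 <= s <= 1 -> Om (s *: (h *: v) + u).
  by move=> s01; have := inb s 0 s01; rewrite lexx ler01 scale0r add0r => /(_ isT) /rOm.
have hin' (s : R) : 0 <= s <= 1 -> Om (h *: w + (s *: (h *: v) + u)).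
  by move=> s01; have := inb s 1 s01; rewrite lexx ler01 scale1r => /(_ isT) /rOm.
have [s s01|s s01] := @mean_value_direction R V g u (h *: v).
  by have [] := is_deriveZdir h (dg _ (hin s s01) (hin' s s01)).
have [_ ->] := is_deriveZdir h (dg _ (hin s s01) (hin' s s01)).
rewrite /g addrCA => ->.
have dwv x : Om x -> is_derive x (h *: w) ('D_v f) (h *: 'D_w ('D_v f) x).
  by move=> Omx; apply: is_deriveZdir; exact: derivableP (dw x Omx).
have [t t01|t t01 ->] := @mean_value_direction R V ('D_v f) (s *: (h *: v) + u) (h *: w).
  by have [] := dwv _ (rOm _ (inb s t s01 t01)).
exists (t *: (h *: w) + (s *: (h *: v) + u)); first exact: inb.
by have [_ ->] := dwv _ (rOm _ (inb s t s01 t01)).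
Qed.

(** The second difference is symmetric in [v] and [w], so the mixed derivatives agree at points [p]
    and [q] arbitrarily near [u]; their continuity gives equality at [u]. *)
Lemma derive_comm f Om u v w : open Om -> Om u -> of_class_C 2 Om f ->
  'D_v ('D_w f) u = 'D_w ('D_v f) u.
Proof.
move=> oOm Omu Cf; apply/eqP; rewrite -subr_eq0 -normr_le0; apply/ler_addgt0Pl => e e0.
rewrite addr0.
have e20 : 0 < e / 2 by rewrite divr_gt0.
have [_ /(_ w) [_ c1]] := Cf v; have [_ /(_ v) [_ c2]] := Cf w.
have /continuous_epsP /(_ _ e20) [r1 r10 H1] := c1 u Omu.
have /continuous_epsP /(_ _ e20) [r2 r20 H2] := c2 u Omu.
have /nbhs_ballP[r3 /= r30 H3] : nbhs u Om by exact: open_nbhs_nbhs.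
pose r := Num.min r1 (Num.min r2 r3).
have r0 : 0 < r by rewrite !lt_min r10 r20.
pose h := r / (`|v| + `|w| + 1).
have vw0 : 0 < `|v| + `|w| + 1 by rewrite ltr_wpDl// addr_ge0.
have h0 : 0 < h by rewrite divr_gt0.
have hr : h * (`|v| + `|w|) < r.
  by rewrite /h mulrAC ltr_pdivrMr// ltr_pM2l// ltrDl.
have rOm : ball u r `<=` Om.
  by move=> t bt; apply: H3; apply: le_ball bt; rewrite /r !ge_min lexx !orbT.
have [p bp Ep] := second_difference oOm Cf r0 rOm h0 hr.
have [|q bq] := @second_difference f Om u w v r oOm Cf r0 rOm h h0.
  by rewrite addrC.
rewrite addrCA.
have -> : f (h *: v + (h *: w + u)) - f (h *: w + u) - (f (h *: v + u) - f u) =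
  f (h *: v + (h *: w + u)) - f (h *: v + u) - (f (h *: w + u) - f u) by ring.
rewrite Ep => /(mulfI (lt0r_neq0 h0)) /(mulfI (lt0r_neq0 h0)) pq.
have {}H1 : `|'D_w ('D_v f) u - 'D_w ('D_v f) p| <= e / 2.
  by apply: H1; apply: le_ball bp; rewrite /r ge_min lexx.
have {}H2 : `|'D_v ('D_w f) u - 'D_v ('D_w f) q| <= e / 2.
  by apply: H2; apply: le_ball bq; rewrite /r !ge_min lexx !orbT.
have key (a b c : R) : `|a - c| <= e / 2 -> `|b - c| <= e / 2 -> `|a - b| <= e.
  move=> ac bc; have -> : a - b = (a - c) - (b - c) by rewrite opprB addrA subrK.
  by apply: le_trans (ler_normB _ _) _; rewrite [leRHS]splitr lerD.
by rewrite pq in H1; exact: key H2 H1.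
Qed.

End Smoothness.

(** * Smooth matrix-valued maps *)

Section ComplexDerivative.
Context {R : realType} {V : normedModType R}.
Local Notation C := (R[i]).
Implicit Types (f g : V -> C) (u v : V).

(** A relation instead of a function: the sum and product rules then carry existence and value of
    the derivative together. The domain is any normed module, so that the same rules serve charts
    and curves. *)
Definition cder f u v (z : C) : Prop :=
  is_derive u v (fun t => complex.Re (f t)) (complex.Re z) /\
  is_derive u v (fun t => complex.Im (f t)) (complex.Im z).

Definition mxder p q (F : V -> 'M[C]_(p, q)) u v (Z : 'M[C]_(p, q)) : Prop :=
  forall i j, cder (fun t => F t i j) u v (Z i j).

Lemma ReD_complex (x y : C) : complex.Re (x + y) = complex.Re x + complex.Re y.
Proof. by case: x y => [a b] [c e]. Qed.

Lemma ImD_complex (x y : C) : complex.Im (x + y) = complex.Im x + complex.Im y.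
Proof. by case: x y => [a b] [c e]. Qed.

Lemma ReM_complex (x y : C) : complex.Re (x * y) =
  complex.Re x * complex.Re y - complex.Im x * complex.Im y.
Proof. by case: x y => [a b] [c e]. Qed.

Lemma ImM_complex (x y : C) : complex.Im (x * y) =
  complex.Re x * complex.Im y + complex.Im x * complex.Re y.
Proof. by case: x y => [a b] [c e]. Qed.

Lemma ReN_complex (x : C) : complex.Re (- x) = - complex.Re x.
Proof. by case: x. Qed.

Lemma ImN_complex (x : C) : complex.Im (- x) = - complex.Im x.
Proof. by case: x. Qed.

Lemma Re_conj_complex (x : C) : complex.Re (x^*)%R = complex.Re x.
Proof. by case: x. Qed.

Lemma Im_conj_complex (x : C) : complex.Im (x^*)%R = - complex.Im x.
Proof. by case: x. Qed.

Lemma is_derive_ext (f g : V -> R) u v l l' :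
  f =1 g -> l = l' -> is_derive u v f l -> is_derive u v g l'.
Proof. by move=> /funext -> ->. Qed.

Lemma is_derive_addf (f g : V -> R) u v a b : is_derive u v f a -> is_derive u v g b ->
  is_derive u v (fun t => f t + g t) (a + b).
Proof. by move=> df dg; have := @is_deriveD _ _ _ f g u v a b df dg. Qed.

Lemma is_derive_oppf (f : V -> R) u v a : is_derive u v f a ->
  is_derive u v (fun t => - f t) (- a).
Proof. by move=> df; have := @is_deriveN _ _ _ f u v a df. Qed.

Lemma is_derive_mulf (f g : V -> R) u v a b : is_derive u v f a -> is_derive u v g b ->
  is_derive u v (fun t => f t * g t) (a * g u + f u * b).
Proof.
move=> df dg; have := @is_deriveM _ _ f g u v a b df dg.
by apply: is_derive_ext => //; rewrite /GRing.scale /= addrC mulrC.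
Qed.

Lemma cder_ext f g u v z z' : f =1 g -> z = z' -> cder f u v z -> cder g u v z'.
Proof. by move=> /funext -> ->. Qed.

Lemma cder_cst (a : C) u v : cder (fun _ => a) u v 0.
Proof. by split; exact: is_derive_cst. Qed.

Lemma cderD f g u v z w : cder f u v z -> cder g u v w ->
  cder (fun t => f t + g t) u v (z + w).
Proof.
move=> [f1 f2] [g1 g2]; split.
- apply: is_derive_ext (is_derive_addf f1 g1) => [t|]; by rewrite ReD_complex.
- apply: is_derive_ext (is_derive_addf f2 g2) => [t|]; by rewrite ImD_complex.
Qed.

Lemma cderM f g u v z w : cder f u v z -> cder g u v w ->
  cder (fun t => f t * g t) u v (z * g u + f u * w).
Proof.
move=> [f1 f2] [g1 g2]; split.
- apply: is_derive_ext (is_derive_addf (is_derive_mulf f1 g1)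
    (is_derive_oppf (is_derive_mulf f2 g2))) => [t|]; first by rewrite ReM_complex.
  by rewrite ReD_complex !ReM_complex; ring.
- apply: is_derive_ext (is_derive_addf (is_derive_mulf f1 g2) (is_derive_mulf f2 g1))
    => [t|]; first by rewrite ImM_complex.
  by rewrite ImD_complex !ImM_complex; ring.
Qed.

Lemma cder_conj f u v z : cder f u v z -> cder (fun t => ((f t)^*)%R) u v (z^*)%R.
Proof.
move=> [f1 f2]; split.
- by apply: is_derive_ext f1 => [t|]; rewrite Re_conj_complex.
- by apply: is_derive_ext (is_derive_oppf f2) => [t|]; rewrite Im_conj_complex.
Qed.

Lemma cder_sum (I : Type) (s : seq I) (P : pred I) (F : I -> V -> C) (Z : I -> C) u v :
  (forall i, cder (F i) u v (Z i)) ->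
  cder (fun t => \sum_(i <- s | P i) F i t) u v (\sum_(i <- s | P i) Z i).
Proof.
move=> HF; elim: s => [|i s IH].
  by apply: cder_ext (cder_cst 0 u v) => [t|]; rewrite big_nil.
case Pi: (P i).
  by apply: cder_ext (cderD (HF i) IH) => [t|]; rewrite big_cons Pi.
by apply: cder_ext IH => [t|]; rewrite big_cons Pi.
Qed.

Lemma cder_unique f u v z w : cder f u v z -> cder f u v w -> z = w.
Proof.
move=> [[_ f1] [_ f2]] [[_ g1] [_ g2]].
by case: z w f1 f2 g1 g2 => [a b] [c e] /= -> -> -> ->.
Qed.

Lemma mxder_ext p q (F G : V -> 'M[C]_(p, q)) u v Z Z' :
  F =1 G -> Z = Z' -> mxder F u v Z -> mxder G u v Z'.
Proof. by move=> /funext -> ->. Qed.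

Lemma mxder_cst p q (A : 'M[C]_(p, q)) u v : mxder (fun _ => A) u v 0.
Proof. by move=> i j; rewrite mxE; exact: cder_cst. Qed.

Lemma mxderD p q (F G : V -> 'M[C]_(p, q)) u v Z W :
  mxder F u v Z -> mxder G u v W -> mxder (fun t => F t + G t) u v (Z + W).
Proof.
move=> dF dG i j.
by apply: cder_ext (cderD (dF i j) (dG i j)) => [t|]; rewrite mxE.
Qed.

Lemma mxderM p q r (F : V -> 'M[C]_(p, q)) (G : V -> 'M[C]_(q, r)) u v Z W :
  mxder F u v Z -> mxder G u v W ->
  mxder (fun t => F t *m G t) u v (Z *m G u + F u *m W).
Proof.
move=> dF dG i j.
apply: (@cder_ext (fun t => \sum_k F t i k * G t k j) _ u v
  (\sum_k (Z i k * G u k j + F u i k * W k j))).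
- by move=> t; rewrite mxE.
- by rewrite !mxE big_split.
- by apply: cder_sum => k; exact: cderM.
Qed.

Lemma mxderMl p q r (A : 'M[C]_(p, q)) (G : V -> 'M[C]_(q, r)) u v W :
  mxder G u v W -> mxder (fun t => A *m G t) u v (A *m W).
Proof.
by move=> dG; apply: mxder_ext (mxderM (mxder_cst A u v) dG); rewrite ?mul0mx ?add0r.
Qed.

Lemma mxderMr p q r (F : V -> 'M[C]_(p, q)) (A : 'M[C]_(q, r)) u v Z :
  mxder F u v Z -> mxder (fun t => F t *m A) u v (Z *m A).
Proof.
by move=> dF; apply: mxder_ext (mxderM dF (mxder_cst A u v)); rewrite ?mulmx0 ?addr0.
Qed.

Lemma mxderZ p q (f : V -> C) (F : V -> 'M[C]_(p, q)) u v z Z :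
  cder f u v z -> mxder F u v Z ->
  mxder (fun t => f t *: F t) u v (z *: F u + f u *: Z).
Proof.
move=> df dF i j.
by apply: cder_ext (cderM df (dF i j)) => [t|]; rewrite !mxE.
Qed.

Lemma mxderZl p q (a : C) (F : V -> 'M[C]_(p, q)) u v Z :
  mxder F u v Z -> mxder (fun t => a *: F t) u v (a *: Z).
Proof.
by move=> dF; apply: mxder_ext (mxderZ (cder_cst a u v) dF); rewrite ?scale0r ?add0r.
Qed.

Lemma mxderN p q (F : V -> 'M[C]_(p, q)) u v Z :
  mxder F u v Z -> mxder (fun t => - F t) u v (- Z).
Proof.
by move=> /(@mxderZl _ _ (-1)); apply: mxder_ext => [t|]; rewrite scaleN1r.
Qed.

Lemma mxderB p q (F G : V -> 'M[C]_(p, q)) u v Z W :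
  mxder F u v Z -> mxder G u v W -> mxder (fun t => F t - G t) u v (Z - W).
Proof. by move=> dF dG; apply: mxderD => //; exact: mxderN. Qed.

Lemma mxder_adj p q (F : V -> 'M[C]_(p, q)) u v Z :
  mxder F u v Z -> mxder (fun t => (F t) ^t*) u v (Z ^t*).
Proof.
move=> dF i j.
by apply: cder_ext (cder_conj (dF j i)) => [t|]; rewrite !mxE.
Qed.

Lemma mxder_map_conj p q (F : V -> 'M[C]_(p, q)) u v Z :
  mxder F u v Z -> mxder (fun t => map_mx conjc (F t)) u v (map_mx conjc Z).
Proof.
move=> dF i j.
by apply: cder_ext (cder_conj (dF i j)) => [t|]; rewrite !mxE.
Qed.

Lemma cder_tr n (F : V -> 'M[C]_n) u v Z :
  mxder F u v Z -> cder (fun t => \tr (F t)) u v (\tr Z).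
Proof. by move=> dF; apply: cder_sum => i; exact: dF. Qed.

Lemma mxder_unique p q (F : V -> 'M[C]_(p, q)) u v Z W :
  mxder F u v Z -> mxder F u v W -> Z = W.
Proof. by move=> dZ dW; apply/matrixP => i j; exact: cder_unique (dZ i j) (dW i j). Qed.

Lemma mxder_near p q (F G : V -> 'M[C]_(p, q)) u v Z :
  (\forall t \near u, F t = G t) -> mxder F u v Z -> mxder G u v Z.
Proof.
move=> FG dF i j; have [d1 d2] := dF i j; split.
  by apply: near_eq_is_derive d1; apply: filterS FG => t ->.
by apply: near_eq_is_derive d2; apply: filterS FG => t ->.
Qed.

Lemma is_derive_g m (F G : V -> 'M[C]_m.+1) u v Z W :
  mxder F u v Z -> mxder G u v W ->
  is_derive u v (fun t => g (F t) (G t)) (g Z (G u) + g (F u) W).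
Proof.
move=> dF dG; have [d1 _] := cder_tr (mxderM dF dG).
rewrite /Defs.g -mulrDl -ReD_complex -mxtraceD.
have := is_deriveZ (2^-1) d1.
apply: is_derive_ext => [t|]; last by rewrite mulrC.
by rewrite mulrC.
Qed.

End ComplexDerivative.

Section SmoothMatrix.
Context {R : realType} {d : nat}.
Local Notation V := 'rV[R]_d.
Local Notation C := (R[i]).
Local Notation e_ j := (delta_mx 0 j : V).
Implicit Types (Om : set V).

Definition csmooth Om (f : V -> C) : Prop := forall k,
  of_class_C k Om (fun u => complex.Re (f u)) /\ of_class_C k Om (fun u => complex.Im (f u)).

Definition mxsmooth p q Om (F : V -> 'M[C]_(p, q)) : Prop :=
  forall i j, csmooth Om (fun u => F u i j).

Lemma smooth_onE n Om (F : V -> 'M[C]_n) : smooth_on Om F <-> mxsmooth Om F.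
Proof. by split=> [H i j k|H k i j]; exact: H. Qed.

Lemma csmooth_eq Om f g : open Om -> (forall u, Om u -> f u = g u) ->
  csmooth Om f -> csmooth Om g.
Proof.
move=> oOm fg Cf k; have [c1 c2] := Cf k; split.
  by apply: (of_class_C_eq oOm _ c1) => u /fg ->.
by apply: (of_class_C_eq oOm _ c2) => u /fg ->.
Qed.

Lemma csmooth_sub Om Om' f : Om' `<=` Om -> csmooth Om f -> csmooth Om' f.
Proof. by move=> sub Cf k; have [c1 c2] := Cf k; split; exact: of_class_C_sub sub _. Qed.

Lemma csmooth_cst Om (a : C) : csmooth Om (fun _ => a).
Proof. by move=> k; split; exact: of_class_C_cst. Qed.

Lemma csmooth_real Om (f : V -> R) : open Om -> (forall k, of_class_C k Om f) ->
  csmooth Om (fun u => (f u)%:C).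
Proof. by move=> oOm Cf k; split; [exact: Cf|exact: of_class_C_cst]. Qed.

Lemma csmoothD Om f g : open Om -> csmooth Om f -> csmooth Om g ->
  csmooth Om (fun u => f u + g u).
Proof.
move=> oOm Cf Cg k; have [f1 f2] := Cf k; have [g1 g2] := Cg k; split.
  by apply: (of_class_C_eq oOm _ (of_class_CD oOm f1 g1)) => u _; rewrite ReD_complex.
by apply: (of_class_C_eq oOm _ (of_class_CD oOm f2 g2)) => u _; rewrite ImD_complex.
Qed.

Lemma csmoothM Om f g : open Om -> csmooth Om f -> csmooth Om g ->
  csmooth Om (fun u => f u * g u).
Proof.
move=> oOm Cf Cg k; have [f1 f2] := Cf k; have [g1 g2] := Cg k; split.
  apply: (of_class_C_eq oOm _ (of_class_CD oOm (of_class_CM oOm f1 g1)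
    (of_class_CN oOm (of_class_CM oOm f2 g2)))) => u _; by rewrite ReM_complex.
apply: (of_class_C_eq oOm _ (of_class_CD oOm (of_class_CM oOm f1 g2)
  (of_class_CM oOm f2 g1))) => u _; by rewrite ImM_complex.
Qed.

Lemma csmooth_conj Om f : open Om -> csmooth Om f -> csmooth Om (fun u => ((f u)^*)%R).
Proof.
move=> oOm Cf k; have [f1 f2] := Cf k; split.
  by apply: (of_class_C_eq oOm _ f1) => u _; rewrite Re_conj_complex.
by apply: (of_class_C_eq oOm _ (of_class_CN oOm f2)) => u _; rewrite Im_conj_complex.
Qed.

Lemma csmooth_sum Om (I : Type) (s : seq I) (F : I -> V -> C) : open Om ->
  (forall i, csmooth Om (F i)) -> csmooth Om (fun u => \sum_(i <- s) F i u).
Proof.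
move=> oOm HF; elim: s => [|i s IH].
  by apply: (csmooth_eq oOm _ (csmooth_cst Om 0)) => u _; rewrite big_nil.
by apply: (csmooth_eq oOm _ (csmoothD oOm (HF i) IH)) => u _; rewrite big_cons.
Qed.

Lemma mxsmooth_eq p q Om (F G : V -> 'M[C]_(p, q)) : open Om ->
  (forall u, Om u -> F u = G u) -> mxsmooth Om F -> mxsmooth Om G.
Proof. by move=> oOm FG sF i j; apply: (csmooth_eq oOm _ (sF i j)) => u /FG ->. Qed.

Lemma mxsmooth_sub p q Om Om' (F : V -> 'M[C]_(p, q)) : Om' `<=` Om ->
  mxsmooth Om F -> mxsmooth Om' F.
Proof. by move=> sub sF i j; exact: csmooth_sub sub (sF i j). Qed.

Lemma mxsmooth_cst p q Om (A : 'M[C]_(p, q)) : mxsmooth Om (fun _ => A).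
Proof. by move=> i j; exact: csmooth_cst. Qed.

Lemma mxsmoothD p q Om (F G : V -> 'M[C]_(p, q)) : open Om ->
  mxsmooth Om F -> mxsmooth Om G -> mxsmooth Om (fun u => F u + G u).
Proof.
move=> oOm sF sG i j.
by apply: (csmooth_eq oOm _ (csmoothD oOm (sF i j) (sG i j))) => u _; rewrite mxE.
Qed.

Lemma mxsmoothM p q r Om (F : V -> 'M[C]_(p, q)) (G : V -> 'M[C]_(q, r)) : open Om ->
  mxsmooth Om F -> mxsmooth Om G -> mxsmooth Om (fun u => F u *m G u).
Proof.
move=> oOm sF sG i j.
apply: (@csmooth_eq Om (fun u => \sum_k F u i k * G u k j)) => //.
  by move=> u _; rewrite mxE.
by apply: csmooth_sum => // k; exact: csmoothM.
Qed.

Lemma mxsmoothZ p q Om f (F : V -> 'M[C]_(p, q)) : open Om ->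
  csmooth Om f -> mxsmooth Om F -> mxsmooth Om (fun u => f u *: F u).
Proof.
move=> oOm sf sF i j.
by apply: (csmooth_eq oOm _ (csmoothM oOm sf (sF i j))) => u _; rewrite mxE.
Qed.

Lemma mxsmoothN p q Om (F : V -> 'M[C]_(p, q)) : open Om ->
  mxsmooth Om F -> mxsmooth Om (fun u => - F u).
Proof.
move=> oOm sF; apply: (mxsmooth_eq oOm _ (mxsmoothZ oOm (csmooth_cst Om (-1)) sF)).
by move=> u _; rewrite scaleN1r.
Qed.

Lemma mxsmoothB p q Om (F G : V -> 'M[C]_(p, q)) : open Om ->
  mxsmooth Om F -> mxsmooth Om G -> mxsmooth Om (fun u => F u - G u).
Proof. by move=> oOm sF sG; apply: mxsmoothD => //; exact: mxsmoothN. Qed.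

Lemma mxsmooth_adj p q Om (F : V -> 'M[C]_(p, q)) : open Om ->
  mxsmooth Om F -> mxsmooth Om (fun u => (F u) ^t*).
Proof.
move=> oOm sF i j.
by apply: (csmooth_eq oOm _ (csmooth_conj oOm (sF j i))) => u _; rewrite !mxE.
Qed.

Lemma mxsmooth_map_conj p q Om (F : V -> 'M[C]_(p, q)) : open Om ->
  mxsmooth Om F -> mxsmooth Om (fun u => map_mx conjc (F u)).
Proof.
move=> oOm sF i j.
by apply: (csmooth_eq oOm _ (csmooth_conj oOm (sF i j))) => u _; rewrite !mxE.
Qed.

Lemma mxsmooth_sum p q Om (I : Type) (s : seq I) (F : I -> V -> 'M[C]_(p, q)) : open Om ->
  (forall i, mxsmooth Om (F i)) -> mxsmooth Om (fun u => \sum_(i <- s) F i u).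
Proof.
move=> oOm sF i j.
apply: (@csmooth_eq Om (fun u => \sum_(k <- s) F k u i j)) => //.
  by move=> u _; rewrite summxE.
by apply: csmooth_sum => // k; exact: sF.
Qed.

Lemma of_class_C_g m Om (F G : V -> 'M[C]_m.+1) : open Om ->
  mxsmooth Om F -> mxsmooth Om G -> forall k, of_class_C k Om (fun u => g (F u) (G u)).
Proof.
move=> oOm sF sG k.
have /(_ k)[H _] : csmooth Om (fun u => \tr (F u *m G u)).
  by apply: csmooth_sum => // i; exact: mxsmoothM.
by apply: of_class_CM => //; exact: of_class_C_cst.
Qed.

Lemma csmooth_cder Om f u v : open Om -> csmooth Om f -> Om u ->
  cder f u v ('D_v (fun t => complex.Re (f t)) u +i* 'D_v (fun t => complex.Im (f t)) u).
Proof.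
move=> oOm sf Omu; have [c1 c2] := sf 1%N.
by split; apply: derivableP; [have [df _] := c1 v|have [df _] := c2 v]; exact: df.
Qed.

Lemma mxsmooth_mxder n Om (F : V -> 'M[C]_n) u v : open Om -> mxsmooth Om F -> Om u ->
  mxder F u v (mxderive v F u).
Proof. by move=> oOm sF Omu i j; rewrite mxE; exact: csmooth_cder oOm (sF i j) Omu. Qed.

Lemma mxder_mxderive n (F : V -> 'M[C]_n) u v Z : mxder F u v Z -> mxderive v F u = Z.
Proof.
move=> dF; apply/matrixP => i j; rewrite mxE.
have [[_ ->] [_ ->]] := dF i j.
by case: (Z i j).
Qed.

Lemma mxsmooth_mxderive n Om (F : V -> 'M[C]_n) v : open Om -> mxsmooth Om F ->
  mxsmooth Om (mxderive v F).
Proof.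
move=> oOm sF i j k; have [c1 c2] := sF i j k.+1; split.
- have [_ H] := c1 v; apply: (of_class_C_eq oOm _ H) => u _; by rewrite mxE.
- have [_ H] := c2 v; apply: (of_class_C_eq oOm _ H) => u _; by rewrite mxE.
Qed.

Lemma mxderive_sum n Om (F : V -> 'M[C]_n) u v : open Om -> mxsmooth Om F -> Om u ->
  mxderive v F u = \sum_j (v 0 j)%:C *: mxderive (e_ j) F u.
Proof.
move=> oOm sF Omu; apply/matrixP => a b; rewrite summxE mxE.
have [c1 c2] := sF a b 1%N.
rewrite (deriveE_grad _ oOm Omu c1) (deriveE_grad _ oOm Omu c2) /grad.
have -> : \sum_k ((v 0 k)%:C *: mxderive (e_ k) F u) a b =
    \sum_k (v 0 k)%:C * ('D_(e_ k) (fun t => complex.Re (F t a b)) u +i*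
      'D_(e_ k) (fun t => complex.Im (F t a b)) u).
  by apply: eq_bigr => k _; rewrite !mxE.
apply/eqP; rewrite eq_complex; apply/andP; split; apply/eqP.
  rewrite (big_morph (@complex.Re R) (@ReD_complex R) (erefl 0 : complex.Re (0 : C) = 0)) /=.
  by apply: eq_bigr => j _; rewrite mul0r subr0.
rewrite (big_morph (@complex.Im R) (@ImD_complex R) (erefl 0 : complex.Im (0 : C) = 0)) /=.
by apply: eq_bigr => j _; rewrite mul0r addr0.
Qed.

Lemma mxderiveE n (F : V -> 'M[C]_n) u v a b : mxderive v F u a b =
  'D_v (fun t => complex.Re (F t a b)) u +i* 'D_v (fun t => complex.Im (F t a b)) u.
Proof. by rewrite mxE. Qed.

Lemma mxderive_comm n Om (F : V -> 'M[C]_n) u v w : open Om -> mxsmooth Om F -> Om u ->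
  mxderive v (mxderive w F) u = mxderive w (mxderive v F) u.
Proof.
move=> oOm sF Omu; apply/matrixP => a b.
have [c1 c2] := sF a b 2%N.
have E (x : V) : (fun t => complex.Re (mxderive x F t a b)) = 'D_x (fun t => complex.Re (F t a b)).
  by apply/funext => t; rewrite mxderiveE.
have E' (x : V) : (fun t => complex.Im (mxderive x F t a b)) = 'D_x (fun t => complex.Im (F t a b)).
  by apply/funext => t; rewrite mxderiveE.
rewrite [LHS]mxderiveE [RHS]mxderiveE (E w) (E v) (E' w) (E' v).
by rewrite (@derive_comm _ _ _ Om u v w oOm Omu c1) (@derive_comm _ _ _ Om u v w oOm Omu c2).
Qed.

Lemma mxder_comp_curve n Om (F : V -> 'M[C]_n) (c : R -> V) t v : open Om ->
  mxsmooth Om F -> Om (c t) -> is_derive t 1 c v ->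
  mxder (fun s => F (c s)) (t : R^o) 1 (mxderive v F (c t)).
Proof.
move=> oOm sF Omc dc a b; have [c1 c2] := sF a b 1%N; rewrite mxE; split => /=.
  by rewrite (deriveE_grad _ oOm Omc c1); exact: is_derive_comp_curve oOm Omc c1 dc.
by rewrite (deriveE_grad _ oOm Omc c2); exact: is_derive_comp_curve oOm Omc c2 dc.
Qed.

End SmoothMatrix.

(** * The geometry of the projective space at a point *)

Section MatrixWords.
Context {K : pzRingType}.

Lemma mulmx_word2 p n q r (A : 'M[K]_(n, q)) (B : 'M[K]_(q, r)) (D : 'M[K]_(n, r)) :
  A *m B = D -> forall X : 'M[K]_(p, n), X *m A *m B = X *m D.
Proof. by move=> <- X; rewrite mulmxA. Qed.

Lemma addmxE p q (A B : 'M[K]_(p, q)) i j : (A + B) i j = A i j + B i j.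
Proof. by rewrite mxE. Qed.

Lemma oppmxE p q (A : 'M[K]_(p, q)) i j : (- A) i j = - A i j.
Proof. by rewrite mxE. Qed.

Lemma scalemxE p q a (A : 'M[K]_(p, q)) i j : (a *: A) i j = a * A i j.
Proof. by rewrite mxE. Qed.

Lemma zeromxE p q i j : (0 : 'M[K]_(p, q)) i j = 0.
Proof. by rewrite mxE. Qed.

Lemma mxtraceN n (A : 'M[K]_n) : \tr (- A) = - \tr A.
Proof. by rewrite /mxtrace -sumrN; apply: eq_bigr => i _; rewrite mxE. Qed.

Lemma mxtraceB n (A B : 'M[K]_n) : \tr (A - B) = \tr A - \tr B.
Proof. by rewrite mxtraceD mxtraceN. Qed.

End MatrixWords.

Ltac mxexpand := rewrite ?(mulmxDl, mulmxDr, mulmxBl, mulmxBr, mulNmx, mulmxN,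
  mulmx1, mul1mx, mulmx0, mul0mx, mulmxA, addr0, add0r, subr0, sub0r, oppr0).

(** Each matrix product is an atom, so the goal becomes a linear identity entry by entry. *)
Ltac mxlinear := let i := fresh in let j := fresh in apply/matrixP => i j;
  rewrite ?(addmxE, oppmxE, scalemxE, zeromxE); ring.

Section HermitianMatrices.
Context {R : realType}.
Local Notation C := (R[i]).

Lemma adjmxM p q r (A : 'M[C]_(p, q)) (B : 'M[C]_(q, r)) :
  (A *m B) ^t* = B ^t* *m A ^t*.
Proof. by rewrite trmx_mul map_mxM. Qed.

Lemma adjmxD p q (A B : 'M[C]_(p, q)) : (A + B) ^t* = A ^t* + B ^t*.
Proof. by apply/matrixP => i j; rewrite !mxE rmorphD. Qed.

Lemma adjmxN p q (A : 'M[C]_(p, q)) : (- A) ^t* = - A ^t*.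
Proof. by apply/matrixP => i j; rewrite !mxE rmorphN. Qed.

Lemma adjmxB p q (A B : 'M[C]_(p, q)) : (A - B) ^t* = A ^t* - B ^t*.
Proof. by rewrite adjmxD adjmxN. Qed.

Lemma adjmxZ p q (a : C) (A : 'M[C]_(p, q)) : (a *: A) ^t* = (a^*)%R *: A ^t*.
Proof. by apply/matrixP => i j; rewrite !mxE rmorphM. Qed.

Lemma adjmxK p q (A : 'M[C]_(p, q)) : (A ^t*) ^t* = A.
Proof. by apply/matrixP => i j; rewrite !mxE conjCK. Qed.

Lemma adjmx1 n : (1%:M : 'M[C]_n) ^t* = 1%:M.
Proof. by apply/matrixP => i j; rewrite !mxE eq_sym; case: eqP => _; rewrite ?conjC0 ?conjC1. Qed.

Lemma tr_adjmx n (A : 'M[C]_n) : \tr (A ^t*) = ((\tr A)^*)%R.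
Proof. by rewrite /mxtrace rmorph_sum; apply: eq_bigr => i _; rewrite !mxE. Qed.

Lemma conj_realC (a : R) : ((a%:C)^*)%R = a%:C :> C.
Proof. exact: conjc_real. Qed.

Lemma conj_iC : ((Complex 0 1)^*)%R = - (Complex 0 1) :> C.
Proof. by apply/eqP; rewrite eq_complex /= oppr0 !eqxx. Qed.

Lemma sqr_iC : Complex 0 1 * Complex 0 1 = -1 :> C.
Proof. by apply/eqP; rewrite eq_complex /=; apply/andP; split; apply/eqP; ring. Qed.

Lemma Re_iCM (x : C) : complex.Re (Complex 0 1 * x) = - complex.Im x.
Proof. by case: x => a b /=; ring. Qed.

Lemma Re_realCM (a : R) (x : C) : complex.Re (a%:C * x) = a * complex.Re x.
Proof. by case: x => b c /=; ring. Qed.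

Lemma Re_sum (I : Type) (s : seq I) (P : pred I) (F : I -> C) :
  complex.Re (\sum_(i <- s | P i) F i) = \sum_(i <- s | P i) complex.Re (F i).
Proof. exact: (big_morph _ (@ReD_complex R) (erefl 0 : complex.Re (0 : C) = 0)). Qed.

Lemma ReM_conj (x : C) : complex.Re (x * (x^*)%R) = complex.Re x ^+ 2 + complex.Im x ^+ 2.
Proof. by case: x => a b /=; ring. Qed.

Lemma frobeniusE p q (A : 'M[C]_(p, q)) : complex.Re (\tr (A *m A ^t*)) =
  \sum_i \sum_j (complex.Re (A i j) ^+ 2 + complex.Im (A i j) ^+ 2).
Proof.
rewrite /mxtrace Re_sum; apply: eq_bigr => i _; rewrite mxE Re_sum.
by apply: eq_bigr => j _; rewrite !mxE ReM_conj.
Qed.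

Lemma frobenius_ge0 p q (A : 'M[C]_(p, q)) : 0 <= complex.Re (\tr (A *m A ^t*)).
Proof.
by rewrite frobeniusE; do 2!(apply: sumr_ge0 => ? _); rewrite addr_ge0// sqr_ge0.
Qed.

Lemma frobenius_entry p q (A : 'M[C]_(p, q)) i j :
  complex.Re (A i j) ^+ 2 + complex.Im (A i j) ^+ 2 <= complex.Re (\tr (A *m A ^t*)).
Proof.
rewrite frobeniusE (bigD1 i) //= (bigD1 j) //= -addrA lerDl addr_ge0//.
  by apply: sumr_ge0 => ? _; rewrite addr_ge0// sqr_ge0.
by do 2!(apply: sumr_ge0 => ? _); rewrite addr_ge0// sqr_ge0.
Qed.

Lemma frobenius_eq0 p q (A : 'M[C]_(p, q)) : complex.Re (\tr (A *m A ^t*)) = 0 -> A = 0.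
Proof.
move=> A0; apply/matrixP => i j; have := frobenius_entry A i j; rewrite A0 mxE => h.
have := sqr_ge0 (complex.Re (A i j)); have := sqr_ge0 (complex.Im (A i j)) => h1 h2.
have /eqP : complex.Re (A i j) ^+ 2 = 0 by lra.
have /eqP : complex.Im (A i j) ^+ 2 = 0 by lra.
rewrite !sqrf_eq0; case: (A i j) => a b /= /eqP -> /eqP ->.
by [].
Qed.

End HermitianMatrices.

Section Metric.
Context {R : realType} {m : nat}.
Local Notation C := (R[i]).
Local Notation E := ('M[C]_m.+1).
Implicit Types (X Y Z P n : E).

Lemma gC X Y : g X Y = g Y X.
Proof. by rewrite /g mxtrace_mulC. Qed.

Lemma gDl X Y Z : g (X + Y) Z = g X Z + g Y Z.
Proof. by rewrite /g mulmxDl mxtraceD ReD_complex mulrDl. Qed.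

Lemma gDr X Y Z : g Z (X + Y) = g Z X + g Z Y.
Proof. by rewrite ![g Z _]gC gDl. Qed.

Lemma gNl X Y : g (- X) Y = - g X Y.
Proof. by rewrite /g mulNmx mxtraceN ReN_complex mulNr. Qed.

Lemma gNr X Y : g X (- Y) = - g X Y.
Proof. by rewrite gC gNl gC. Qed.

Lemma gBl X Y Z : g (X - Y) Z = g X Z - g Y Z.
Proof. by rewrite gDl gNl. Qed.

Lemma gBr X Y Z : g Z (X - Y) = g Z X - g Z Y.
Proof. by rewrite gDr gNr. Qed.

Lemma gZl (a : R) X Y : g (a%:C *: X) Y = a * g X Y.
Proof. by rewrite /g -scalemxAl mxtraceZ Re_realCM mulrA. Qed.

Lemma gZr (a : R) X Y : g X (a%:C *: Y) = a * g X Y.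
Proof. by rewrite gC gZl gC. Qed.

Lemma g0l X : g 0 X = 0.
Proof. by rewrite /g mul0mx mxtrace0 mul0r. Qed.

Lemma g0r X : g X 0 = 0.
Proof. by rewrite gC g0l. Qed.

Lemma g_suml (I : Type) (s : seq I) (F : I -> E) Y :
  g (\sum_(i <- s) F i) Y = \sum_(i <- s) g (F i) Y.
Proof. exact: (big_morph (fun X => g X Y) (fun X Z => gDl X Z Y) (g0l Y)). Qed.

Lemma g_sumr (I : Type) (s : seq I) (F : I -> E) Y :
  g Y (\sum_(i <- s) F i) = \sum_(i <- s) g Y (F i).
Proof. by rewrite gC g_suml; apply: eq_bigr => i _; rewrite gC. Qed.

Lemma g_ge0 X : X ^t* = X -> 0 <= g X X.
Proof. by move=> hX; rewrite /g -{2}hX divr_ge0// frobenius_ge0. Qed.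

Lemma g_eq0 X : X ^t* = X -> g X X = 0 -> X = 0.
Proof.
move=> hX /eqP; rewrite /g mulf_eq0 invr_eq0 pnatr_eq0 orbF -{2}hX => /eqP.
exact: frobenius_eq0.
Qed.

Section AtPoint.
Variables (P : E).
Hypothesis (cpP : CP P).

Let hP : P ^t* = P. Proof. by case: cpP. Qed.
Let PP : P *m P = P. Proof. by case: cpP. Qed.
Let trP : \tr P = 1. Proof. by case: cpP. Qed.

(** A column [P e_k] with [P k k] nonzero is divided by its norm, the square root of [P k k]. The
    remainder [P - z z^*] is a Hermitian idempotent of trace 0, so its Frobenius norm vanishes. *)
Lemma CP_vector : exists2 z : 'cV[C]_m.+1, z ^t* *m z = 1%:M & P = z *m z ^t*.
Proof.
have [k Pk] : exists k, P k k != 0.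
  apply/existsP; rewrite -negb_forall; apply/negP => /forallP H.
  move: trP; rewrite /mxtrace big1; first by move/eqP; rewrite eq_sym oner_eq0.
  by move=> i _; apply/eqP; exact: H.
have Pkk : P k k = \sum_j `|P k j| ^+ 2.
  rewrite -{1}PP mxE; apply: eq_bigr => j _; rewrite normCK; congr (_ * _).
  by rewrite -{1}hP !mxE.
have Pk0 : 0 < P k k.
  by rewrite lt0r Pk Pkk sumr_ge0// => j _; rewrite exprn_ge0.
pose s := sqrtC (P k k).
have s0 : s != 0 by rewrite sqrtC_eq0.
have cs : ((s^-1)^*)%R = s^-1 by apply: geC0_conj; rewrite invr_ge0 sqrtC_ge0 ltW.
pose e : 'cV[C]_m.+1 := delta_mx k 0.
have eP : e ^t* *m P *m e = (P k k)%:M.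
  apply/matrixP => i j; rewrite !ord1.
  have -> : e ^t* = delta_mx 0 k.
    by apply/matrixP => a b; rewrite !mxE ord1 !eqxx /= andbT; case: eqP => _; rewrite ?conjC0 ?conjC1.
  by rewrite -colE -rowE !mxE.
pose z := s^-1 *: (P *m e).
have hz : z ^t* = s^-1 *: (e ^t* *m P).
  by rewrite adjmxZ adjmxM hP; congr (_ *: _); exact: cs.
have zz : z ^t* *m z = 1%:M.
  rewrite hz /z -scalemxAl -scalemxAr scalerA mulmxA -(mulmxA _ P P) PP eP.
  by rewrite scale_scalar_mx /s -expr2 exprVn sqrtCK mulVf.
have Pz : P *m z = z by rewrite /z -scalemxAr mulmxA PP.
have zP : z ^t* *m P = z ^t* by rewrite -{1}hP -adjmxM Pz.
exists z => //; apply/eqP; rewrite -subr_eq0; apply/eqP.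
apply: frobenius_eq0.
have hQ : (P - z *m z ^t*) ^t* = P - z *m z ^t* by rewrite adjmxB adjmxM adjmxK hP.
rewrite hQ mulmxBl !mulmxBr PP !mulmxA Pz -!(mulmxA _ _ P) zP -(mulmxA z _ z) zz.
rewrite mulmx1 subrr subr0 mxtraceB trP mxtrace_mulC zz mxtrace1.
by rewrite subrr.
Qed.

(** [P] has rank one. By this identity Hermitian products of vectors become traces, and no unit
    vector on the line has to be chosen. *)
Lemma CP_sandwich Z : P *m Z *m P = \tr (P *m Z) *: P.
Proof.
have [z zz ->] := CP_vector.
rewrite mulmxA -(mulmxA z) -(mulmxA z) [z ^t* *m Z *m z]mx11_scalar.
rewrite -mulmxA -scalemx1 -!scalemxAl mul1mx -scalemxAr; congr (_ *: _).
by rewrite mxtrace_mulC trace_mx11.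
Qed.

Lemma tangent_hermitian X : tangentCP P X -> X ^t* = X.
Proof. by case. Qed.

Lemma tangent_split X : tangentCP P X -> P *m X + X *m P = X.
Proof. by case. Qed.

Lemma tangent_PXP X : tangentCP P X -> P *m X *m P = 0.
Proof.
move=> [_ e]; have : P *m (P *m X + X *m P) *m P = P *m X *m P by rewrite e.
rewrite mulmxDr mulmxDl !mulmxA PP -!mulmxA PP !mulmxA => /eqP.
by rewrite -subr_eq0 addrK => /eqP.
Qed.

Lemma tangent0 : tangentCP P 0.
Proof. by split; [apply/matrixP => i j; rewrite !mxE conjC0|rewrite mulmx0 mul0mx addr0]. Qed.

Lemma tangentD X Y : tangentCP P X -> tangentCP P Y -> tangentCP P (X + Y).
Proof.
move=> [hX eX] [hY eY]; split; first by rewrite adjmxD hX hY.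
by rewrite mulmxDr mulmxDl addrACA eX eY.
Qed.

Lemma tangentZ (a : R) X : tangentCP P X -> tangentCP P (a%:C *: X).
Proof.
move=> [hX eX]; split; first by rewrite adjmxZ hX conj_realC.
by rewrite -scalemxAr -scalemxAl -scalerDr eX.
Qed.

Lemma tangentN X : tangentCP P X -> tangentCP P (- X).
Proof.
move=> [hX eX]; split; first by rewrite adjmxN hX.
by rewrite mulmxN mulNmx -opprD eX.
Qed.

Lemma tangentB X Y : tangentCP P X -> tangentCP P Y -> tangentCP P (X - Y).
Proof. by move=> tX tY; apply: tangentD => //; exact: tangentN. Qed.

Lemma tangent_sum (I : Type) (s : seq I) (F : I -> E) :
  (forall i, tangentCP P (F i)) -> tangentCP P (\sum_(i <- s) F i).
Proof. by move=> H; elim/big_ind: _ => //; [exact: tangent0|exact: tangentD]. Qed.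

Lemma JCPN X : JCP P (- X) = - JCP P X.
Proof. by rewrite /JCP mulNmx mulmxN -opprD scalerN. Qed.

Lemma JCPZ (a : C) X : JCP P (a *: X) = a *: JCP P X.
Proof. by rewrite /JCP -scalemxAl -scalemxAr -scalerBr !scalerA mulrC. Qed.

Lemma tangentJ X : tangentCP P X -> tangentCP P (JCP P X).
Proof.
move=> tX; have hX := tangent_hermitian tX; split.
  by rewrite /JCP adjmxZ adjmxB !adjmxM hP hX conj_iC scaleNr -scalerN opprB.
have PXP := tangent_PXP tX.
rewrite /JCP -scalemxAr -scalemxAl -scalerDr; congr (_ *: _).
by rewrite mulmxBr mulmxBl !mulmxA PP -!(mulmxA _ P P) PP PXP sub0r subr0 addrC.
Qed.

Lemma JCPK X : tangentCP P X -> JCP P (JCP P X) = - X.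
Proof.
move=> tX; have PXP := tangent_PXP tX.
rewrite {1}/JCP /JCP -scalemxAl -scalemxAr -scalerBr scalerA sqr_iC scaleN1r.
rewrite mulmxBr mulmxBl !mulmxA PP -!(mulmxA _ P P) PP PXP sub0r subr0 opprK.
by rewrite addrC tangent_split.
Qed.

Lemma gJl X Y : g (JCP P X) Y = - g X (JCP P Y).
Proof.
have e : \tr ((X *m P - P *m X) *m Y) = - \tr (X *m (Y *m P - P *m Y)).
  mxexpand; rewrite !mxtraceB.
  by rewrite -(mulmxA P X) [\tr (P *m _)]mxtrace_mulC opprB.
by rewrite /g /JCP -scalemxAl -scalemxAr !mxtraceZ e mulrN ReN_complex mulNr.
Qed.

Lemma gJJ X Y : tangentCP P X -> g (JCP P X) (JCP P Y) = g X Y.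
Proof. by move=> tX; rewrite gC gJl JCPK// gNr opprK gC. Qed.

Lemma gXJX X : g X (JCP P X) = 0.
Proof. by have := gJl X X; rewrite gC => h; lra. Qed.

Lemma projCP_tangent Z : Z ^t* = Z -> tangentCP P (projCP P Z).
Proof.
move=> hZ; split; rewrite /projCP.
  rewrite adjmxD !adjmxM !adjmxB adjmx1 hP hZ addrC; congr (_ + _); exact: mulmxA.
mxexpand; rewrite ?(PP, mulmx_word2 PP); mxlinear.
Qed.

Lemma g_projCP Z Y : tangentCP P Y -> g (projCP P Z) Y = g Z Y.
Proof.
move=> tY; rewrite /g /projCP; congr (complex.Re _ / _).
mxexpand; rewrite -[in RHS](tangent_split tY); mxexpand.
rewrite !(mxtraceD, mxtraceN).
have -> : \tr (P *m Z *m P *m Y) = 0.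
  by rewrite -!mulmxA mxtrace_mulC -!mulmxA (mulmxA P) tangent_PXP// mulmx0 mxtrace0.
have -> : \tr (P *m Z *m Y) = \tr (Z *m Y *m P) by rewrite -mulmxA mxtrace_mulC.
by rewrite !oppr0 !addr0 addrC.
Qed.

End AtPoint.

End Metric.

Section TraceIdentities.
Context {K : comPzRingType} {n : nat}.
Implicit Types (N X Y P Z B : 'M[K]_n).

Lemma trace_bracket N X Y : \tr ((Y *m N + N *m Y) *m (N *m X - X *m N)) =
  \tr (N *m N *m (X *m Y - Y *m X)).
Proof.
rewrite mulmxDl !mulmxBr !mxtraceD !mxtraceN !mulmxA.
have -> : \tr (Y *m N *m X *m N) = \tr (N *m Y *m N *m X).
  by rewrite [LHS]mxtrace_mulC !mulmxA.
have -> : \tr (Y *m N *m N *m X) = \tr (N *m N *m X *m Y).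
  by rewrite -!mulmxA [LHS]mxtrace_mulC -!mulmxA.
have -> : \tr (N *m Y *m X *m N) = \tr (N *m N *m Y *m X).
  by rewrite [LHS]mxtrace_mulC !mulmxA.
ring.
Qed.

Lemma trace_offdiag P Z B : P *m B = 0 -> B *m P = 0 -> \tr ((P *m Z + Z *m P) *m B) = 0.
Proof.
move=> PB BP; rewrite mulmxDl mxtraceD -(mulmxA Z) PB mulmx0.
by rewrite -mulmxA mxtrace_mulC -mulmxA BP mulmx0 !mxtrace0 addr0.
Qed.

Lemma trace_commutator P X Y :
  \tr ((X *m P - P *m X) *m Y) = - \tr (P *m (X *m Y - Y *m X)).
Proof.
rewrite mulmxBl mulmxBr !mxtraceB opprB !mulmxA; congr (_ - _).
by rewrite -[in LHS]mulmxA [LHS]mxtrace_mulC.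
Qed.

End TraceIdentities.

(** * A unit normal at a point, its complex line and its derivative *)

Section UnitNormalAtPoint.
Context {R : realType} {m : nat}.
Local Notation C := (R[i]).
Local Notation E := ('M[C]_m.+1).
Implicit Types (X Y Z : E).

Variables (P n : E).
Hypotheses (cpP : CP P) (tn : tangentCP P n) (gnn : g n n = 1).

Let hP : P ^t* = P. Proof. by case: cpP. Qed.
Let PP : P *m P = P. Proof. by case: cpP. Qed.
Let hn : n ^t* = n. Proof. exact: tangent_hermitian tn. Qed.
Let nE : P *m n + n *m P = n. Proof. exact: tangent_split tn. Qed.
Let PnP : P *m n *m P = 0. Proof. exact (tangent_PXP cpP tn). Qed.

(* If [P = z z^*], the orthogonal projection onto the complex line of [n *m z]. *)
Definition normal_line : E := n *m P *m n.
Local Notation W := normal_line.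

Lemma tr_Pnn : \tr (P *m n *m n) = 1.
Proof.
have : complex.Re (\tr (n *m n)) = 2.
  by move: gnn; rewrite /g => /(canRL (divfK _)) -> //; rewrite mul1r.
have -> : \tr (n *m n) = \tr (P *m n *m n) + \tr (P *m n *m n).
  rewrite -{1}nE mulmxDl mxtraceD; congr (_ + _).
  by rewrite mxtrace_mulC mulmxA mxtrace_mulC mulmxA.
have : ((\tr (P *m n *m n))^*)%R = \tr (P *m n *m n).
  by rewrite -tr_adjmx !adjmxM hn hP mulmxA mxtrace_mulC mulmxA.
case: (\tr _) => a b [] /= ib h; apply/eqP; rewrite eq_complex /=.
by apply/andP; split; apply/eqP; lra.
Qed.

Lemma Pnn : P *m n *m n = P.
Proof.
have : P *m (n *m n) *m P = P by rewrite CP_sandwich// mulmxA tr_Pnn scale1r.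
have : P *m n *m (P *m n + n *m P) = P *m (n *m n) *m P.
  by mxexpand; rewrite PnP mul0mx add0r.
by rewrite nE => -> ->.
Qed.

Lemma nnP : n *m n *m P = P.
Proof. by rewrite -[RHS]hP -{2}Pnn !adjmxM hn hP mulmxA. Qed.

Lemma normal_lineP : W *m P = 0.
Proof. by rewrite /W -!mulmxA (mulmxA P n) PnP mulmx0. Qed.

Lemma P_normal_line : P *m W = 0.
Proof. by rewrite /W !mulmxA PnP mul0mx. Qed.

(** With [v = n *m z] one has [n = v z^* + z v^*]: the lines [P] and [W] are exchanged by [n], whose
    square is the projection onto their sum. *)
Lemma mul_normal_nn : n *m n = P + W.
Proof.
by rewrite -{1}nE mulmxDl Pnn.
Qed.

Lemma normal_line_adj : W ^t* = W.
Proof. by rewrite /W !adjmxM hn hP mulmxA. Qed.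

(* For hermitian [Z] the components of [Z] along [n] and [JCP P n] are the real
   and imaginary part of the single complex number [\tr (P *m n *m Z)]. *)
Lemma g_normal Z : Z ^t* = Z -> g n Z = complex.Re (\tr (P *m n *m Z)).
Proof.
move=> hZ; rewrite /g -{1}nE mulmxDl mxtraceD.
have -> : \tr (n *m P *m Z) = ((\tr (P *m n *m Z))^*)%R.
  by rewrite -tr_adjmx !adjmxM hn hP hZ mxtrace_mulC.
by rewrite ReD_complex Re_conj_complex; field.
Qed.

Lemma g_Jnormal Z : Z ^t* = Z -> g Z (JCP P n) = complex.Im (\tr (P *m n *m Z)).
Proof.
move=> hZ; rewrite /g /JCP -scalemxAr mxtraceZ Re_iCM mulmxBr mxtraceB.
have -> : \tr (Z *m (n *m P)) = ((\tr (P *m n *m Z))^*)%R.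
  by rewrite -tr_adjmx !adjmxM hn hP hZ mulmxA.
rewrite [\tr (Z *m _)]mxtrace_mulC ImD_complex ImN_complex Im_conj_complex.
by field.
Qed.

Lemma gJnJn : g (JCP P n) (JCP P n) = 1.
Proof. by rewrite gJJ. Qed.

Lemma tangent_Jn : tangentCP P (JCP P n).
Proof. exact: tangentJ. Qed.

(** One complex equation in place of two real ones: the trace is the Hermitian product of the
    vectors of [n] and [X], so it expresses orthogonality to [n] and to [JCP P n] at once. *)
Definition holomorphic X := tangentCP P X /\ \tr (P *m n *m X) = 0.

Lemma holomorphicP X : holomorphic X <->
  [/\ tangentCP P X, g n X = 0 & g X (JCP P n) = 0].
Proof.
split=> [[tX e]|[tX e1 e2]].
  have hX := tangent_hermitian tX.
  by split=> //; rewrite ?g_normal// ?g_Jnormal// e.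
have hX := tangent_hermitian tX; split=> //.
move: e1 e2; rewrite g_normal// g_Jnormal//; case: (\tr _) => a b /= -> ->.
by [].
Qed.

Section Holomorphic.
Variable (X : E).
Hypothesis (dX : holomorphic X).
Let tX : tangentCP P X. Proof. by case: dX. Qed.
Let XE : P *m X + X *m P = X. Proof. exact: tangent_split tX. Qed.
Let hX : X ^t* = X. Proof. exact: tangent_hermitian tX. Qed.
Let PXP : P *m X *m P = 0. Proof. exact (tangent_PXP cpP tX). Qed.

(** Here [X = x z^* + z x^*] with [x] orthogonal to [z] and to [n *m z]; this is why the words below
    vanish. *)
Lemma hol_PnXP : P *m n *m X *m P = 0.
Proof.
by rewrite -(mulmxA P n X) CP_sandwich// mulmxA; case: dX => _ ->; rewrite scale0r.
Qed.

Lemma hol_nXP : n *m X *m P = 0.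
Proof.
by rewrite -[in LHS]nE; mxexpand; rewrite hol_PnXP add0r -!mulmxA (mulmxA P) PXP mulmx0.
Qed.

Lemma hol_PXn : P *m X *m n = 0.
Proof. by have := congr1 (fun A : E => A ^t*) hol_nXP; rewrite !adjmxM hn hX hP !mulmxA => ->; apply/matrixP => i j; rewrite !mxE conjC0. Qed.

Lemma hol_PnX : P *m n *m X = 0.
Proof.
by rewrite -[in LHS]XE; mxexpand; rewrite PnP mul0mx add0r hol_PnXP.
Qed.

Lemma hol_XnP : X *m n *m P = 0.
Proof. by have := congr1 (fun A : E => A ^t*) hol_PnX; rewrite !adjmxM hn hX hP !mulmxA => ->; apply/matrixP => i j; rewrite !mxE conjC0. Qed.

Lemma hol_WX : W *m X = 0.
Proof. by rewrite /W -!mulmxA (mulmxA P) hol_PnX mulmx0. Qed.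

Lemma hol_XW : X *m W = 0.
Proof. by rewrite /W !mulmxA hol_XnP mul0mx. Qed.

End Holomorphic.

(** The normal enters only through its line [W]. Where [W] is constant, the holomorphic subspace is
    therefore the tangent space of a fixed CP^(m-1). *)
Lemma holomorphic_XW X : tangentCP P X -> (holomorphic X <-> X *m W = 0).
Proof.
move=> tX; split=> [dX|XW]; first exact: hol_XW.
have hX := tangent_hermitian tX.
have XnP : X *m n *m P = 0.
  have : X *m W *m n *m P = 0 by rewrite XW !mul0mx.
  by rewrite /W !mulmxA -!(mulmxA (X *m n *m P)) nnP (mulmx_word2 PP).
split=> //; have : ((\tr (X *m n *m P))^*)%R = 0 by rewrite XnP mxtrace0 conjC0.
by rewrite -tr_adjmx !adjmxM hn hX hP mulmxA.
Qed.

Lemma holomorphicJ X : holomorphic X -> holomorphic (JCP P X).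
Proof.
move=> dX; split; first by case: dX => tX _; exact: tangentJ.
rewrite /JCP -scalemxAr mxtraceZ; mxexpand.
by rewrite hol_PnX// mul0mx PnP mul0mx subrr mxtrace0 mulr0.
Qed.

Lemma holomorphic_part X : tangentCP P X ->
  holomorphic (X - (g n X)%:C *: n - (g X (JCP P n))%:C *: JCP P n).
Proof.
move=> tX; apply/holomorphicP; have tJ := tangent_Jn.
split.
- by apply: tangentB; [apply: tangentB => //|]; apply: tangentZ.
- by rewrite !gBr !gZr gnn gXJX; ring.
- by rewrite !gBl !gZl gXJX gJnJn; ring.
Qed.

(* [Z] stands for the derivative of a unit normal field in the direction [X]. *)
Definition normal_derivative X Z :=
  [/\ Z ^t* = Z, Z = X *m n + P *m Z + (Z *m P + n *m X) & g n Z = 0].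

Section NormalDerivative.
Variables (X Z : E).
Hypotheses (dX : holomorphic X) (ZX : normal_derivative X Z).
Let hZ : Z ^t* = Z. Proof. by case: ZX. Qed.
Let ZE : Z = X *m n + P *m Z + (Z *m P + n *m X). Proof. by case: ZX. Qed.
Let tX : tangentCP P X. Proof. by case: dX. Qed.

Lemma normal_derivative_PZP : P *m Z *m P = 0.
Proof.
have : P *m Z *m P = P *m Z *m P + P *m Z *m P.
  rewrite {1}ZE; mxexpand; rewrite hol_PXn// PP (mulmx_word2 PP) hol_PnX//.
  by rewrite mul0mx add0r addr0.
by move/eqP; rewrite addrC -subr_eq subrr eq_sym => /eqP.
Qed.

Lemma projCP_normal_derivative : projCP P Z = P *m Z + Z *m P.
Proof.
rewrite /projCP; mxexpand; rewrite normal_derivative_PZP.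
by rewrite !subr0.
Qed.

(** The tangential part of [Z] has no component along [n] and, by hypothesis, none in the
    holomorphic subspace. *)
Lemma normal_derivative_proj_hol : (forall Y, holomorphic Y -> g Z Y = 0) ->
  projCP P Z = (g Z (JCP P n))%:C *: JCP P n.
Proof.
move=> H; have tZ := projCP_tangent cpP hZ; have hp := holomorphic_part tZ.
have tJ := tangent_Jn.
have gp : g n (projCP P Z) = 0 by rewrite gC g_projCP// gC; case: ZX.
have gJ : g (projCP P Z) (JCP P n) = g Z (JCP P n) by rewrite g_projCP.
rewrite gp gJ scale0r subr0 in hp.
have : projCP P Z - (g Z (JCP P n))%:C *: JCP P n = 0.
  apply: g_eq0; first by case: hp => /tangent_hermitian.
  move: (H _ hp); rewrite -(g_projCP cpP); last by case: hp.
  rewrite {1}(_ : projCP P Z = (projCP P Z - (g Z (JCP P n))%:C *: JCP P n) +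
      (g Z (JCP P n))%:C *: JCP P n); last by rewrite subrK.
  rewrite gDl gZl [X in _ + _ * X]gC => e.
  by case/holomorphicP: hp => _ _ e2; move: e; rewrite e2 mulr0 addr0.
by move/eqP; rewrite subr_eq0 => /eqP.
Qed.

(* The left-hand side is the derivative of [normal_line]. *)
Lemma normal_line_stationary : (forall Y, holomorphic Y -> g Z Y = 0) ->
  (Z *m P + n *m X) *m n + n *m P *m Z = 0.
Proof.
move=> /normal_derivative_proj_hol; rewrite projCP_normal_derivative.
set a := g Z _ => e.
(* To first order the vector [n *m z] only changes by a phase, and the projection onto its line does
   not see a phase. *)
have ZP : Z *m P = (a%:C * Complex 0 1) *: (n *m P).
  have : (P *m Z + Z *m P) *m P = (a%:C *: JCP P n) *m P by rewrite e.
  mxexpand; rewrite normal_derivative_PZP add0r (mulmx_word2 PP) => ->.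
  by rewrite /JCP scalerA -!scalemxAl; congr (_ *: _); mxexpand; rewrite PnP (mulmx_word2 PP) subr0.
have PZ : P *m Z = - (a%:C * Complex 0 1) *: (P *m n).
  have : P *m (P *m Z + Z *m P) = P *m (a%:C *: JCP P n) by rewrite e.
  mxexpand; rewrite normal_derivative_PZP addr0 PP => ->.
  rewrite /JCP scalerA -!scalemxAr scaleNr -scalerN; congr (_ *: _).
  by mxexpand; rewrite PnP PP sub0r.
have nXn : n *m X *m n = 0.
  by rewrite -[in X in _ *m X]nE; mxexpand; rewrite hol_nXP// mul0mx add0r -!(mulmxA n) hol_XnP// mulmx0.
rewrite mulmxDl nXn addr0 ZP -!scalemxAl -(mulmxA n P Z) PZ -scalemxAr scaleNr mulmxA subrr.
by [].
Qed.

End NormalDerivative.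

(* The derivative of [JCP P n] along a curve with velocity [X] on which the normal
   field has derivative [Z]. *)
Definition dJnormal X Z : E := Complex 0 1 *: ((Z *m P + n *m X) - (X *m n + P *m Z)).

Section HopfIdentities.
Variables (X Y ZX ZY : E).
Hypotheses (dX : holomorphic X) (dY : holomorphic Y).
Hypotheses (hZX : normal_derivative X ZX) (hZY : normal_derivative Y ZY).
Let aX := - projCP P ZX.
Let aY := - projCP P ZY.

(** The second term is the contribution of the moving base point [P]. *)
Lemma dJnormalE X' Z : dJnormal X' Z =
  JCP P Z + Complex 0 1 *: (n *m X' - X' *m n).
Proof.
rewrite /dJnormal /JCP -scalerDr; congr (_ *: _); mxlinear.
Qed.

Lemma JCP_proj Z : Z ^t* = Z -> JCP P Z = JCP P (projCP P Z).
Proof.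
move=> hZ; rewrite /JCP /projCP; congr (_ *: _); mxexpand.
rewrite ?(PP, mulmx_word2 PP); mxlinear.
Qed.

Lemma g_tangent_bracket : g Y (Complex 0 1 *: (n *m X - X *m n)) = 0.
Proof.
have [tY _] := dY; rewrite /g -scalemxAr mxtraceZ mulmxBr mxtraceB !mulmxA.
have -> : \tr (Y *m n *m X) = 0.
  rewrite -(tangent_split tY) !mulmxDl mxtraceD.
  rewrite -!(mulmxA P) mxtrace_mulC -!mulmxA (mulmxA n X P) hol_nXP// mulmx0 mxtrace0.
  by rewrite (mulmxA P n X) hol_PnX// mulmx0 mxtrace0 addr0.
have -> : \tr (Y *m X *m n) = 0.
  rewrite -(tangent_split tY) !mulmxDl mxtraceD.
  rewrite -!(mulmxA P) mxtrace_mulC -!mulmxA (mulmxA X n P) hol_XnP// mulmx0 mxtrace0.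
  by rewrite (mulmxA P X n) hol_PXn// mulmx0 mxtrace0 addr0.
by rewrite subrr mulr0 mul0r.
Qed.

(** Only the part [Y n + n Y] of [ZY] pairs with the commutator, and the result is a trace against
    [n *m n = P + W], of which [P] alone survives. This term does not involve the shape operator; it
    is what excludes open sets of Hopf points. *)
Lemma g_derivative_bracket : g ZY (Complex 0 1 *: (n *m X - X *m n)) = - g (JCP P X) Y.
Proof.
have [_ ZYE _] := hZY.
have e1 : \tr (ZY *m (n *m X - X *m n)) = \tr (P *m (X *m Y - Y *m X)).
  have Pb : P *m (n *m X - X *m n) = 0.
    by rewrite mulmxBr !mulmxA hol_PnX// hol_PXn// subrr.
  have bP : (n *m X - X *m n) *m P = 0.
    by rewrite mulmxBl hol_nXP// hol_XnP// subrr.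
  have -> : ZY = (Y *m n + n *m Y) + (P *m ZY + ZY *m P).
    by rewrite [LHS]ZYE; mxlinear.
  rewrite [(Y *m n + n *m Y + _) *m _]mulmxDl mxtraceD (trace_offdiag ZY Pb bP) addr0 trace_bracket.
  have W0 : W *m (X *m Y - Y *m X) = 0.
    by rewrite mulmxBr !mulmxA !hol_WX// !mul0mx subrr.
  by rewrite mul_normal_nn mulmxDl W0 addr0.
have e2 := trace_commutator P X Y.
by rewrite /g /JCP -scalemxAr -scalemxAl !mxtraceZ e1 e2 mulrN ReN_complex mulNr opprK.
Qed.

Lemma g_derivative_dJnormal :
  g ZY (dJnormal X ZX) = g (JCP P aX) aY - g (JCP P X) Y.
Proof.
have [hX _ _] := hZX; have [hY _ _] := hZY.
rewrite dJnormalE gDr g_derivative_bracket JCP_proj// -(g_projCP cpP).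
  by rewrite /aX /aY JCPN gNl gNr opprK [g (JCP P _) (projCP P _)]gC.
exact (tangentJ cpP (projCP_tangent cpP hX)).
Qed.

Lemma g_tangent_dJnormal : g Y (dJnormal X ZX) = - g (JCP P aX) Y.
Proof.
have [hX _ _] := hZX.
by rewrite dJnormalE gDr g_tangent_bracket addr0 JCP_proj// /aX JCPN gNl opprK gC.
Qed.

End HopfIdentities.

End UnitNormalAtPoint.

(** * Dimension count in the tangent spaces of the projective space *)

Section TangentDimension.
Context {R : realType} {m : nat}.
Local Notation C := (R[i]).
Local Notation E := ('M[C]_m.+1).
Local Notation d := (m.*2.-1).
Implicit Types (X Y Z P n : E).

Lemma CP_coordinate P : CP P -> exists (z : 'cV[C]_m.+1) (k : 'I_m.+1),
  [/\ z ^t* *m z = 1%:M, P = z *m z ^t* & z k 0 != 0].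
Proof.
move=> cpP; have [z zz PE] := CP_vector cpP.
have [k zk] : exists k, z k 0 != 0.
  apply/existsP; rewrite -negb_forall; apply/negP => /forallP H.
  move/matrixP/(_ 0 0): zz; rewrite !mxE big1 => [/eqP|i _].
    by rewrite eq_sym oner_eq0.
  by rewrite (eqP (H i)) mulr0.
by exists z, k.
Qed.

Variables (P : E) (z : 'cV[C]_m.+1) (k : 'I_m.+1).
Hypotheses (cpP : CP P) (zz : z ^t* *m z = 1%:M) (PE : P = z *m z ^t*) (zk : z k 0 != 0).

Lemma P_unit_vector : P *m z = z.
Proof. by rewrite PE -mulmxA zz mulmx1. Qed.

Lemma unit_vector_P : z ^t* *m P = z ^t*.
Proof. by rewrite PE mulmxA zz mul1mx. Qed.

Lemma tangent_vector_orth X : tangentCP P X -> z ^t* *m (X *m z) = 0.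
Proof.
move=> tX; transitivity (z ^t* *m (P *m X *m P) *m z).
  by rewrite !mulmxA unit_vector_P -(mulmxA _ P) P_unit_vector.
by rewrite tangent_PXP// mulmx0 mul0mx.
Qed.

Lemma tangent_vectorE X : tangentCP P X ->
  X = X *m z *m z ^t* + z *m (X *m z) ^t*.
Proof.
move=> tX; rewrite adjmxM (tangent_hermitian tX) -{1}(tangent_split tX) addrC.
by rewrite {1 2}PE !mulmxA.
Qed.

Lemma g_vectorE X Y : tangentCP P X -> tangentCP P Y ->
  g X Y = complex.Re (((X *m z) ^t* *m (Y *m z)) 0 0).
Proof.
move=> tX tY; rewrite /g {1}(tangent_vectorE tX) mulmxDl mxtraceD.
have hX := tangent_hermitian tX; have hY := tangent_hermitian tY.
have -> : \tr (z *m (X *m z) ^t* *m Y) = ((X *m z) ^t* *m (Y *m z)) 0 0.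
  by rewrite -mulmxA mxtrace_mulC trace_mx11 mulmxA.
have -> : \tr (X *m z *m z ^t* *m Y) = ((((X *m z) ^t* *m (Y *m z)) 0 0)^*)%R.
  rewrite -mulmxA mxtrace_mulC trace_mx11.
  have -> : z ^t* *m Y *m (X *m z) = ((X *m z) ^t* *m (Y *m z)) ^t*.
    by rewrite !adjmxM !adjmxK hY !mulmxA.
  by rewrite !mxE.
by rewrite ReD_complex Re_conj_complex; field.
Qed.

Definition vector_tangent (v : 'cV[C]_m.+1) : E := v *m z ^t* + z *m v ^t*.

Lemma vector_tangentP v : z ^t* *m v = 0 ->
  tangentCP P (vector_tangent v) /\ vector_tangent v *m z = v.
Proof.
move=> zv; have vz : v ^t* *m z = 0.
  by have := congr1 (fun A : 'M[C]_1 => A ^t*) zv; rewrite adjmxM adjmxK => ->;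
     apply/matrixP => i j; rewrite !mxE conjC0.
split; last by rewrite mulmxDl -!mulmxA zz vz mulmx1 mulmx0 addr0.
split; first by rewrite adjmxD !adjmxM !adjmxK addrC.
rewrite /vector_tangent PE mulmxDl mulmxDr !mulmxA.
rewrite -!(mulmxA z _ v) zv mulmx0 mul0mx add0r -!(mulmxA z _ z) zz mulmx1.
by rewrite -(mulmxA v _ z) zz mulmx1 vz mulmx0 mul0mx addr0 addrC.
Qed.

(** The coordinate [k], where [z] does not vanish, is set to 0: for a vector orthogonal to [z] it is
    determined by the others. *)
Definition coord_vector (r : 'rV[R]_(m + m)) : 'cV[C]_m.+1 :=
  \col_i (if unlift k i is Some j then Complex (r 0 (lshift m j)) (r 0 (rshift m j)) else 0).

Definition coord_tangent r : E := vector_tangent ((1%:M - P) *m coord_vector r).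

(** Not the inverse of [coord_tangent]: both maps are merely linear and injective. This one bounds
    the real dimension of the tangent space by [m + m] from above, [coord_tangent] from below. *)
Definition tangent_coord X : 'rV[R]_(m + m) :=
  row_mx (\row_j complex.Re ((X *m z) (lift k j) 0))
         (\row_j complex.Im ((X *m z) (lift k j) 0)).

Lemma coord_vectorD r s : coord_vector (r + s) = coord_vector r + coord_vector s.
Proof.
apply/colP => i; rewrite !mxE; case: unliftP => [j _|_]; last by rewrite addr0.
by apply/eqP; rewrite eq_complex /= !mxE !eqxx.
Qed.

Lemma coord_vectorZ (a : R) r : coord_vector (a *: r) = a%:C *: coord_vector r.
Proof.
apply/colP => i; rewrite !mxE; case: unliftP => [j _|_]; last by rewrite mulr0.
by apply/eqP; rewrite eq_complex /= !mxE; apply/andP; split; apply/eqP; ring.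
Qed.

Lemma coord_tangentD r s : coord_tangent (r + s) = coord_tangent r + coord_tangent s.
Proof.
rewrite /coord_tangent /vector_tangent coord_vectorD mulmxDr adjmxD mulmxDl mulmxDr.
by rewrite addrACA.
Qed.

Lemma coord_tangentZ (a : R) r : coord_tangent (a *: r) = a%:C *: coord_tangent r.
Proof.
rewrite /coord_tangent /vector_tangent coord_vectorZ -scalemxAr adjmxZ conj_realC.
by rewrite -scalemxAl -scalemxAr scalerDr.
Qed.

Lemma coord_tangent_orth r : z ^t* *m ((1%:M - P) *m coord_vector r) = 0.
Proof. by rewrite mulmxA mulmxBr mulmx1 unit_vector_P subrr mul0mx. Qed.

Lemma tangent_coord_tangent r : tangentCP P (coord_tangent r).
Proof. by case: (vector_tangentP (coord_tangent_orth r)). Qed.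

(** The kernel of [1%:M - P] is spanned by [z], and a multiple of [z] with vanishing [k]-th
    coordinate is 0. *)
Lemma coord_tangent_eq0 r : coord_tangent r = 0 -> r = 0.
Proof.
move=> r0; have [_] := vector_tangentP (coord_tangent_orth r).
rewrite -/(coord_tangent r) r0 mul0mx => /esym.
rewrite mulmxBl mul1mx => /eqP; rewrite subr_eq0 => /eqP e.
have : coord_vector r k 0 = 0 by rewrite mxE unlift_none.
rewrite {1}e PE -mulmxA [z ^t* *m _]mx11_scalar mul_mx_scalar mxE => /eqP.
rewrite mulf_eq0 (negbTE zk) orbF => /eqP c0.
have v0 : coord_vector r = 0.
  by rewrite e PE -mulmxA [z ^t* *m _]mx11_scalar c0 mul_mx_scalar scale0r.
apply/rowP => i; rewrite mxE; case: (split_ordP i) => j ->.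
  have := congr1 (fun w : 'cV[C]_m.+1 => complex.Re (w (lift k j) 0)) v0.
  by rewrite !mxE liftK /=.
have := congr1 (fun w : 'cV[C]_m.+1 => complex.Im (w (lift k j) 0)) v0.
by rewrite !mxE liftK /=.
Qed.

Lemma tangent_coordD X Y : tangent_coord (X + Y) = tangent_coord X + tangent_coord Y.
Proof.
rewrite /tangent_coord add_row_mx; congr row_mx; apply/rowP => j;
by rewrite !mulmxDl !mxE ?ReD_complex ?ImD_complex.
Qed.

Lemma tangent_coordZ (a : R) X : tangent_coord (a%:C *: X) = a *: tangent_coord X.
Proof.
rewrite /tangent_coord scale_row_mx; congr row_mx; apply/rowP => j;
by rewrite -!scalemxAl !mxE ?ReM_complex ?ImM_complex /= ?mul0r ?subr0 ?addr0.
Qed.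

Lemma tangent_coord_eq0 X : tangentCP P X -> tangent_coord X = 0 -> X = 0.
Proof.
move=> tX; rewrite /tangent_coord -row_mx0 => /eq_row_mx[re im].
have x0 i : i != k -> (X *m z) i 0 = 0.
  case: (unliftP k i) => [j -> _|->]; last by rewrite eqxx.
  move/rowP/(_ j): re; move/rowP/(_ j): im; rewrite !mxE.
  by case: (\sum__ _) => a b /= -> ->.
have xk : (X *m z) k 0 = 0.
  have := tangent_vector_orth tX => /matrixP/(_ 0 0).
  rewrite [LHS]mxE (bigD1 k) //= big1 ?addr0; last by move=> i ik; rewrite x0// mulr0.
  rewrite !mxE => /eqP; rewrite mulf_eq0 conjC_eq0 (negbTE zk) /= => /eqP.
  by [].
have xz : X *m z = 0.
  apply/colP => i; rewrite [RHS]mxE; have [->|ik] := eqVneq i k; [exact: xk|exact: x0].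
by rewrite (tangent_vectorE tX) xz mul0mx add0r (_ : (0 : 'cV_ _) ^t* = 0) ?mulmx0//;
   apply/matrixP => i j; rewrite !mxE conjC0.
Qed.

Lemma coord_tangent_sum (r : 'rV[R]_(m + m)) :
  coord_tangent r = \sum_i (r 0 i)%:C *: coord_tangent (delta_mx 0 i).
Proof.
rewrite {1}(row_sum_delta r).
have -> : \sum_i (r 0 i)%:C *: coord_tangent (delta_mx 0 i) =
   \sum_i coord_tangent (r 0 i *: delta_mx 0 i).
  by apply: eq_bigr => i _; rewrite coord_tangentZ.
apply: (big_morph coord_tangent) => [x y|]; first exact: coord_tangentD.
by have := coord_tangentZ 0 0; rewrite !scale0r.
Qed.

Lemma tangent_coord_sum (I : finType) (a : I -> R) (X : I -> E) :
  tangent_coord (\sum_i (a i)%:C *: X i) = \sum_i a i *: tangent_coord (X i).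
Proof.
have -> : \sum_i a i *: tangent_coord (X i) = \sum_i tangent_coord ((a i)%:C *: X i).
  by apply: eq_bigr => i _; rewrite tangent_coordZ.
apply: (big_morph tangent_coord) => [x y|]; first exact: tangent_coordD.
by have := tangent_coordZ 0 0; rewrite !scale0r.
Qed.

(** [2 m - 1] linear conditions on [2 m] coordinates have a nonzero solution. *)
Lemma normal_exists_coord (m0 : (0 < m)%N) (X : 'I_d -> E) :
  exists n, [/\ tangentCP P n, g n n = 1 & forall j, g n (X j) = 0].
Proof.
pose A := \matrix_(i < m + m, j < d) g (coord_tangent (delta_mx 0 i)) (X j).
have : kermx A != 0.
  rewrite -mxrank_eq0 mxrank_ker subn_eq0 -ltnNge.
  by apply: leq_ltn_trans (rank_leq_col A) _; rewrite addnn prednK// double_gt0.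
move=> /rowV0Pn[r /sub_kermxP rA r0].
pose n := coord_tangent r.
have tn : tangentCP P n by exact: tangent_coord_tangent.
have n0 : n != 0 by apply: contraNneq r0 => /coord_tangent_eq0 ->.
have nX j : g n (X j) = 0.
  have /rowP/(_ j) := rA; rewrite !mxE => <-.
  by rewrite /n coord_tangent_sum g_suml; apply: eq_bigr => i _; rewrite gZl mxE.
have gn0 : 0 < g n n.
  rewrite lt0r (g_ge0 (tangent_hermitian tn)) andbT.
  by apply: contraNneq n0 => /(g_eq0 (tangent_hermitian tn)) ->.
exists ((Num.sqrt (g n n))^-1%:C *: n); split.
- exact: tangentZ.
- rewrite gZl gZr mulrA -invfM -expr2 sqr_sqrtr ?ltW// mulVf ?gt_eqF//.
- by move=> j; rewrite gZl nX mulr0.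
Qed.

(** The [X j] and [n] are [2 m] independent vectors, hence a basis; the coefficient of [Y] along [n]
    is [g n Y = 0]. *)
Lemma tangent_span_coord (m0 : (0 < m)%N) (X : 'I_d -> E) n :
  (forall j, tangentCP P (X j)) ->
  (forall v : 'rV[R]_d, \sum_j (v 0 j)%:C *: X j = 0 -> v = 0) ->
  tangentCP P n -> g n n = 1 -> (forall j, g n (X j) = 0) ->
  forall Y, tangentCP P Y -> g n Y = 0 -> exists v : 'rV[R]_d, Y = \sum_j (v 0 j)%:C *: X j.
Proof.
move=> tX Xfree tn gnn nX Y tY nY.
pose M := col_mx (\matrix_(i < d) tangent_coord (X i)) (tangent_coord n).
have ME (a : 'rV[R]_d) (b : R) : row_mx a b%:M *m M =
    tangent_coord (\sum_j (a 0 j)%:C *: X j + b%:C *: n).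
  rewrite mul_row_col mul_scalar_mx tangent_coordD tangent_coordZ tangent_coord_sum.
  congr (_ + _); rewrite mulmx_sum_row; apply: eq_bigr => i _; by rewrite rowK.
have tS (a : 'rV[R]_d) (b : R) : tangentCP P (\sum_j (a 0 j)%:C *: X j + b%:C *: n).
  apply: tangentD; last exact: tangentZ.
  by apply: tangent_sum => j; exact: tangentZ.
have gS (a : 'rV[R]_d) (b : R) : g n (\sum_j (a 0 j)%:C *: X j + b%:C *: n) = b.
  rewrite gDr gZr gnn mulr1 g_sumr big1 ?add0r// => j _.
  by rewrite gZr nX mulr0.
have free : row_free M.
  rewrite -kermx_eq0; apply/eqP/row_matrixP => i; rewrite row0.
  have /sub_kermxP := row_sub i (kermx M).
  rewrite -[row i _]hsubmxK [rsubmx _]mx11_scalar ME => /(tangent_coord_eq0 (tS _ _)) e0.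
  have b0 := gS (lsubmx (row i (kermx M))) (rsubmx (row i (kermx M)) 0 0).
  rewrite e0 g0r in b0; rewrite -b0 in e0 *.
  rewrite scale0r addr0 in e0; rewrite (Xfree _ e0).
  by rewrite -[RHS]row_mx0; congr row_mx; rewrite raddf0.
have full : row_full M.
  by rewrite /row_full (eqP free) addnn addn1 prednK// double_gt0.
have /submxP[w wE] : (tangent_coord Y <= M)%MS by exact: submx_full.
rewrite -[w]hsubmxK [rsubmx w]mx11_scalar ME in wE.
set a := lsubmx w in wE; set b := rsubmx w 0 0 in wE.
have e : Y = \sum_j (a 0 j)%:C *: X j + b%:C *: n.
  apply/eqP; rewrite -subr_eq0; apply/eqP; apply: tangent_coord_eq0.
    exact: tangentB.
  rewrite tangent_coordD wE.
  have -> : - (\sum_j (a 0 j)%:C *: X j + b%:C *: n) =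
     (-1)%:C *: (\sum_j (a 0 j)%:C *: X j + b%:C *: n).
    by rewrite rmorphN scaleN1r.
  by rewrite tangent_coordZ scaleN1r subrr.
have b0 : b = 0 by rewrite -(gS a b) -e.
by exists a; rewrite {1}e b0 scale0r addr0.
Qed.

End TangentDimension.

Section TangentDimensionAtPoint.
Context {R : realType} {m : nat}.
Local Notation C := (R[i]).
Local Notation E := ('M[C]_m.+1).
Local Notation d := (m.*2.-1).

Lemma normal_exists (P : E) (X : 'I_d -> E) : (0 < m)%N -> CP P ->
  exists n, [/\ tangentCP P n, g n n = 1 & forall j, g n (X j) = 0].
Proof.
move=> m0 cpP; have [z [k [zz PE zk]]] := CP_coordinate cpP.
exact: normal_exists_coord zz PE zk m0 X.
Qed.

Lemma tangent_span (P : E) (X : 'I_d -> E) n : (0 < m)%N -> CP P ->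
  (forall j, tangentCP P (X j)) ->
  (forall v : 'rV[R]_d, \sum_j (v 0 j)%:C *: X j = 0 -> v = 0) ->
  tangentCP P n -> g n n = 1 -> (forall j, g n (X j) = 0) ->
  forall Y, tangentCP P Y -> g n Y = 0 -> exists v : 'rV[R]_d, Y = \sum_j (v 0 j)%:C *: X j.
Proof.
move=> m0 cpP; have [z [k [zz PE zk]]] := CP_coordinate cpP.
by apply: (@tangent_span_coord R m P z k).
Qed.

End TangentDimensionAtPoint.

(* [T] is the tangent space, [D] its maximal holomorphic subspace and [sc] the
   scalar multiplication. *)
Section CommutationIdentity.
Context {R : realFieldType} {V : zmodType}.
Variables (sc : R -> V -> V) (g : V -> V -> R) (J A phi : V -> V) (AF : V -> V -> V).
Variables (n xi : V) (T D : V -> Prop).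
Implicit Types (X Y Z : V).

Hypothesis gC : forall X Y, g X Y = g Y X.
Hypothesis gD : forall X Y Z, g (X + Y) Z = g X Z + g Y Z.
Hypothesis gN : forall X Z, g (- X) Z = - g X Z.
Hypothesis gZ : forall a X Z, g (sc a X) Z = a * g X Z.
Hypothesis sc0 : forall X, sc 0 X = 0.
Hypothesis scN1 : forall X, sc (-1) X = - X.
Hypothesis gJ : forall X Y, g (J X) Y = - g X (J Y).
Hypothesis JN : forall X, J (- X) = - J X.
Hypothesis JJ : forall X, T X -> J (J X) = - X.
Hypothesis TB : forall X Y, T X -> T Y -> T (X - Y).
Hypothesis TZ : forall a X, T X -> T (sc a X).
Hypothesis Tn : forall X, T X -> g n X = 0.
Hypothesis Txi : T xi.
Hypothesis gxixi : g xi xi = 1.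
Hypothesis xiE : xi = - J n.
Hypothesis DT : forall X, D X -> T X.
Hypothesis Dxi : forall X, D X -> g X xi = 0.
Hypothesis JD : forall X, D X -> D (J X).
Hypothesis D_part : forall X, T X -> exists2 b, D b & forall Y, D Y -> g b Y = g X Y.
Hypothesis D_def : forall X, D X -> g X X = 0 -> X = 0.
Hypothesis phiE : forall Z, phi Z = J Z - sc (g Z xi) n.
Hypothesis AFE : forall X Y, AF X Y =
  sc (g (phi (A X)) (A Y)) xi - sc (g (A Y) xi) (phi (A X))
  - A (sc (g (phi (A X)) Y) xi - sc (g Y xi) (phi (A X))).
Hypothesis AT : forall X, T X -> T (A X).
Hypothesis Asym : forall X Y, T X -> T Y -> g (A X) Y = g X (A Y).
Hypothesis AZ : forall a X, T X -> A (sc a X) = sc a (A X).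
Hypothesis comm : forall X Y, D X -> D Y -> AF (phi X) Y = phi (AF X Y).

Let gB X Y Z : g (X - Y) Z = g X Z - g Y Z. Proof. by rewrite gD gN. Qed.

Let gJJ X Y : T X -> g (J X) (J Y) = g X Y.
Proof. by move=> TX; rewrite gC gJ JJ// gC gN opprK. Qed.

Let phi_hol X : D X -> phi X = J X.
Proof. by move=> dX; rewrite phiE Dxi// sc0 subr0. Qed.

Let g_phi_T Z X : T X -> g (phi Z) X = g (J Z) X.
Proof. by move=> TX; rewrite phiE gB gZ (Tn TX) mulr0 subr0. Qed.

Let g_phi_xi Z : T Z -> g (phi Z) xi = 0.
Proof.
move=> TZ'; rewrite g_phi_T// xiE gC gN [g (J n) _]gC gJJ// gC Tn//.
by rewrite oppr0.
Qed.

Let AF_hol X Y : D X -> D Y -> AF X Y =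
  sc (g (phi (A X)) (A Y)) xi - sc (g (A Y) xi) (phi (A X)) - sc (g (phi (A X)) Y) (A xi).
Proof. by move=> dX dY; rewrite AFE (Dxi dY) sc0 subr0 AZ. Qed.

Local Notation beta Y := (g (A xi) Y).
Local Notation p X Y := (g (A X) Y).

Let Aeta Y : D Y -> g (A Y) xi = beta Y.
Proof. by move=> /DT TY; rewrite Asym// gC. Qed.

Lemma commutation_hol X Y Z : D X -> D Y -> D Z ->
  beta Y * (p X Z - p (J X) (J Z)) =
  p (J X) (J Y) * beta Z + p X (J Y) * beta (J Z).
Proof.
move=> dX dY dZ; have := congr1 (fun W => g W Z) (comm dX dY).
rewrite (phi_hol dX) (g_phi_T _ (DT dZ)) gJ (AF_hol (JD dX) dY) (AF_hol dX dY).
rewrite !gB !gZ (Aeta dY) !(g_phi_T _ (DT dZ)) !(g_phi_T _ (DT dY)).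
rewrite (g_phi_T _ (DT (JD dZ))) (gC xi Z) (gC xi (J Z)) (Dxi dZ) (Dxi (JD dZ)).
rewrite (gJJ _ (AT (DT dX))) !gJ; lra.
Qed.

Lemma commutation_xi X Y : D X -> D Y -> beta Y = 0 ->
  g (phi (A (J X))) (A Y) = g (A xi) xi * g (J (A (J X))) Y.
Proof.
move=> dX dY bY; have := congr1 (fun W => g W xi) (comm dX dY).
rewrite (phi_hol dX) (AF_hol (JD dX) dY) (AF_hol dX dY) (Aeta dY) bY !sc0 !subr0.
rewrite g_phi_xi; last by apply: TB; apply: TZ => //; exact: AT.
by rewrite gB !gZ gxixi (g_phi_T _ (DT dY)) => h; lra.
Qed.

(** Let [b] represent [beta] on [D]. Taking [Z = J b] in [commutation_hol] makes [p X (J Y)] a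
    multiple of [beta Y * mu X]. The cases [Y = b], and [J X] with [Y = J b], then give
    [mu X = - mu X]. *)
Lemma commutation_nonhopf : (exists2 Y, D Y & beta Y <> 0) ->
  forall X Y, D X -> D Y -> g (A X) Y = 0.
Proof.
move=> [Y0 dY0 bY0]; have [b db gb] := D_part (AT Txi).
have bb0 : beta b != 0.
  apply/eqP => e; apply: bY0; rewrite -gb// (D_def db) ?gb//.
  by have := gZ 0 0 Y0; rewrite sc0 mul0r.
have bJb : beta (J b) = 0.
  by rewrite -gb//; [have := gJ b b; rewrite gC => h; lra | exact: JD].
have JJb : J (J b) = - b by rewrite JJ//; exact: DT.
have gNr X Z : g Z (- X) = - g Z X by rewrite gC gN gC.
pose mu X := p (J X) b + p X (J b).
have star X Y : D X -> D Y -> p X (J Y) * beta b = - (beta Y * mu X).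
  move=> dX dY; have := commutation_hol dX dY (JD db).
  by rewrite bJb JJb !gNr /mu; lra.
have p0 X Y : D X -> D Y -> p X (J Y) = 0.
  move=> dX dY.
  have h1 : p X (J b) = - mu X.
    by have := star X b dX db; rewrite -mulrN mulrC => /(mulfI bb0).
  have h2 : p (J X) b = 0.
    have := star (J X) (J b) (JD dX) (JD db).
    rewrite bJb JJb gNr mul0r oppr0 mulNr => /eqP.
    by rewrite oppr_eq0 mulf_eq0 (negbTE bb0) orbF => /eqP.
  have m0 : mu X = 0 by move: h1 h2; rewrite /mu; lra.
  have := star X Y dX dY; rewrite m0 mulr0 oppr0 => /eqP.
  by rewrite mulf_eq0 (negbTE bb0) orbF => /eqP.
move=> X Y dX dY; have := p0 X (J Y) dX (JD dY).
by rewrite (JJ (DT dY)) gNr => /eqP; rewrite oppr_eq0 => /eqP.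
Qed.

(** This is [commutation_xi] at [J X], since [J (J X) = - X]. *)
Lemma commutation_hopf : (forall Y, D Y -> beta Y = 0) ->
  forall X Y, D X -> D Y -> g (J (A X)) (A Y) = g (A xi) xi * g (J (A X)) Y.
Proof.
move=> b0 X Y dX dY; have := commutation_xi (JD dX) dY (b0 Y dY).
have -> : A (J (J X)) = - A X by rewrite (JJ (DT dX)) -scN1 AZ ?scN1//; exact: DT.
rewrite (g_phi_T _ (AT (DT dY))) JN !gN => h.
by rewrite -[LHS]opprK h mulrN opprK.
Qed.

End CommutationIdentity.

(** * Charts, unit normals and the shape operator *)

Section RealCoordinates.
Context {R : realType} {n : nat}.
Local Notation C := (R[i]).

Definition realify (X : 'M[C]_n) : 'rV[R]_(n * n + n * n) :=
  row_mx (mxvec (map_mx (@complex.Re R) X)) (mxvec (map_mx (@complex.Im R) X)).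

Lemma realify_Re X i j : realify X 0 (lshift _ (mxvec_index i j)) = complex.Re (X i j).
Proof. by rewrite row_mxEl mxvecE mxE. Qed.

Lemma realify_Im X i j : realify X 0 (rshift _ (mxvec_index i j)) = complex.Im (X i j).
Proof. by rewrite row_mxEr mxvecE mxE. Qed.

Variant realify_index_spec : 'I_(n * n + n * n) -> Type :=
  | RealifyRe i j : realify_index_spec (lshift _ (mxvec_index i j))
  | RealifyIm i j : realify_index_spec (rshift _ (mxvec_index i j)).

Lemma realify_indexP k : realify_index_spec k.
Proof.
by case: (split_ordP k) => l ->; case/mxvec_indexP: l => i j; constructor.
Qed.

Lemma realify_inj X Y : realify X = realify Y -> X = Y.
Proof.
move=> e; apply/matrixP => i j.
have := congr1 (fun r : 'rV[R]_(n * n + n * n) => r 0 (lshift _ (mxvec_index i j))) e.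
have := congr1 (fun r : 'rV[R]_(n * n + n * n) => r 0 (rshift _ (mxvec_index i j))) e.
rewrite !realify_Re !realify_Im.
by case: (X i j) (Y i j) => [a b] [c e'] /= -> ->.
Qed.

Context {d : nat}.
Local Notation V := 'rV[R]_d.

Lemma realify_smooth Om (F : V -> 'M[C]_n) k j : open Om -> mxsmooth Om F ->
  of_class_C k Om (fun u => realify (F u) 0 j).
Proof.
move=> oOm sF; case: (realify_indexP j) => a b; have [h1 h2] := sF a b k.
  by apply: (of_class_C_eq oOm _ h1) => u _; rewrite realify_Re.
by apply: (of_class_C_eq oOm _ h2) => u _; rewrite realify_Im.
Qed.

Lemma jacobian_realify Om (F : V -> 'M[C]_n) u v : open Om -> mxsmooth Om F -> Om u ->
  v *m jacobian_mx (fun t => realify (F t)) u = realify (mxderive v F u).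
Proof.
move=> oOm sF Omu; apply/rowP => j; rewrite grad_jacobian.
rewrite -(deriveE_grad v oOm Omu (realify_smooth 1 j oOm sF)).
case: (realify_indexP j) => a b; rewrite ?realify_Re ?realify_Im mxderiveE /=.
  by congr (derive _ _ _); apply/funext => t; rewrite realify_Re.
by congr (derive _ _ _); apply/funext => t; rewrite realify_Im.
Qed.

Lemma immersion_left_inverse Om (F : V -> 'M[C]_n) u : open Om -> mxsmooth Om F -> Om u ->
  (forall v, mxderive v F u = 0 -> v = 0) ->
  exists G, jacobian_mx (fun t => realify (F t)) u *m G = 1%:M.
Proof.
move=> oOm sF Omu inj; apply/row_freeP.
rewrite -kermx_eq0; apply/eqP/row_matrixP => i; rewrite row0.
have /sub_kermxP := row_sub i (kermx (jacobian_mx (fun t => realify (F t)) u)).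
rewrite (jacobian_realify _ oOm sF Omu) => e; apply: inj.
apply: realify_inj; rewrite e; apply/rowP => j; rewrite mxE.
by case: (realify_indexP j) => a b; rewrite ?realify_Re ?realify_Im mxE.
Qed.

Lemma is_derive_realify (F : R -> 'M[C]_n) (t : R) Z : mxder F (t : R^o) 1 Z ->
  is_derive t 1 (fun s => realify (F s)) (realify Z).
Proof.
move=> dF.
have dE j : is_derive t 1 (fun s => realify (F s) 0 j) (realify Z 0 j).
  case: (realify_indexP j) => a b; have [d1 d2] := dF a b.
    by rewrite realify_Re; apply: is_derive_ext d1 => // s; rewrite realify_Re.
  by rewrite realify_Im; apply: is_derive_ext d2 => // s; rewrite realify_Im.
have dd : derivable (fun s : R => realify (F s)) (t : R^o) 1.
  by apply/derivable_mxP => i j; rewrite ord1; have [] := dE j.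
apply: DeriveDef => //; rewrite derive_mx//.
by apply/rowP => j; rewrite mxE; have [_ ->] := dE j.
Qed.

(** A curve chosen pointwise in the parameter domain need only be shown continuous at [t]; the
    immersion supplies its derivative. *)
Lemma immersion_lift Om (F : V -> 'M[C]_n) (c : R -> V) (t : R) Z :
  open Om -> mxsmooth Om F -> Om (c t) ->
  (forall v, mxderive v F (c t) = 0 -> v = 0) ->
  (forall r, 0 < r -> \forall h \near (0 : R), ball (c t) r (c (h *: 1 + t))) ->
  mxder (fun s => F (c s)) (t : R^o) 1 Z ->
  exists2 v, is_derive t 1 c v & Z = mxderive v F (c t).
Proof.
move=> oOm sF Omc inj cc dFc.
have [G JG] := immersion_left_inverse oOm sF Omc inj.
have dc := is_derive_lift oOm Omc (fun j => realify_smooth 1 j oOm sF) JG cc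
  (is_derive_realify dFc).
exists (realify Z *m G) => //.
exact: mxder_unique dFc (mxder_comp_curve oOm sF Omc dc).
Qed.

End RealCoordinates.

(** * Independence of derivatives from the chart *)

Section Charts.
Context {R : realType} {m : nat} {M : topologicalType}.
Local Notation C := (R[i]).
Local Notation E := ('M[C]_m.+1).
Local Notation d := (m.*2.-1).
Local Notation V := ('rV[R]_d).
Variable iota : M -> E.
Implicit Types (Om : set V) (c : V -> M).

Lemma chart_open Om c : chart iota Om c -> open Om. Proof. by case. Qed.

Lemma chart_inj Om c : chart iota Om c ->
  forall u v, Om u -> Om v -> c u = c v -> u = v.
Proof. by case. Qed.

Lemma chart_cont Om c : chart iota Om c -> forall u, Om u -> {for u, continuous c}.
Proof. by case. Qed.

Lemma chart_openmap Om c : chart iota Om c ->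
  forall O, open O -> O `<=` Om -> open (c @` O).
Proof. by case. Qed.

Lemma chart_smooth Om c : chart iota Om c -> mxsmooth Om (iota \o c).
Proof. by case=> _ _ _ _ [/smooth_onE]. Qed.

Lemma chart_immersion Om c : chart iota Om c ->
  forall u v, Om u -> mxderive v (iota \o c) u = 0 -> v = 0.
Proof. by case=> _ _ _ _ []. Qed.

Lemma chart_preimage_open Om c U : chart iota Om c -> open U -> open (Om `&` c @^-1` U).
Proof.
move=> ch oU; rewrite openE => u [Omu Uc]; rewrite /interior.
apply: filterI; first by apply: open_nbhs_nbhs; split; [exact: chart_open ch|].
by apply: (chart_cont ch Omu); apply: open_nbhs_nbhs.
Qed.

Lemma is_derive_near0 (c : R -> V) (t : R) v r : is_derive t 1 c v -> 0 < r ->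
  \forall h \near (0 : R), ball (c t) r (c (h *: 1 + t)).
Proof.
move=> [/derivable1_diffP /differentiable_continuous cc _] r0.
have : \forall s \near t, ball (c t) r (c s).
  by apply: cc; apply: nbhsx_ballx.
move=> /nbhs_ballP[e /= e0 He]; apply/nbhs_ballP; exists e => // h hb; apply: He.
move: hb; rewrite -!ball_normE /= sub0r normrN [h *: (1 : R^o)]mulr1 opprD addrCA subrr addr0.
by rewrite normrN.
Qed.

(** The two charts are related only through the topology of [M]. The line through [u1] is
    transported to the second chart by choice; [c2] being open and injective, the resulting curve
    [gam] is continuous at 0, and [immersion_lift] makes it differentiable there. The same curve
    then compares the derivatives of any [F]. *)
Lemma chart_transition Om1 c1 u1 Om2 c2 u2 (v1 : V) :
  chart iota Om1 c1 -> chart iota Om2 c2 -> Om1 u1 -> Om2 u2 -> c1 u1 = c2 u2 ->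
  exists v2, mxderive v1 (iota \o c1) u1 = mxderive v2 (iota \o c2) u2 /\
    forall (F : M -> E) Om1' Om2', open Om1' -> open Om2' -> Om1' u1 -> Om2' u2 ->
      mxsmooth Om1' (F \o c1) -> mxsmooth Om2' (F \o c2) ->
      mxderive v1 (F \o c1) u1 = mxderive v2 (F \o c2) u2.
Proof.
move=> ch1 ch2 Om1u Om2u e12.
have line0 : is_derive (0 : R) 1 (fun t : R => t *: v1 + u1) v1.
  apply/is_derive_epsP => e e0; apply/nbhs_ballP; exists 1; [exact: ltr01|move=> h _ /=].
  rewrite addr0 [h *: (1 : R^o)]mulr1 scale0r add0r addrK subrr normr0.
  by rewrite mulr_ge0// ltW.
have line00 : 0 *: v1 + u1 = u1 by rewrite scale0r add0r.
pose S t := [set u | Om2 u /\ c2 u = c1 (t *: v1 + u1)].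
(* The default [u2] is taken only where the line has left the image of [c2], which does not happen
   for small [t]. *)
pose gam (t : R) := xget u2 (S t).
have gamP r : 0 < r -> \forall t \near (0 : R),
    [/\ Om2 (gam t), c2 (gam t) = c1 (t *: v1 + u1) & ball u2 r (gam t)].
  move=> r0.
  pose B := Om2 `&` (ball u2 r)°.
  have oB : open B by apply: openI; [exact: chart_open ch2|exact: open_interior].
  have oc2B : open (c2 @` B) by apply: (chart_openmap ch2) => // u [].
  have c1n : nbhs (c1 u1) (c2 @` B).
    apply: open_nbhs_nbhs; split => //; exists u2 => //; split => //.
    exact: nbhsx_ballx.
  have nu : \forall u \near u1, (c2 @` B) (c1 u).
    by apply: (chart_cont ch1 Om1u).
  have /nbhs_ballP[e /= e0 He] := nu.
  have := is_derive_near0 line0 e0; rewrite line00.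
  apply: filterS => t /=; rewrite addr0 [t *: (1 : R^o)]mulr1 => /He [u [Om2u' Bu] cu].
  have St : S t u by split.
  have [g1 g2] : S t (gam t) by exact: xgetI St.
  split => //; rewrite (_ : gam t = u); first exact: interior_subset Bu.
  by apply: (chart_inj ch2) => //; rewrite g2 cu.
have gam0 : gam 0 = u2.
  have S0 : S 0 u2 by split; rewrite // line00.
  have [g1 g2] : S 0 (gam 0) by exact: xgetI S0.
  by apply: (chart_inj ch2) => //; rewrite g2 line00.
have near_c : \forall t \near (0 : R), c2 (gam t) = c1 (t *: v1 + u1).
  by have := gamP 1 ltr01; apply: filterS => t [].
have transfer (F : M -> E) Om1' : open Om1' -> Om1' u1 -> mxsmooth Om1' (F \o c1) ->
    mxder (fun t : R => (F \o c2) (gam t)) (0 : R^o) 1 (mxderive v1 (F \o c1) u1).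
  move=> oOm1' Om1'u sF.
  have Om0 : Om1' (0 *: v1 + u1) by rewrite line00.
  have := mxder_comp_curve oOm1' sF Om0 line0; rewrite line00.
  by apply: mxder_near; apply: filterS near_c => t /= ->.
have [|||v2 dgam E2] := @immersion_lift R _ _ Om2 (iota \o c2) gam 0 _
    (chart_open ch2) (chart_smooth ch2) _ _ _
    (transfer iota Om1 (chart_open ch1) Om1u (chart_smooth ch1)).
- by rewrite gam0.
- by rewrite gam0 => v; exact: (chart_immersion ch2).
- move=> r r0; rewrite gam0; have := gamP r r0; apply: filterS => t [_ _].
  by rewrite addr0 [t *: (1 : R^o)]mulr1.
rewrite gam0 in E2; exists v2; split => // F Om1' Om2' oOm1' oOm2' Om1'u Om2'u s1 s2.
apply: mxder_unique (transfer F Om1' oOm1' Om1'u s1) _.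
by rewrite -gam0; apply: (mxder_comp_curve oOm2' s2) => //; rewrite gam0.
Qed.

Lemma tangentP Om c u p X : chart iota Om c -> Om u -> c u = p ->
  tangent iota p X <-> exists v, X = mxderive v (iota \o c) u.
Proof.
move=> ch Omu cu; split=> [[Om' [c' [u' [v' [ch' Omu' cu' ->]]]]]|[v ->]]; last first.
  by exists Om, c, u, v.
have [|v2 [e _]] := chart_transition v' ch' ch Omu' Omu; first by rewrite cu' cu.
by exists v2.
Qed.

Definition smooth_in_charts (U : set M) (F : M -> E) := forall Om c, chart iota Om c ->
  mxsmooth (Om `&` c @^-1` U) (F \o c).

(** By [chart_transition] the set in [derive_along] has a single element; injectivity of the
    differential recovers [v] from the tangent vector. *)
Lemma derive_alongP U F Om c u p v : open U -> U p -> smooth_in_charts U F ->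
  chart iota Om c -> Om u -> c u = p ->
  derive_along iota F p (mxderive v (iota \o c) u) = mxderive v (F \o c) u.
Proof.
move=> oU Up sF ch Omu cu; rewrite /derive_along.
apply: xget_unique; first by exists Om, c, u, v.
move=> Z [Om' [c' [u' [v' [ch' Omu' cu' e ->]]]]].
have [|v2 [e2 H]] := chart_transition v' ch' ch Omu' Omu; first by rewrite cu' cu.
have vv : v2 = v.
  apply/eqP; rewrite -subr_eq0; apply/eqP; apply: (chart_immersion ch Omu).
  have sm := chart_smooth ch; have oOm := chart_open ch.
  rewrite (mxderive_sum _ oOm sm Omu).
  under eq_bigr do rewrite !mxE rmorphB /= scalerBl.
  by rewrite sumrB -!(mxderive_sum _ oOm sm Omu) -e2 -e subrr.
rewrite vv in H; apply: (H F (Om' `&` c' @^-1` U) (Om `&` c @^-1` U)).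
- exact: chart_preimage_open.
- exact: chart_preimage_open.
- by split=> //; rewrite /preimage /= cu'.
- by split=> //; rewrite /preimage /= cu.
- exact: sF.
- exact: sF.
Qed.

End Charts.

Lemma open_positive {R : realType} {d : nat} (f : 'rV[R]_d -> R) (Om : set 'rV[R]_d) :
  open Om -> of_class_C 0 Om f -> open (Om `&` [set u | 0 < f u]).
Proof.
move=> oOm cf; rewrite openE => v [Omv fv]; rewrite /interior.
have /continuous_epsP cfv := cf v Omv.
have [r r0 Hr] := cfv (f v / 2) (divr_gt0 fv (ltr0n _ 2)).
apply: filterI; first by apply: open_nbhs_nbhs; split.
have : ball v r `<=` [set u | 0 < f u].
  move=> w /Hr; rewrite ler_norml => /andP[_ h] /=; have : 0 < f v by []; lra.
by move=> sub; exact: (filterS sub (nbhsx_ballx v r r0)).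
Qed.

(** * Unit normals and local normal fields *)

Section HypersurfaceNormals.
Context {R : realType} {m : nat} {M : topologicalType}.
Local Notation C := (R[i]).
Local Notation E := ('M[C]_m.+1).
Local Notation d := (m.*2.-1).
Local Notation V := ('rV[R]_d).
Local Notation e_ j := (delta_mx 0 j : V).
Variable iota : M -> E.
Hypothesis m0 : (0 < m)%N.
Hypothesis hM : real_hypersurface iota.
Implicit Types (Om : set V) (c : V -> M).

Lemma hypersurface_CP p : CP (iota p). Proof. by case: hM. Qed.

Lemma hypersurface_chart p : exists Om c u, [/\ chart iota Om c, Om u & c u = p].
Proof. by case: hM. Qed.

Lemma chart_tangentCP Om c u v : chart iota Om c -> Om u ->
  tangentCP (iota (c u)) (mxderive v (iota \o c) u).
Proof.
move=> ch Omu; have dF := mxsmooth_mxder v (chart_open ch) (chart_smooth ch) Omu.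
split.
- apply: (mxder_unique (mxder_adj dF)); apply: (mxder_ext _ _ dF) => // t /=.
  by case: (hypersurface_CP (c t)).
- apply/esym; apply: (mxder_unique dF); rewrite addrC.
  apply: (mxder_ext _ _ (mxderM dF dF)) => // t /=.
  by case: (hypersurface_CP (c t)).
Qed.

Lemma tangent_tangentCP p X : tangent iota p X -> tangentCP (iota p) X.
Proof.
by move=> [Om [c [u [v [ch Omu <- ->]]]]]; exact: (chart_tangentCP v ch Omu).
Qed.

Section Frame.
Variables (Om : set V) (c : V -> M) (u : V).
Hypotheses (ch : chart iota Om c) (Omu : Om u).
Let X_ j := mxderive (e_ j) (iota \o c) u.

Lemma chart_frameE v : mxderive v (iota \o c) u = \sum_j (v 0 j)%:C *: X_ j.
Proof. exact: mxderive_sum (chart_open ch) (chart_smooth ch) Omu. Qed.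

Lemma chart_frame_free (v : V) : \sum_j (v 0 j)%:C *: X_ j = 0 -> v = 0.
Proof. by rewrite -chart_frameE; exact: chart_immersion ch _ _ Omu. Qed.

Lemma chart_frame_normal n : (forall j, g n (X_ j) = 0) ->
  forall X, tangent iota (c u) X -> g n X = 0.
Proof.
move=> nX X /(tangentP X ch Omu erefl)[v ->].
by rewrite chart_frameE g_sumr big1// => j _; rewrite gZr nX mulr0.
Qed.

Lemma chart_frame_tangent j : tangent iota (c u) (X_ j).
Proof. by exists Om, c, u, (e_ j). Qed.

(** A vector in the kernel of the Gram matrix represents a tangent vector orthogonal to itself. *)
Lemma chart_gram_unit : \matrix_(i, j) g (X_ i) (X_ j) \in unitmx.
Proof.
rewrite -row_free_unit -kermx_eq0; apply/eqP/row_matrixP => i; rewrite row0.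
have /sub_kermxP := row_sub i (kermx (\matrix_(i, j) g (X_ i) (X_ j))).
move: (row i _) => v vG; apply: chart_frame_free; rewrite -chart_frameE.
apply: g_eq0; first exact: (tangent_hermitian (chart_tangentCP v ch Omu)).
have e j : g (mxderive v (iota \o c) u) (X_ j) = (v *m \matrix_(i, j) g (X_ i) (X_ j)) 0 j.
  rewrite chart_frameE g_suml mxE; apply: eq_bigr => k _; by rewrite gZl mxE.
by rewrite {2}chart_frameE g_sumr big1// => j _; rewrite gZr e vG mxE mulr0.
Qed.

End Frame.

Lemma unit_normal_exists p : exists n, unit_normal iota p n.
Proof.
have [Om [c [u [ch Omu <-]]]] := hypersurface_chart p.
have [n [tn gn nX]] := normal_exists (fun j => mxderive (e_ j) (iota \o c) u) m0
  (hypersurface_CP (c u)).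
by exists n; split=> //; exact: (chart_frame_normal ch Omu nX).
Qed.

Lemma tangent_normalP p n X : unit_normal iota p n ->
  (tangent iota p X <-> tangentCP (iota p) X /\ g n X = 0).
Proof.
move=> [tn gn nX]; split=> [tX|[tX gX]].
  by split; [exact: tangent_tangentCP|exact: nX].
have [Om [c [u [ch Omu cu]]]] := hypersurface_chart p.
rewrite -cu in tn nX tX *.
apply/(tangentP X ch Omu erefl).
have [||v ->] := tangent_span m0 (hypersurface_CP (c u)) _ (chart_frame_free ch Omu) tn gn
  _ tX gX.
- by move=> j; exact: (chart_tangentCP _ ch Omu).
- by move=> j; apply: nX; exact: (chart_frame_tangent ch Omu).
by exists v; rewrite (chart_frameE ch Omu).
Qed.

Lemma normal_multiple p n n' : unit_normal iota p n -> tangentCP (iota p) n' ->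
  (forall X, tangent iota p X -> g n' X = 0) -> n' = (g n n')%:C *: n.
Proof.
move=> un tn' nX'; have [tn gn nX] := un.
have tD : tangentCP (iota p) (n' - (g n n')%:C *: n).
  by apply: tangentB => //; exact: tangentZ.
have gD : g n (n' - (g n n')%:C *: n) = 0 by rewrite gBr gZr gn; ring.
have tgD : tangent iota p (n' - (g n n')%:C *: n) by apply/(tangent_normalP _ un).
have : n' - (g n n')%:C *: n = 0.
  apply: g_eq0; first exact: tangent_hermitian tD.
  by rewrite gBl gZl gD nX'// mulr0 subr0.
by move/eqP; rewrite subr_eq0 => /eqP.
Qed.

Lemma unit_normal_pm p n n' : unit_normal iota p n -> unit_normal iota p n' ->
  n' = n \/ n' = - n.
Proof.
move=> un [tn' gn' nX']; have e := normal_multiple un tn' nX'.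
have [_ gn _] := un.
have : (g n n') ^+ 2 = 1.
  by rewrite expr2 -[RHS]gn' {3 4}e gZl gZr gn mulr1.
move/eqP; rewrite sqrf_eq1 => /orP[] /eqP h; rewrite h in e.
  by left; rewrite e scale1r.
by right; rewrite e rmorphN /= scaleN1r.
Qed.

Lemma unit_normal_opp p n : unit_normal iota p n -> unit_normal iota p (- n).
Proof.
move=> [tn gn nX]; split; [exact: tangentN|by rewrite gNl gNr opprK|].
by move=> X tX; rewrite gNl nX// oppr0.
Qed.

Lemma DDP p n X : unit_normal iota p n -> (DD iota p X <-> holomorphic (iota p) n X).
Proof.
move=> un; have [tn gn nX] := un; have cpP := hypersurface_CP p; split.
  move=> [tX H]; apply/(holomorphicP cpP tn); split.
  - exact: tangent_tangentCP.
  - exact: nX.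
  - by have := H n un; rewrite gNr => /eqP; rewrite oppr_eq0 => /eqP.
move=> /(holomorphicP cpP tn)[tX g1 g2]; split.
  exact/(tangent_normalP X un).
by move=> n' /(unit_normal_pm un)[] ->; rewrite ?JCPN gNr ?gNr g2 ?oppr0.
Qed.

Section LocalNormal.
Variable n0 : E.

(** A fixed matrix [n0] chooses between the two unit normals at [q], wherever it is not orthogonal
    to them. *)
Definition oriented_normal q n := unit_normal iota q n /\ 0 < g n n0.
Definition normal_domain : set M := [set q | exists n, oriented_normal q n].
Definition local_normal q : E := xget 0 (oriented_normal q).

Definition chart_gram c (u : V) : 'M[R]_d :=
  \matrix_(i, j) g (mxderive (e_ i) (iota \o c) u) (mxderive (e_ j) (iota \o c) u).

(** The component of [n0] along the normal. The tangential part is computed with the inverse Gram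
    matrix, so that smoothness in [u] can be read off the formula. *)
Definition chart_normal_part c (u : V) : E :=
  let T := projCP (iota (c u)) n0 in
  let a := (\row_j g T (mxderive (e_ j) (iota \o c) u)) *m invmx (chart_gram c u) in
  T - \sum_j (a 0 j)%:C *: mxderive (e_ j) (iota \o c) u.

Hypothesis hn0 : n0 ^t* = n0.

Lemma chart_normal_part_tangent Om c u : chart iota Om c -> Om u ->
  tangentCP (iota (c u)) (chart_normal_part c u).
Proof.
move=> ch Omu; apply: tangentB; first exact: (projCP_tangent (hypersurface_CP _) hn0).
by apply: tangent_sum => j; apply: tangentZ; exact: (chart_tangentCP _ ch Omu).
Qed.

Lemma chart_normal_part_orth Om c u : chart iota Om c -> Om u ->
  forall X, tangent iota (c u) X -> g (chart_normal_part c u) X = 0.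
Proof.
move=> ch Omu; apply: (chart_frame_normal ch Omu) => k.
rewrite /chart_normal_part; set T := projCP _ _; set a := _ *m _.
rewrite gBl g_suml.
have : (a *m chart_gram c u) 0 k = g T (mxderive (e_ k) (iota \o c) u).
  by rewrite /a mulmxKV ?mxE//; exact: (chart_gram_unit ch Omu).
rewrite mxE => <-; rewrite -sumrB big1// => j _.
by rewrite gZl [chart_gram c u j k]mxE subrr.
Qed.

Lemma chart_normal_partE Om c u n : chart iota Om c -> Om u -> unit_normal iota (c u) n ->
  chart_normal_part c u = (g n n0)%:C *: n.
Proof.
move=> ch Omu un; have [tn gn nX] := un.
rewrite (normal_multiple un (chart_normal_part_tangent ch Omu) (chart_normal_part_orth ch Omu)).
congr (_%:C *: _); rewrite /chart_normal_part; set a := _ *m _.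
rewrite gBr g_sumr big1 ?subr0; last first.
  by move=> j _; rewrite gZr nX ?mulr0//; exact: (chart_frame_tangent ch Omu j).
by rewrite gC (g_projCP (hypersurface_CP _) _ tn) gC.
Qed.

Lemma normal_domain_chart Om c u : chart iota Om c -> Om u ->
  (normal_domain (c u) <-> 0 < g (chart_normal_part c u) (chart_normal_part c u)).
Proof.
move=> ch Omu; have [n un] := unit_normal_exists (c u).
have [tn gn nX] := un.
have e := chart_normal_partE ch Omu un.
rewrite e gZl gZr gn mulr1 -expr2; split.
  move=> [n' [un' gn']]; rewrite exprn_even_gt0//=.
  case: (unit_normal_pm un un') => nE; rewrite nE ?gNl ?oppr_gt0 in gn'.
    by rewrite gt_eqF.
  by rewrite lt_eqF.
rewrite exprn_even_gt0//= => gn0; have [gp|gm|g0] := ltgtP 0 (g n n0).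
- by exists n.
- by exists (- n); split; [exact: unit_normal_opp|rewrite gNl oppr_gt0].
- by rewrite -g0 eqxx in gn0.
Qed.

Lemma chart_normal_part_smooth Om c : chart iota Om c -> mxsmooth Om (chart_normal_part c).
Proof.
move=> ch; have oOm := chart_open ch; have sF := chart_smooth ch.
have sX j : mxsmooth Om (fun u => mxderive (e_ j) (iota \o c) u).
  exact: mxsmooth_mxderive.
have sT : mxsmooth Om (fun u => projCP (iota (c u)) n0).
  rewrite /projCP; apply: mxsmoothD => //.
    apply: mxsmoothM => //; first by apply: mxsmoothM => //; exact: mxsmooth_cst.
    by apply: mxsmoothB => //; exact: mxsmooth_cst.
  apply: mxsmoothM => //; apply: mxsmoothM => //; last exact: mxsmooth_cst.
  by apply: mxsmoothB => //; exact: mxsmooth_cst.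
apply: mxsmoothB => //; apply: mxsmooth_sum => // j.
apply: mxsmoothZ => //; apply: csmooth_real => // k.
apply: (@of_class_C_eq _ _ _ _ (fun u => \sum_i g (projCP (iota (c u)) n0)
   (mxderive (e_ i) (iota \o c) u) * invmx (chart_gram c u) i j)) => //.
  by move=> u _; rewrite [RHS]mxE; apply: eq_bigr => i _; rewrite mxE.
apply: of_class_C_sum => // i _; apply: of_class_CM => //.
  exact: of_class_C_g.
apply: of_class_C_invmx => //; first by move=> u Omu; exact: (chart_gram_unit ch Omu).
move=> a b; apply: (@of_class_C_eq _ _ _ _ (fun u => g (mxderive (e_ a) (iota \o c) u)
  (mxderive (e_ b) (iota \o c) u))) => //; last exact: of_class_C_g.
by move=> u _; rewrite mxE.
Qed.

Lemma normal_domain_open : open normal_domain.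
Proof.
rewrite openE => q Uq; rewrite /interior.
have [Om [c [u [ch Omu cu]]]] := hypersurface_chart q.
pose f u := g (chart_normal_part c u) (chart_normal_part c u).
have sN := chart_normal_part_smooth ch; have oOm := chart_open ch.
pose O := Om `&` [set v | 0 < f v].
have oO : open O by apply: (open_positive oOm); exact: (of_class_C_g oOm sN sN).
have oc : open (c @` O) by apply: (chart_openmap ch) => // v [].
have : nbhs q (c @` O).
  apply: open_nbhs_nbhs; split => //; exists u => //; split => //.
  by apply/(normal_domain_chart ch Omu); rewrite cu.
by apply: filterS => q' [v [Omv fv] <-]; apply/(normal_domain_chart ch Omv).
Qed.

Lemma local_normalP q : normal_domain q -> oriented_normal q (local_normal q).
Proof. by move=> [n Hn]; exact: xgetI Hn. Qed.

Lemma local_normal_chart Om c u : chart iota Om c -> Om u -> normal_domain (c u) ->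
  local_normal (c u) =
  ((Num.sqrt (g (chart_normal_part c u) (chart_normal_part c u)))^-1)%:C *: chart_normal_part c u.
Proof.
move=> ch Omu /local_normalP [un gn0]; have e := chart_normal_partE ch Omu un.
have [_ gn _] := un.
rewrite e gZl gZr gn mulr1 -expr2 sqrtr_sqr (gtr0_norm gn0) scalerA -rmorphM /=.
by rewrite mulVf ?gt_eqF// scale1r.
Qed.

Lemma local_normal_field : unit_normal_field iota normal_domain local_normal.
Proof.
split; [exact: normal_domain_open| |by move=> q /local_normalP []].
move=> Om c ch; apply/smooth_onE.
have oO : open (Om `&` c @^-1` normal_domain).
  exact: chart_preimage_open ch normal_domain_open.
have sN : mxsmooth (Om `&` c @^-1` normal_domain) (chart_normal_part c).
  by apply: mxsmooth_sub (chart_normal_part_smooth ch) => u [].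
apply: (@mxsmooth_eq _ _ _ _ _ (fun u => ((Num.sqrt (g (chart_normal_part c u)
   (chart_normal_part c u)))^-1)%:C *: chart_normal_part c u)) => //.
  by move=> u [Omu Uu] /=; rewrite (local_normal_chart ch Omu Uu).
apply: mxsmoothZ => //; apply: csmooth_real => // k.
have gp u : (Om `&` c @^-1` normal_domain) u ->
    0 < g (chart_normal_part c u) (chart_normal_part c u).
  by move=> [Omu Uu]; apply/(normal_domain_chart ch Omu).
apply: of_class_CV => //.
  by move=> u /gp gu; rewrite gt_eqF// sqrtr_gt0.
apply: of_class_C_sqrt => //; exact: of_class_C_g.
Qed.

End LocalNormal.

Lemma unit_normal_field_exists p : exists U N, unit_normal_field iota U N /\ U p.
Proof.
have [n un] := unit_normal_exists p; have [tn gn _] := un.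
exists (normal_domain n), (local_normal n); split.
  exact: local_normal_field (tangent_hermitian tn).
by exists n; split=> //; rewrite gn.
Qed.

End HypersurfaceNormals.

(** * The shape operator in a chart *)

Section ShapeOperator.
Context {R : realType} {m : nat} {M : topologicalType}.
Local Notation C := (R[i]).
Local Notation E := ('M[C]_m.+1).
Local Notation d := (m.*2.-1).
Local Notation V := ('rV[R]_d).
Variable iota : M -> E.
Hypothesis m0 : (0 < m)%N.
Hypothesis hM : real_hypersurface iota.
Variables (U : set M) (N : M -> E).
Hypothesis hN : unit_normal_field iota U N.
Variables (Om : set V) (c : V -> M).
Hypothesis ch : chart iota Om c.
Implicit Types (u v w : V).

Definition normal_chart_domain : set V := Om `&` c @^-1` U.
Local Notation O := normal_chart_domain.
Local Notation dF v u := (mxderive v (iota \o c) u).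
Local Notation dN v u := (mxderive v (N \o c) u).

Lemma normal_chart_domain_open : open O.
Proof. by case: hN => oU _ _; exact: (chart_preimage_open ch oU). Qed.

Lemma normal_chart_smooth : mxsmooth O (N \o c).
Proof. by case: hN => _ sN _; apply/smooth_onE; exact: sN. Qed.

Lemma immersion_chart_smooth : mxsmooth O (iota \o c).
Proof. by apply: mxsmooth_sub (chart_smooth ch) => u []. Qed.

Lemma chart_unit_normal u : O u -> unit_normal iota (c u) (N (c u)).
Proof. by move=> [_ Uu]; case: hN => _ _; apply. Qed.

Lemma mxder_immersion u v : O u -> mxder (iota \o c) u v (dF v u).
Proof. exact: mxsmooth_mxder normal_chart_domain_open immersion_chart_smooth. Qed.

Lemma mxder_normal u v : O u -> mxder (N \o c) u v (dN v u).
Proof. exact: mxsmooth_mxder normal_chart_domain_open normal_chart_smooth. Qed.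

Lemma near_chart_domain u : O u -> \forall t \near u, O t.
Proof. by move=> Ou; apply: open_nbhs_nbhs; split=> //; exact: normal_chart_domain_open. Qed.

(** The derivatives of [n^* = n], of [P n + n P = n] and of [g n n = 1]. *)
Lemma chart_normal_derivative u v : O u ->
  normal_derivative (iota (c u)) (N (c u)) (dF v u) (dN v u).
Proof.
move=> Ou; have dF' := mxder_immersion v Ou; have dN' := mxder_normal v Ou.
split.
- apply: (mxder_unique (mxder_adj dN')); apply: (mxder_near _ dN').
  apply: filterS (near_chart_domain Ou) => t Ot /=.
  by have [/tangent_hermitian -> _ _] := chart_unit_normal Ot.
- apply: (mxder_unique dN').
  have := mxderD (mxderM dF' dN') (mxderM dN' dF').
  apply: mxder_near; apply: filterS (near_chart_domain Ou) => t Ot /=.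
  by have [/tangent_split -> _ _] := chart_unit_normal Ot.
- have [_ h] : is_derive u v (fun=> 1 : R) (g (dN v u) (N (c u)) + g (N (c u)) (dN v u)).
    apply: near_eq_is_derive (is_derive_g dN' dN').
    apply: filterS (near_chart_domain Ou) => t Ot /=.
    by have [_ -> _] := chart_unit_normal Ot.
  by move: h; rewrite derive_cst (gC (N (c u))) => h; lra.
Qed.

(** The derivative of [g N (dF w) = 0]. The right-hand side contains a second derivative of [iota],
    which accounts for the symmetry of the shape operator. *)
Lemma g_dnormal_tangent u v w : O u ->
  g (dN v u) (dF w u) = - g (N (c u)) (mxderive v (mxderive w (iota \o c)) u).
Proof.
move=> Ou; have sD : mxsmooth O (mxderive w (iota \o c)).
  by apply: mxsmooth_mxderive; [exact: normal_chart_domain_open|exact: immersion_chart_smooth].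
have dD := mxsmooth_mxder v normal_chart_domain_open sD Ou.
have [_ h] : is_derive u v (fun=> 0 : R) (g (dN v u) (dF w u) +
    g (N (c u)) (mxderive v (mxderive w (iota \o c)) u)).
  apply: near_eq_is_derive (is_derive_g (mxder_normal v Ou) dD).
  apply: filterS (near_chart_domain Ou) => t Ot /=.
  have [_ _ H] := chart_unit_normal Ot; apply: H.
  by case: Ot => Omt _; exists Om, c, t, w.
by move: h; rewrite derive_cst => /eqP; rewrite eq_sym addr_eq0 => /eqP.
Qed.

Lemma normal_tangent_symmetric u v w : O u -> g (dN v u) (dF w u) = g (dN w u) (dF v u).
Proof.
move=> Ou; rewrite (g_dnormal_tangent v w Ou) (g_dnormal_tangent w v Ou).
by rewrite (mxderive_comm v w normal_chart_domain_open immersion_chart_smooth Ou).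
Qed.

Lemma shapeE u v : O u -> Defs.shape iota N (c u) (dF v u) = - projCP (iota (c u)) (dN v u).
Proof.
move=> [Omu Uu]; rewrite /Defs.shape; congr (- projCP _ _).
have [oU sN _] := hN.
apply: (derive_alongP v oU Uu _ ch Omu erefl).
by move=> Om' c' ch'; apply/smooth_onE; exact: sN.
Qed.

Lemma g_shape u v Y : O u -> tangentCP (iota (c u)) Y ->
  g (Defs.shape iota N (c u) (dF v u)) Y = - g (dN v u) Y.
Proof.
by move=> Ou tY; rewrite shapeE// gNl (g_projCP (hypersurface_CP hM _) _ tY).
Qed.

Lemma shape_tangent u v : O u -> tangent iota (c u) (Defs.shape iota N (c u) (dF v u)).
Proof.
move=> Ou; have un := chart_unit_normal Ou; have [tn _ _] := un.
have [hZ _ nZ] := chart_normal_derivative v Ou.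
apply/(tangent_normalP m0 hM _ un); split.
  by rewrite shapeE//; apply: tangentN; exact (projCP_tangent (hypersurface_CP hM _) hZ).
by rewrite gC g_shape// gC nZ oppr0.
Qed.

Lemma shapeZ u (a : R) v : O u -> Defs.shape iota N (c u) (a%:C *: dF v u) =
  a%:C *: Defs.shape iota N (c u) (dF v u).
Proof.
move=> Ou.
have lin (F : V -> E) : mxsmooth O F -> mxderive (a *: v) F u = a%:C *: mxderive v F u.
  move=> sF; rewrite !(mxderive_sum _ normal_chart_domain_open sF Ou) scaler_sumr.
  by apply: eq_bigr => j _; rewrite mxE rmorphM /= scalerA.
rewrite -(lin _ immersion_chart_smooth) !shapeE// (lin _ normal_chart_smooth).
by rewrite scalerN; congr (- _); rewrite /projCP -!scalemxAr -!scalemxAl -scalerDr.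
Qed.

End ShapeOperator.

(** * Commutation implies a vanishing second fundamental form on D *)

Section DirectionLinear.
Context {R : realType} {d n : nat}.
Local Notation V := 'rV[R]_d.
Variables (Om : set V) (F : V -> 'M[R[i]]_n) (u : V).
Hypotheses (oOm : open Om) (sF : mxsmooth Om F) (Omu : Om u).

Lemma mxderive_dirD v w : mxderive (v + w) F u = mxderive v F u + mxderive w F u.
Proof.
rewrite !(mxderive_sum _ oOm sF Omu) -big_split; apply: eq_bigr => j _.
by rewrite mxE rmorphD /= scalerDl.
Qed.

Lemma mxderive_dirZ (a : R) v : mxderive (a *: v) F u = a%:C *: mxderive v F u.
Proof.
rewrite !(mxderive_sum _ oOm sF Omu) scaler_sumr; apply: eq_bigr => j _.
by rewrite mxE rmorphM /= scalerA.
Qed.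

Lemma mxderive_dirBZ (a : R) v w :
  mxderive (v - a *: w) F u = mxderive v F u - a%:C *: mxderive w F u.
Proof.
by rewrite mxderive_dirD -scaleNr mxderive_dirZ rmorphN /= scaleNr.
Qed.

End DirectionLinear.

(* [et], [om] and [hh] stand for the Reeb form, the contraction of the second
   fundamental form with the Reeb vector [e], and the second fundamental form. *)
Section ReebAlgebra.
Context {R : realFieldType} {V : lmodType R}.
Variables (et om : V -> R) (hh : V -> V -> R) (e : V).
Implicit Types (v w : V).
Hypothesis etBZ : forall a v w, et (v - a *: w) = et v - a * et w.
Hypothesis omBZ : forall a v w, om (v - a *: w) = om v - a * om w.
Hypothesis hhBZ : forall a v w v', hh (v - a *: w) v' = hh v v' - a * hh w v'.
Hypothesis hhC : forall v w, hh v w = hh w v.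
Hypothesis hh_e : forall v, hh v e = om v.
Hypothesis et_e : et e = 1.

Lemma reeb_proportionalP : (forall v w, om v * et w = om w * et v) <->
  forall w, et w = 0 -> om w = 0.
Proof.
split=> [H w w0|H].
  by have := H w e; rewrite et_e w0 mulr1 mulr0.
have omE v : om v = om e * et v.
  have : om (v - et v *: e) = 0 by apply: H; rewrite etBZ et_e mulr1 subrr.
  by rewrite omBZ => /eqP; rewrite subr_eq0 => /eqP ->; rewrite mulrC.
by move=> v w; rewrite (omE v) (omE w); ring.
Qed.

(** For fixed [v2] the tensor is the exterior product of the form [hh _ v2 - et v2 * om] with [et].
    It turns a condition on the kernel of [et], which varies with the point, into an identity for
    all vectors. *)
Lemma second_form_ruledP : (forall v w, et v = 0 -> et w = 0 -> hh v w = 0) <->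
  forall v1 v2 v3, hh v1 v2 * et v3 - hh v3 v2 * et v1
    - et v2 * (om v1 * et v3 - om v3 * et v1) = 0.
Proof.
split=> [H v1 v2 v3|H v w v0 w0]; last first.
  by have := H v w e; rewrite et_e v0 w0; lra.
have hhE v w : hh v w = et v * om w + et w * om v - et v * et w * om e.
  have etp x : et (x - et x *: e) = 0 by rewrite etBZ et_e mulr1 subrr.
  have := H _ _ (etp v) (etp w).
  rewrite hhBZ ![hh _ (w - _)]hhC !hhBZ (hhC w v) (hhC e v) (hhC w e) (hhC e w) !hh_e.
  by move=> h; have : hh v w = hh v w by []; lra.
by rewrite !hhE; ring.
Qed.

End ReebAlgebra.

Section ForwardDirection.
Context {R : realType} {m : nat} {M : topologicalType}.
Local Notation C := (R[i]).
Local Notation E := ('M[C]_m.+1).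
Local Notation d := (m.*2.-1).
Local Notation V := ('rV[R]_d).
Variable iota : M -> E.
Hypothesis m1 : (1 < m)%N.
Hypothesis hM : real_hypersurface iota.
Variables (U : set M) (N : M -> E).
Hypothesis hN : unit_normal_field iota U N.
Variables (Om : set V) (c : V -> M).
Hypothesis ch : chart iota Om c.
Implicit Types (u v w : V).

Local Notation O := (normal_chart_domain U Om c).
Local Notation dF v u := (mxderive v (iota \o c) u).
Local Notation dN v u := (mxderive v (N \o c) u).
Local Notation P u := (iota (c u)).
Local Notation n u := (N (c u)).
Local Notation J u := (JCP (P u) (n u)).
Local Notation D u := (holomorphic (P u) (n u)).
Local Notation A u := (Defs.shape iota N (c u)).

Let m0 : (0 < m)%N. Proof. exact: ltnW. Qed.
Let oO : open O. Proof. exact: (normal_chart_domain_open hN ch). Qed.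
Let sF : mxsmooth O (iota \o c). Proof. exact: (immersion_chart_smooth U ch). Qed.
Let sN : mxsmooth O (N \o c). Proof. exact: (normal_chart_smooth hN ch). Qed.

Definition reeb_form v u : R := - g (dF v u) (J u).
(** This is [g (A X) xi]: the minus signs of the shape operator and of [xi] cancel. Written with the
    derivative of [N] it is visibly smooth in [u]. *)
Definition reeb_shape v u : R := g (dN v u) (J u).
Definition second_form v w u : R := - g (dN v u) (dF w u).
Local Notation et := reeb_form.
Local Notation om := reeb_shape.
Local Notation hh := second_form.

Section Pointwise.
Variable u : V.
Hypothesis Ou : O u.

Let cpP : CP (P u). Proof. exact: (hypersurface_CP hM _). Qed.
Let un : unit_normal iota (c u) (n u). Proof. exact: (chart_unit_normal hN Ou). Qed.
Let tn : tangentCP (P u) (n u). Proof. by case: un. Qed.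
Let gnn : g (n u) (n u) = 1. Proof. by case: un. Qed.
Let Omu : Om u. Proof. by case: Ou. Qed.

Lemma frame_tangent v : tangentCP (P u) (dF v u) /\ g (n u) (dF v u) = 0.
Proof. by apply/(tangent_normalP m0 hM _ un); exists Om, c, u, v. Qed.

Lemma frame_surj X : tangentCP (P u) X -> g (n u) X = 0 -> exists v, X = dF v u.
Proof.
move=> tX nX; apply/(tangentP X ch Omu erefl).
exact/(tangent_normalP m0 hM X un).
Qed.

Lemma frame_hol v : D u (dF v u) <-> et v u = 0.
Proof.
have [tX nX] := frame_tangent v; rewrite /et; split.
  by move=> /(holomorphicP cpP tn)[_ _ ->]; rewrite oppr0.
by move=> /eqP; rewrite oppr_eq0 => /eqP h; apply/(holomorphicP cpP tn).
Qed.

Lemma hol_frame X : D u X -> exists2 v, X = dF v u & et v u = 0.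
Proof.
move=> dX; have /(holomorphicP cpP tn)[tX nX _] := dX.
by have [v e] := frame_surj tX nX; exists v => //; apply/frame_hol; rewrite -e.
Qed.

Lemma reeb_frame : exists2 e, dF e u = - J u & et e u = 1.
Proof.
have tJ : tangentCP (P u) (J u) by exact: (tangentJ cpP).
have [|e He] := frame_surj (tangentN tJ); first by rewrite gNr gXJX oppr0.
by exists e => //; rewrite /et -He gNl opprK gJJ.
Qed.

Lemma reeb_formBZ (a : R) v w : et (v - a *: w) u = et v u - a * et w u.
Proof. by rewrite /et (mxderive_dirBZ oO sF Ou) gBl gZl mulrN opprK opprB addrC. Qed.

Lemma reeb_shapeBZ (a : R) v w : om (v - a *: w) u = om v u - a * om w u.
Proof. by rewrite /om (mxderive_dirBZ oO sN Ou) gBl gZl. Qed.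

Lemma second_formBZ (a : R) v w v' : hh (v - a *: w) v' u = hh v v' u - a * hh w v' u.
Proof. by rewrite /hh (mxderive_dirBZ oO sN Ou) gBl gZl mulrN opprK opprB addrC. Qed.

Lemma second_formC v w : hh v w u = hh w v u.
Proof. by rewrite /hh (normal_tangent_symmetric hN ch v w Ou). Qed.

Lemma second_form_reeb e v : dF e u = - J u -> hh v e u = om v u.
Proof. by move=> e'; rewrite /hh e' gNr opprK. Qed.

Lemma shape_frame v w : g (A u (dF v u)) (dF w u) = hh v w u.
Proof. by rewrite (g_shape hM hN ch v Ou); case: (frame_tangent w). Qed.

Lemma commutation_cases :
  (forall X Y, DD iota (c u) X -> DD iota (c u) Y ->
     A_F iota N (c u) (Defs.phi iota N (c u) X) Y = Defs.phi iota N (c u) (A_F iota N (c u) X Y)) ->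
  ((exists2 Y, D u Y & g (A u (- J u)) Y <> 0) ->
     forall X Y, D u X -> D u Y -> g (A u X) Y = 0) /\
  ((forall Y, D u Y -> g (A u (- J u)) Y = 0) ->
     forall X Y, D u X -> D u Y ->
       g (JCP (P u) (A u X)) (A u Y) =
       g (A u (- J u)) (- J u) * g (JCP (P u) (A u X)) Y).
Proof.
move=> comm.
pose T X := tangent iota (c u) X.
have TP X : T X <-> tangentCP (P u) X /\ g (n u) X = 0 by exact: (tangent_normalP m0 hM X un).
have Tfr X : T X -> exists v, X = dF v u by move=> /TP[tX nX]; exact: frame_surj.
have sc0 (X : E) : (0 : R)%:C *: X = 0 by rewrite scale0r.
have scN1 (X : E) : (-1 : R)%:C *: X = - X by rewrite rmorphN /= scaleN1r.
have JJ X : T X -> JCP (P u) (JCP (P u) X) = - X by move=> /TP[tX _]; rewrite JCPK.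
have TB X Y : T X -> T Y -> T (X - Y).
  move=> /TP[tX nX] /TP[tY nY]; apply/TP; split; first exact: tangentB.
  by rewrite gBr nX nY subrr.
have TZ (a : R) X : T X -> T (a%:C *: X).
  by move=> /TP[tX nX]; apply/TP; split; [exact: tangentZ|rewrite gZr nX mulr0].
have Tn X : T X -> g (n u) X = 0 by move=> /TP[].
have tJ : tangentCP (P u) (J u) by exact: (tangentJ cpP).
have Txi : T (- J u).
  by apply/TP; split; [exact: tangentN|rewrite gNr gXJX oppr0].
have gxixi : g (- J u) (- J u) = 1 by rewrite gNl gNr opprK gJJ.
have DT X : D u X -> T X by move=> /(holomorphicP cpP tn)[tX nX _]; apply/TP.
have Dxi X : D u X -> g X (- J u) = 0.
  by move=> /(holomorphicP cpP tn)[_ _ e]; rewrite gNr e oppr0.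
have JD X : D u X -> D u (JCP (P u) X) by exact: holomorphicJ.
have D_part X : T X -> exists2 b, D u b & forall Y, D u Y -> g b Y = g X Y.
  move=> /TP[tX nX].
  exists (X - (g (n u) X)%:C *: n u - (g X (J u))%:C *: J u).
    exact: (holomorphic_part cpP tn gnn).
  move=> Y /(holomorphicP cpP tn)[_ e1 e2].
  by rewrite !gBl !gZl e1 (gC (J u)) e2 !mulr0 !subr0.
have D_def X : D u X -> g X X = 0 -> X = 0.
  by move=> [/tangent_hermitian hX _]; exact: g_eq0.
have AT X : T X -> T (A u X) by move=> /Tfr[v ->]; exact: (shape_tangent m0 hM hN ch).
have Asym X Y : T X -> T Y -> g (A u X) Y = g X (A u Y).
  move=> /Tfr[v ->] /Tfr[w ->]; rewrite shape_frame [RHS]gC shape_frame.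
  exact: second_formC.
have AZ (a : R) X : T X -> A u (a%:C *: X) = a%:C *: A u X.
  by move=> /Tfr[v ->]; exact: (shapeZ hN ch).
have phiE (Z : E) : Defs.phi iota N (c u) Z = JCP (P u) Z - (g Z (- J u))%:C *: n u by [].
have AFE (X Y : E) : A_F iota N (c u) X Y =
  (g (Defs.phi iota N (c u) (A u X)) (A u Y))%:C *: (- J u) -
  (g (A u Y) (- J u))%:C *: Defs.phi iota N (c u) (A u X) -
  A u ((g (Defs.phi iota N (c u) (A u X)) Y)%:C *: (- J u) -
       (g Y (- J u))%:C *: Defs.phi iota N (c u) (A u X)) by [].
have comm' X Y : D u X -> D u Y ->
     A_F iota N (c u) (Defs.phi iota N (c u) X) Y = Defs.phi iota N (c u) (A_F iota N (c u) X Y).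
  by move=> /(@DDP _ _ _ _ m0 hM _ _ _ un) dX /(@DDP _ _ _ _ m0 hM _ _ _ un) dY; exact: comm.
have gDl' := @gDl R m; have gNl' := @gNl R m; have gC' := @gC R m.
have gZl' := @gZl R m; have gJl' := @gJl R m (P u); have JN := @JCPN R m (P u).
split.
- apply: (@commutation_nonhopf R E (fun a X => a%:C *: X) (@g R m) (JCP (P u)) (A u)
    (Defs.phi iota N (c u)) (A_F iota N (c u)) (n u) (- J u) T (D u)); try assumption.
- apply: (@commutation_hopf R E (fun a X => a%:C *: X) (@g R m) (JCP (P u)) (A u)
    (Defs.phi iota N (c u)) (A_F iota N (c u)) (n u) (- J u) T (D u)); try assumption.
  all: by [].
Qed.

(** Proportionality of two forms on constant vectors, instead of vanishing of one on the kernel of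
    the other: on an open set it can be differentiated. *)
Definition hopf_at := forall v w, om v u * et w u = om w u * et v u.

Lemma shape_reeb_frame e v : dF e u = - J u -> g (A u (- J u)) (dF v u) = om v u.
Proof. by move=> eE; rewrite -eE shape_frame second_formC; exact: second_form_reeb. Qed.

Lemma hopf_atP : hopf_at <-> forall Y, D u Y -> g (A u (- J u)) Y = 0.
Proof.
have [e eE e1] := reeb_frame.
have P0 := reeb_proportionalP reeb_formBZ reeb_shapeBZ e1.
split=> [/P0 H Y /hol_frame[w -> w0]|H].
  by rewrite (shape_reeb_frame w eE) H.
apply/P0 => w w0; rewrite -(shape_reeb_frame w eE); apply: H.
exact/frame_hol.
Qed.

Definition ruled_at := forall v w, et v u = 0 -> et w u = 0 -> hh v w u = 0.

Definition ruled_tensor v1 v2 v3 u : R :=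
  hh v1 v2 u * et v3 u - hh v3 v2 u * et v1 u -
  et v2 u * (om v1 u * et v3 u - om v3 u * et v1 u).

Lemma ruled_atP : ruled_at <-> forall v1 v2 v3, ruled_tensor v1 v2 v3 u = 0.
Proof.
have [e eE e1] := reeb_frame.
exact (second_form_ruledP reeb_formBZ second_formBZ second_formC
  (fun v => second_form_reeb v eE) e1).
Qed.

(** [et] is one linear condition on a space of dimension at least 2. *)
Lemma hol_nonzero : exists2 X, D u X & X != 0.
Proof.
have d2 : (1 < d)%N by case: m m1 => [|[|k]] //; rewrite doubleS.
pose i0 := Ordinal (ltnW d2); pose i1 := Ordinal d2.
pose a : V := delta_mx 0 i0; pose b : V := delta_mx 0 i1.
have a0 : a != 0.
  apply/eqP => /rowP/(_ i0)/eqP; by rewrite !mxE !eqxx oner_eq0.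
have inj v : v != 0 -> dF v u != 0.
  by apply: contraNneq => /(chart_immersion ch Omu) ->.
have [ea|ea] := eqVneq (et a u) 0.
  by exists (dF a u); [apply/frame_hol|exact: inj].
exists (dF (b - (et b u / et a u) *: a) u).
  by apply/frame_hol; rewrite reeb_formBZ divfK// subrr.
apply: inj; apply/eqP => /rowP/(_ i1)/eqP.
by rewrite !mxE !eqxx /= mulr0 subr0 oner_eq0.
Qed.

End Pointwise.

Lemma Jnormal_smooth : mxsmooth O (fun u => J u).
Proof.
apply: mxsmoothZ => //; first exact: csmooth_cst.
by apply: mxsmoothB => //; exact: mxsmoothM.
Qed.

Lemma mxder_Jnormal u v : O u ->
  mxder (fun t => J t) u v (dJnormal (P u) (n u) (dF v u) (dN v u)).
Proof.
move=> Ou; have dF' := mxder_immersion hN ch v Ou; have dN' := mxder_normal hN ch v Ou.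
have := mxderZl (Complex 0 1) (mxderB (mxderM dN' dF') (mxderM dF' dN')).
by apply: mxder_ext => //.
Qed.

Lemma is_derive_reeb_shape u v w : O u ->
  is_derive u v (om w) (g (mxderive v (mxderive w (N \o c)) u) (J u) +
    g (dN w u) (dJnormal (P u) (n u) (dF v u) (dN v u))).
Proof.
move=> Ou; apply: is_derive_g; last exact: mxder_Jnormal.
by apply: (mxsmooth_mxder v oO) => //; exact: mxsmooth_mxderive.
Qed.

Lemma is_derive_reeb_form u v w : O u ->
  is_derive u v (et w) (- (g (mxderive v (mxderive w (iota \o c)) u) (J u) +
    g (dF w u) (dJnormal (P u) (n u) (dF v u) (dN v u)))).
Proof.
move=> Ou; apply: is_derive_oppf; apply: is_derive_g; last exact: mxder_Jnormal.
by apply: (mxsmooth_mxder v oO) => //; exact: mxsmooth_mxderive.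
Qed.

Lemma ruled_tensor_continuous v1 v2 v3 : of_class_C 0 O (ruled_tensor v1 v2 v3).
Proof.
have sdF w : mxsmooth O (fun u => dF w u) by exact: mxsmooth_mxderive.
have sdN w : mxsmooth O (fun u => dN w u) by exact: mxsmooth_mxderive.
have sJ := Jnormal_smooth.
have cet w : of_class_C 0 O (et w) by apply: of_class_CN => //; exact: of_class_C_g.
have com w : of_class_C 0 O (om w) by exact: of_class_C_g.
have chh v w : of_class_C 0 O (hh v w) by apply: of_class_CN => //; exact: of_class_C_g.
rewrite /ruled_tensor; apply: of_class_CD => //.
  apply: of_class_CD => //; first exact: of_class_CM.
  by apply: of_class_CN => //; exact: of_class_CM.
apply: of_class_CN => //; apply: of_class_CM => //; apply: of_class_CD => //.
  exact: of_class_CM.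
by apply: of_class_CN => //; exact: of_class_CM.
Qed.

End ForwardDirection.

(** * Hopf points do not fill an open set *)

Section RuledShape.
Context {R : realType} {m : nat} {M : topologicalType}.
Local Notation C := (R[i]).
Local Notation E := ('M[C]_m.+1).
Local Notation d := (m.*2.-1).
Local Notation V := ('rV[R]_d).
Variable iota : M -> E.
Hypothesis m1 : (1 < m)%N.
Hypothesis hM : real_hypersurface iota.
Variables (U : set M) (N : M -> E).
Hypothesis hN : unit_normal_field iota U N.
Variables (Om : set V) (c : V -> M).
Hypothesis ch : chart iota Om c.
Implicit Types (u v w : V).

Local Notation O := (normal_chart_domain U Om c).
Local Notation dF v u := (mxderive v (iota \o c) u).
Local Notation dN v u := (mxderive v (N \o c) u).
Local Notation P u := (iota (c u)).
Local Notation n u := (N (c u)).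
Local Notation J u := (JCP (P u) (n u)).
Local Notation D u := (holomorphic (P u) (n u)).
Local Notation A u := (Defs.shape iota N (c u)).
Local Notation dJ v u := (dJnormal (P u) (n u) (dF v u) (dN v u)).
Local Notation et := (reeb_form iota N c).
Local Notation om := (reeb_shape iota N c).

Let oO : open O. Proof. exact: (normal_chart_domain_open hN ch). Qed.

Let proportional_zero (a b c' f : R) : b = 1 -> f = 0 -> a * b = c' * f -> a = 0.
Proof. by move=> -> ->; rewrite mulr1 mulr0. Qed.

Let proportional_derivative (a b c' f a' b' c'' f' : R) : b = 1 -> c' = 0 -> b' = 0 ->
  (a * b + c' * f) + - (a' * b' + c'' * f') = 0 -> a = c'' * f'.
Proof. by move=> -> -> ->; lra. Qed.

(** The vectors [w] and [e] are constant, and [et w = 0] is known at [u] only. As [om w] vanishes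
    there too, differentiating [om w * et e = om e * et w] leaves just the derivatives of [om w] and
    of [et w]. *)
Lemma hopf_derivative u v w e : O u -> (\forall t \near u, hopf_at iota N c t) ->
  et e u = 1 -> et w u = 0 ->
  g (mxderive v (mxderive w (N \o c)) u) (J u) + g (dN w u) (dJ v u) =
  om e u * - (g (mxderive v (mxderive w (iota \o c)) u) (J u) + g (dF w u) (dJ v u)).
Proof.
move=> Ou hopf e1 w0.
have d1 x := is_derive_reeb_shape hN ch v x Ou.
have d2 x := is_derive_reeb_form hN ch v x Ou.
have h0 : om w u = 0 by exact: (proportional_zero e1 w0 (nbhs_singleton hopf w e)).
have dd := is_derive_addf (is_derive_mulf (d1 w) (d2 e))
  (is_derive_oppf (is_derive_mulf (d1 e) (d2 w))).
have nz : \forall t \near u, om w t * et e t + - (om e t * et w t) = 0.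
  by move: hopf; apply: filterS => t Ht; apply/eqP; rewrite subr_eq0; apply/eqP; exact: (Ht w e).
have [_ h] := @near_eq_is_derive _ _ _ _ (fun=> 0 : R) _ _ _ nz dd.
rewrite derive_cst in h.
exact: (proportional_derivative e1 h0 w0 (esym h)).
Qed.

(** [q] and [q'] stem from the second derivatives of [N] and [iota] and are the same in both
    equations by symmetry; [s2] is [g (J X) Y]. After substitution the equations, for [X, Y] and for
    [Y, X], differ only in the sign of [s2]. *)
Let hopf_algebra (q q' a s1 s2 s3 s4 t1 t2 : R) :
  q + (s1 - s2) = a * - (q' + - t1) -> q + (s3 - s4) = a * - (q' + - t2) ->
  s1 = a * t1 -> s3 = a * t2 -> s4 = - s2 -> s2 = 0.
Proof. by move=> e1 e2 e3 e4 e5; lra. Qed.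

Hypothesis comm : forall p, U p -> forall X Y, DD iota p X -> DD iota p Y ->
  A_F iota N p (Defs.phi iota N p X) Y = Defs.phi iota N p (A_F iota N p X Y).

(* For holomorphic [X] the exterior derivative of [om = alpha * et], evaluated on
   [X] and [J X], gives [g (J X) (J X) = 0]. *)
Lemma hopf_not_open u : O u -> ~ (\forall t \near u, hopf_at iota N c t).
Proof.
move=> Ou hopf.
have cpP := hypersurface_CP hM (c u).
have [tn gnn _] := chart_unit_normal hN Ou.
have [X dX X0] := hol_nonzero m1 hM hN ch Ou.
have tX : tangentCP (P u) X by case: dX.
have dY : D u (JCP (P u) X) by exact: holomorphicJ.
have [x xE x0] := hol_frame m1 hM hN ch Ou dX.
have [y yE y0] := hol_frame m1 hM hN ch Ou dY.
have [e eE e1] := reeb_frame m1 hM hN ch Ou.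
have hZX := chart_normal_derivative hN ch x Ou.
have hZY := chart_normal_derivative hN ch y Ou.
have [_ H] := commutation_cases m1 hM hN ch Ou (comm (proj2 Ou)).
have b0 := (hopf_atP m1 hM hN ch Ou).1 (nbhs_singleton hopf).
have aE : g (A u (- J u)) (- J u) = om e u.
  by rewrite -{2}eE (shape_reeb_frame m1 hM hN ch Ou e eE).
have h1 := hopf_derivative x Ou hopf e1 y0.
have h2 := hopf_derivative y Ou hopf e1 x0.
have sF := immersion_chart_smooth U ch; have sN := normal_chart_smooth hN ch.
rewrite (mxderive_comm y x oO sF Ou) (mxderive_comm y x oO sN Ou) in h2.
have AX := shapeE hN ch x Ou; have AY := shapeE hN ch y Ou.
rewrite xE in dX; rewrite yE in dY.
have i1 := g_derivative_dJnormal cpP tn gnn dX dY hZX hZY.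
have i2 := g_derivative_dJnormal cpP tn gnn dY dX hZY hZX.
have i3 := g_tangent_dJnormal cpP tn dX dY hZX.
have i4 := g_tangent_dJnormal cpP tn dY dX hZY.
have k1 := H b0 _ _ dX dY; have k2 := H b0 _ _ dY dX.
rewrite aE AX AY in k1 k2.
rewrite i1 i3 in h1; rewrite i2 i4 in h2.
have s4 : g (JCP (P u) (dF y u)) (dF x u) = - g (JCP (P u) (dF x u)) (dF y u).
  exact (etrans (gJl (P u) (dF y u) (dF x u)) (congr1 _ (gC _ _))).
have := hopf_algebra h1 h2 k1 k2 s4.
rewrite -xE -yE => s2; case/eqP: X0.
apply: (g_eq0 (tangent_hermitian tX)).
rewrite -(gJJ cpP X tX); exact: s2.
Qed.

Lemma commuting_ruled_at u : O u -> ruled_at iota N c u.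
Proof.
move=> Ou; have [hopf|nhopf] := pselect (\forall t \near u, hopf_at iota N c t).
  by case: (hopf_not_open Ou hopf).
have nonhopf w : O w -> ~ hopf_at iota N c w -> ruled_at iota N c w.
  move=> Ow nh; have [H _] := commutation_cases m1 hM hN ch Ow (comm (proj2 Ow)).
  have [Y dY bY] : exists2 Y, D w Y & g (A w (- J w)) Y <> 0.
    apply: contrapT => h; apply: nh; apply/(hopf_atP m1 hM hN ch Ow) => Y dY.
    by apply: contrapT => bY; apply: h; exists Y.
  move=> v v' /(frame_hol m1 hM hN ch Ow) dv /(frame_hol m1 hM hN ch Ow) dv'.
  rewrite -(shape_frame m1 hM hN ch Ow); apply: H => //.
  by exists Y.
apply/(ruled_atP m1 hM hN ch Ou) => v1 v2 v3.
have /continuous_epsP cT : {for u, continuous (ruled_tensor iota N c v1 v2 v3)}.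
  exact (ruled_tensor_continuous hN ch Ou).
apply/eqP; rewrite -normr_le0; apply/ler_addgt0Pl => eps eps0; rewrite addr0.
have [r r0 Hr] := cT eps eps0.
(* The Hopf points fill no neighbourhood of [u], so there is a point within distance [r] where the
   tensor is known to vanish. *)
have [w [bw Ow nw]] : exists w, [/\ ball u r w, O w & ~ hopf_at iota N c w].
  apply: contrapT => h; apply: nhopf; near=> t.
  apply: contrapT => nt; apply: h; exists t; split => //; near: t.
    exact: nbhsx_ballx.
  exact: (near_chart_domain hN ch Ou).
have /(ruled_atP m1 hM hN ch Ow)/(_ v1 v2 v3) Tw := nonhopf w Ow nw.
by have := Hr w bw; rewrite Tw subr0.
Unshelve. all: by end_near. Qed.

End RuledShape.

(** * Leaves *)

Section InversePath.
Context {R : realType} {d : nat}.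
Local Notation V := 'rV[R]_d.

(** The segment to [tau] is lifted through [f] by [inverse_function]. It is lifted for [|t| < 2]
    because two-sided derivatives are wanted at 0 and 1. *)
Lemma inverse_path (f : V -> V) (Om : set V) u0 :
  open Om -> Om u0 -> (forall j, of_class_C 1 Om (fun u => f u 0 j)) -> f u0 = 0 ->
  (forall u, Om u -> jacobian_mx f u \in unitmx) ->
  exists2 rho, 0 < rho & forall tau : V, `|tau| <= rho -> exists c : R -> V,
    c 0 = u0 /\ forall t : R, `|t| < 2 ->
      [/\ Om (c t), f (c t) = t *: tau & exists v, is_derive t 1 c v].
Proof.
move=> oOm Om0 fC f0 uJ.
pose G := invmx (jacobian_mx f u0).
have JG : jacobian_mx f u0 *m G = 1%:M by rewrite mulmxV// uJ.
have half0 : 0 < 1 / 2 :> R by lra.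
have [r1 r10 Hr1] := strict_left_inverse oOm Om0 fC JG half0.
have /nbhs_ballP[r2 /= r20 Hr2] : nbhs u0 Om by exact: open_nbhs_nbhs.
pose r := Num.min r1 r2.
have r0 : 0 < r by rewrite lt_min r10.
have br1 u : ball u0 r u -> ball u0 r1 u by apply: le_ball; rewrite /r ge_min lexx.
have br2 u : ball u0 r u -> Om u by move=> b; apply: Hr2; apply: le_ball b; rewrite /r ge_min lexx orbT.
pose psi u := f u *m G.
have Hpsi u u' : ball u0 r u -> ball u0 r u' ->
    `|psi u - psi u' - (u - u')| <= 1 / 2 * `|u - u'|.
  by move=> /br1 bu /br1 bu'; rewrite /psi -mulmxBl; exact: Hr1.
have psi0 : psi u0 = 0 by rewrite /psi f0 mul0mx.
have cpsi u : ball u0 r u -> {for u, continuous psi}.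
  move=> bu; have /nbhs_ballP[r3 /= r30 Hr3] : nbhs u (ball u0 r).
    by apply: open_nbhs_nbhs; split=> //; exact: ball_open.
  apply: (iffRL (@cvgrPdist_le _ _ _ (nbhs u) _ _ _)) => eps eps0.
  apply/nbhs_ballP; exists (Num.min r3 (eps / 2)); first by rewrite /= lt_min r30 divr_gt0.
  move=> t bt; have bt3 : ball u0 r t.
    by apply: Hr3; apply: le_ball bt; rewrite ge_min lexx.
  have := Hpsi _ _ bu bt3.
  have : `|u - t| <= eps / 2.
    move: bt; rewrite -ball_normE /= lt_min => /andP[_ h]; exact: ltW.
  have : `|psi u - psi t| <= `|psi u - psi t - (u - t)| + `|u - t|.
    by rewrite -{1}[psi u - psi t](subrK (u - t)); exact: ler_normD.
  lra.
have inv := inverse_function r0 Hpsi cpsi.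
have [C C0 HC] := row_norm_mulmx_le G.
have C10 : 0 < C + 1 by rewrite ltr_wpDl.
(* For [|t| <= 2] the target [t *: (tau *m G)] has norm at most [2 * (r / 32) = r / 16], as
   [inverse_function] requires. *)
exists (r / 32 / (C + 1)); first by rewrite !divr_gt0.
move=> tau htau.
have tauG : `|tau *m G| <= r / 32.
  apply: le_trans (HC _) _; apply: (@le_trans _ _ ((C + 1) * (r / 32 / (C + 1)))).
    by apply: ler_pM => //; rewrite lerDl.
  by rewrite mulrC divfK// gt_eqF.
have sol (t : R) : exists u, `|t| <= 2 -> `|u - u0| <= r / 2 /\ psi u = t *: (tau *m G).
  have [t2|t2] := leP `|t| 2; last by exists u0.
  have [|u hu Hu] := inv (t *: (tau *m G)); last by exists u.
  rewrite psi0 subr0 normrZ; apply: (@le_trans _ _ (2 * (r / 32))); last by lra.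
  by apply: ler_pM.
have /choice[c Hc] := sol.
have cball (t : R) : `|t| <= 2 -> ball u0 r (c t).
  move=> /Hc [h _]; rewrite -ball_normE /= distrC; apply: le_lt_trans h _; lra.
have cE (t : R) : `|t| <= 2 -> f (c t) = t *: tau.
  move=> /Hc [_]; rewrite /psi => /(congr1 (fun w => w *m jacobian_mx f u0)).
  by rewrite -scalemxAl -!mulmxA mulVmx ?uJ// !mulmx1.
(* The points [c t] come from a choice; this Lipschitz bound makes them a continuous curve. *)
have clip (s t : R) : `|s| <= 2 -> `|t| <= 2 -> `|c s - c t| <= 2 * (`|s - t| * `|tau *m G|).
  move=> hs ht; have := Hpsi _ _ (cball s hs) (cball t ht).
  have [_ ->] := Hc s hs; have [_ ->] := Hc t ht.
  rewrite -scalerBl.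
  have : `|c s - c t| <= `|(s - t) *: (tau *m G)| + `|(s - t) *: (tau *m G) - (c s - c t)|.
    have {1}-> : c s - c t = (s - t) *: (tau *m G) - ((s - t) *: (tau *m G) - (c s - c t)).
      by rewrite opprB [RHS]addrC subrK.
    exact: ler_normB.
  rewrite normrZ; lra.
exists c; split.
  have h0 : `|0 : R| <= 2 by rewrite normr0.
  have := Hpsi _ _ (cball 0 h0) (ballxx _ r0).
  have [_ ->] := Hc 0 h0; rewrite scale0r psi0 subr0 sub0r normrN => h.
  by apply/eqP; rewrite -subr_eq0 -normr_le0; have := normr_ge0 (c 0 - u0); lra.
move=> t t2; have ht := ltW t2.
have Omc : Om (c t) by apply: br2; exact: cball.
split=> //; first exact: cE.
have JG' : jacobian_mx f (c t) *m invmx (jacobian_mx f (c t)) = 1%:M by rewrite mulmxV// uJ.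
have near2 : \forall h \near (0 : R), `|h + t| <= 2.
  apply/nbhs_ballP; exists (2 - `|t|); [by rewrite /= subr_gt0|move=> h /=].
  rewrite -ball_normE /= sub0r normrN => h1.
  by apply: le_trans (ler_normD _ _) _; lra.
have cc (e : R) : 0 < e -> \forall h \near (0 : R), ball (c t) e (c (h *: 1 + t)).
  move=> e0; pose k := 2 * (`|tau *m G| + 1).
  have k0 : 0 < k by rewrite mulr_gt0// ltr_wpDl.
  have nh : \forall h \near (0 : R), `|h| < e / k.
    apply/nbhs_ballP; exists (e / k); first by rewrite /= divr_gt0.
    by move=> h; rewrite -ball_normE /= sub0r normrN.
  apply: filterS2 near2 nh => h h2; rewrite ltr_pdivlMr// => hk.
  rewrite [h *: (1 : R^o)]mulr1 -ball_normE /= distrC.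
  apply: le_lt_trans (clip _ _ h2 ht) _; rewrite addrK.
  apply: le_lt_trans hk; rewrite /k mulrCA; apply: ler_wpM2l => //.
  by apply: ler_wpM2l => //; rewrite lerDl.
have df : is_derive t 1 (fun s => f (c s)) tau.
  apply/is_derive_epsP => e e0; apply: filterS near2 => h h2.
  rewrite [h *: (1 : R^o)]mulr1 (cE _ h2) (cE _ ht) scalerDl addrK subrr normr0.
  by rewrite mulr_ge0// ltW.
by exists (tau *m invmx (jacobian_mx f (c t))); exact: (is_derive_lift oOm Omc fC JG' cc df).
Qed.

End InversePath.

Section CauchySchwarz.
Context {R : realType} {m : nat}.
Local Notation C := (R[i]).
Local Notation E := ('M[C]_m.+1).
Implicit Types (X Y H K B : E).

Lemma g_CauchySchwarz X Y : X ^t* = X -> Y ^t* = Y -> g X Y ^+ 2 <= g X X * g Y Y.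
Proof.
move=> hX hY; have [Y0|Y0] := eqVneq (g Y Y) 0.
  by rewrite (g_eq0 hY Y0) !g0r mulr0 expr0n.
have Yp : 0 < g Y Y by rewrite lt0r Y0 g_ge0.
have hD : ((g Y Y)%:C *: X - (g X Y)%:C *: Y) ^t* = (g Y Y)%:C *: X - (g X Y)%:C *: Y.
  by rewrite adjmxB !adjmxZ hX hY !conj_realC.
have := g_ge0 hD; rewrite !gBl !gBr !gZl !gZr (gC Y X).
set a := g X X; set b := g X Y; set e := g Y Y => h.
have : 0 <= e * (a * e - b ^+ 2) by rewrite expr2; lra.
by rewrite pmulr_rge0// subr_ge0.
Qed.

Definition herm_part K : E := (1 / 2 : R)%:C *: (K + K ^t*).

Lemma herm_part_adj K : (herm_part K) ^t* = herm_part K.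
Proof. by rewrite /herm_part adjmxZ conj_realC adjmxD adjmxK addrC. Qed.

Lemma g_adj X Y : g (X ^t*) (Y ^t*) = g X Y.
Proof.
by rewrite /g -adjmxM tr_adjmx Re_conj_complex mxtrace_mulC.
Qed.

Lemma g_herm_part H K : H ^t* = H -> g H K = g H (herm_part K).
Proof. by move=> hH; rewrite gZr gDr -[g H (K ^t*)]g_adj hH adjmxK; field. Qed.

(** The left-hand side will be the derivative of [2 * g H H] along the path. [K] and [B] need not be
    Hermitian, but only their Hermitian parts pair with [H]; Cauchy-Schwarz and
    [- 2 a b <= a^2 + b^2] do the rest. *)
Lemma g_product_bound H K B : H ^t* = H ->
  - (4 * (g H K * g H B)) <=
  (g (herm_part K) (herm_part K) + g (herm_part B) (herm_part B)) * (2 * g H H).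
Proof.
move=> hH; rewrite (g_herm_part K hH) (g_herm_part B hH).
have := g_CauchySchwarz hH (herm_part_adj K); have := g_CauchySchwarz hH (herm_part_adj B).
set a := g H (herm_part K); set b := g H (herm_part B); set s := g H H.
have : 0 <= (a + b) ^+ 2 by exact: sqr_ge0.
rewrite !expr2; lra.
Qed.

End CauchySchwarz.

Lemma normal_vector_unit {R : realType} {m : nat} (P n : 'M[R[i]]_m.+1) (z : 'cV[R[i]]_m.+1) :
  CP P -> tangentCP P n -> g n n = 1 -> z ^t* *m z = 1%:M -> P = z *m z ^t* ->
  (n *m z) ^t* *m (n *m z) = 1%:M.
Proof.
move=> cpP tn gnn zz PE.
rewrite adjmxM (tangent_hermitian tn) -(unit_vector_P zz PE) !mulmxA.
have -> : z ^t* *m P *m n *m n = z ^t* *m (P *m n *m n) by rewrite !mulmxA.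
by rewrite (Pnn cpP tn gnn) (unit_vector_P zz PE) zz.
Qed.

(** * An affine coordinate on the projective space around a point *)

Section AffineCoordinate.
Context {R : realType} {m : nat}.
Local Notation C := (R[i]).
Local Notation E := ('M[C]_m.+1).
Variables (P : E) (z : 'cV[C]_m.+1).
Hypotheses (cpP : CP P) (zz : z ^t* *m z = 1%:M) (PE : P = z *m z ^t*).
Implicit Types (Q X : E).

(** The trace of [Q *m P], that is the squared modulus of the inner product of unit vectors on the
    two lines. The factor 2 undoes the one half in [g]. *)
Definition affine_weight Q : R := 2 * g Q P.

(* The vector on the line [Q] with inner product 1 with [z]. *)
Definition affine_vector Q : 'cV[C]_m.+1 := ((affine_weight Q)^-1)%:C *: (Q *m z).

Lemma affine_weight_base : affine_weight P = 1.
Proof.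
have [_ PP trP] := cpP.
by rewrite /affine_weight /g PP trP mulrC divfK.
Qed.

Lemma affine_vector_base : affine_vector P = z.
Proof.
by rewrite /affine_vector affine_weight_base invr1 scale1r (P_unit_vector zz PE).
Qed.

Lemma affine_weightE Q : CP Q -> \tr (Q *m P) = (affine_weight Q)%:C.
Proof.
move=> [hQ _ _]; have [hP _ _] := cpP.
have : ((\tr (Q *m P))^*)%R = \tr (Q *m P).
  by rewrite -tr_adjmx adjmxM hQ hP mxtrace_mulC.
rewrite /affine_weight /g; case: (\tr _) => a b [] /= h.
by apply/eqP; rewrite eq_complex /=; apply/andP; split; apply/eqP; lra.
Qed.

Lemma affine_vectorE Q : CP Q -> 0 < affine_weight Q ->
  Q = (affine_weight Q)%:C *: (affine_vector Q *m (affine_vector Q) ^t*).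
Proof.
move=> cpQ a0; have [hQ _ _] := cpQ.
have e : Q *m z *m (Q *m z) ^t* = (affine_weight Q)%:C *: Q.
  by rewrite -(affine_weightE cpQ) -(CP_sandwich cpQ) adjmxM hQ PE !mulmxA.
rewrite /affine_vector adjmxZ conj_realC -scalemxAl -scalemxAr e !scalerA.
rewrite -!rmorphM /= -[LHS]scale1r; congr (_ *: _); congr (_%:C).
by field; rewrite gt_eqF.
Qed.

Lemma affine_vector_fix Q : CP Q -> Q *m affine_vector Q = affine_vector Q.
Proof. by move=> [_ QQ _]; rewrite /affine_vector -scalemxAr mulmxA QQ. Qed.

Lemma affine_vector_normalized Q : CP Q -> 0 < affine_weight Q ->
  z ^t* *m affine_vector Q = 1%:M.
Proof.
move=> cpQ a0; rewrite /affine_vector -scalemxAr.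
have -> : z ^t* *m (Q *m z) = ((affine_weight Q)%:C)%:M.
  by rewrite -(affine_weightE cpQ) PE mulmxA mxtrace_mulC mulmxA [LHS]mx11_scalar -trace_mx11.
by rewrite scale_scalar_mx -rmorphM /= mulVf ?gt_eqF.
Qed.

Lemma affine_vector_inj Q Q' : CP Q -> CP Q' -> 0 < affine_weight Q ->
  0 < affine_weight Q' -> affine_vector Q = affine_vector Q' -> Q = Q'.
Proof.
move=> cpQ cpQ' a0 a0' e; have E1 := affine_vectorE cpQ a0; have E2 := affine_vectorE cpQ' a0'.
rewrite -e in E2; set B := _ *m _ in E1 E2.
have [_ _ t1] := cpQ; have [_ _ t2] := cpQ'.
rewrite E1 mxtraceZ in t1; rewrite E2 mxtraceZ in t2.
have B0 : \tr B != 0 by apply: contra_eq_neq t1 => ->; rewrite mulr0 eq_sym oner_neq0.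
rewrite E1 [RHS]E2; congr (_ *: _); apply: (mulIf B0).
by rewrite t1 t2.
Qed.

Lemma g_affine X Q : tangentCP P X -> CP Q ->
  complex.Re (((X *m z) ^t* *m affine_vector Q) 0 0) = g Q X / affine_weight Q.
Proof.
move=> tX [hQ _ _]; have hX := tangent_hermitian tX; have [hP _ _] := cpP.
have -> : ((X *m z) ^t* *m affine_vector Q) 0 0 =
    ((affine_weight Q)^-1)%:C * \tr (X *m Q *m P).
  rewrite /affine_vector -scalemxAr mxE; congr (_ * _).
  by rewrite adjmxM hX PE mulmxA [in RHS]mxtrace_mulC !mulmxA trace_mx11.
rewrite Re_realCM mulrC; congr (_ * _).
rewrite /g -{2}(tangent_split tX) mulmxDr mxtraceD !mulmxA.
have -> : \tr (Q *m P *m X) = \tr (X *m Q *m P).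
  by rewrite mxtrace_mulC mulmxA.
have -> : \tr (Q *m X *m P) = ((\tr (X *m Q *m P))^*)%R.
  by rewrite -tr_adjmx !adjmxM hX hQ hP mulmxA mxtrace_mulC mulmxA.
by rewrite ReD_complex Re_conj_complex; field.
Qed.

Lemma g_base_tangent X : tangentCP P X -> g P X = 0.
Proof.
move=> tX; have [_ PP _] := cpP; rewrite /g.
by rewrite -PP -mulmxA mxtrace_mulC (tangent_PXP cpP tX) mxtrace0 mul0r.
Qed.

End AffineCoordinate.

Section LeafAlgebra.
Context {R : realType} {m : nat}.
Local Notation C := (R[i]).
Local Notation E := ('M[C]_m.+1).
Variables (Q n X W0 : E) (xi xi' y w : 'cV[C]_m.+1) (a f' : R).
Hypotheses (cpQ : CP Q) (tn : tangentCP Q n) (gnn : g n n = 1).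
Hypotheses (tX : tangentCP Q X) (nX : g n X = 0).
Hypotheses (QE : Q = a%:C *: (xi *m xi ^t*)) (Qxi : Q *m xi = xi).
Hypothesis dxi : X *m xi + Q *m xi' = xi'.
Hypothesis xi'E : xi' = y + f'%:C *: w.
Hypothesis W0y : W0 *m y = 0.
Let W := normal_line Q n.
Let nu := n *m xi.
Let gam : C := (nu ^t* *m w) 0 0.
Let bet : C := (nu ^t* *m y) 0 0.
Hypotheses (a0 : 0 < a) (gam0 : 0 < complex.Re gam).

Let hn : n ^t* = n. Proof. exact: (tangent_hermitian tn). Qed.

(** With [f' = - Re bet / Re gam] the component of [X] along [JCP Q n] is
    [a * (Im bet - Re bet * Im gam / Re gam)], a real linear form in [bet]. This matrix represents
    it, the factor 2 undoing the one half in [g]. *)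
Definition leaf_kernel (nu : 'cV[C]_m.+1) (gam : C) : E :=
  (- (2 * a)%:C * (Complex 0 1 + (complex.Im gam / complex.Re gam)%:C)) *: (y *m nu ^t*).

(** The real part of this number vanishes because [X] is orthogonal to [n], which determines [f'];
    the imaginary part is the component of [X] along [JCP Q n]. *)
Lemma leaf_trace : \tr (Q *m n *m X) = a%:C * (bet + f'%:C * gam).
Proof.
have e : xi ^t* *m n *m X *m xi = nu ^t* *m xi'.
  have QnQ := tangent_PXP cpQ tn.
  have xiQ : xi ^t* *m Q = xi ^t*.
    by have [hQ _ _] := cpQ; rewrite -{1}hQ -adjmxM Qxi.
  have xinQ : xi ^t* *m n *m Q = 0.
    by rewrite -{1}xiQ -!mulmxA (mulmxA Q) QnQ mulmx0.
  have Xxi : X *m xi = xi' - Q *m xi' by rewrite -{1}dxi addrK.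
  rewrite -[LHS]mulmxA Xxi mulmxBr mulmxA xinQ mul0mx subr0.
  by rewrite /nu adjmxM hn.
have -> : \tr (Q *m n *m X) = a%:C * (xi ^t* *m n *m X *m xi) 0 0.
  rewrite {1}QE -!scalemxAl mxtraceZ; congr (_ * _).
  by rewrite -!mulmxA mxtrace_mulC !mulmxA trace_mx11.
rewrite e xi'E mulmxDr -scalemxAr; congr (_ * _).
by rewrite mxE [X in _ + X]mxE.
Qed.

(** [nu] lies on the line of [W] and [y] is orthogonal to that of [W0], so [bet] only sees the
    difference of the two lines. *)
Lemma leaf_bet : bet = (nu ^t* *m (W - W0) *m y) 0 0.
Proof.
rewrite /bet; congr (fun A : 'M[C]_1 => A 0 0).
rewrite -mulmxA mulmxBl W0y subr0 mulmxA.
have Wnu : W *m nu = nu.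
  by rewrite /W /nu /normal_line !mulmxA -(mulmxA n) -(mulmxA n) (Pnn cpQ tn gnn) -mulmxA Qxi.
have hW : W ^t* = W := normal_line_adj cpQ tn.
by rewrite -{1}hW -adjmxM Wnu.
Qed.

Lemma leaf_speed : f' = - complex.Re bet / complex.Re gam.
Proof.
have := g_normal cpQ tn (tangent_hermitian tX); rewrite nX leaf_trace Re_realCM => /esym/eqP.
rewrite mulf_eq0 (gt_eqF a0) /= ReD_complex Re_realCM addr_eq0 => /eqP e.
by rewrite e opprK mulfK// gt_eqF.
Qed.

Lemma leaf_speed0 : W = W0 -> f' = 0.
Proof.
by move=> e; rewrite leaf_speed leaf_bet e subrr mulmx0 mul0mx mxE oppr0 mul0r.
Qed.

(* The component of the velocity [X] along the Reeb vector is linear in [W - W0],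
   which makes Gronwall's inequality applicable to [W - W0]. *)
Lemma leaf_reeb : g X (JCP Q n) = g (W - W0) (leaf_kernel nu gam).
Proof.
rewrite (g_Jnormal cpQ tn (tangent_hermitian tX)) leaf_trace ImM_complex /= mul0r addr0.
rewrite ImD_complex ImM_complex /= mul0r addr0 leaf_speed.
rewrite /leaf_kernel /g -scalemxAr mxtraceZ.
have -> : \tr ((W - W0) *m (y *m nu ^t*)) = bet.
  by rewrite mulmxA mxtrace_mulC mulmxA trace_mx11 -leaf_bet.
move: gam0 bet; case: gam => r s /= r0; case=> p q /=.
by field; rewrite gt_eqF.
Qed.

End LeafAlgebra.

Lemma is_derive_quotient0 {R : realType} {V : normedModType R} (f h : V -> R) u v a :
  is_derive u v f a -> derivable h u v -> f u = 0 -> h u = 1 ->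
  is_derive u v (fun t => f t / h t) a.
Proof.
move=> df dh f0 h1; have h0 : h u != 0 by rewrite h1 oner_eq0.
have dV : is_derive u v (fun t => (h t)^-1) ('D_v (fun t => (h t)^-1) u).
  exact: (derivableP (derivableV h0 dh)).
have := is_derive_mulf df dV; apply: is_derive_ext => //.
by rewrite f0 h1 invr1 mulr1 mul0r addr0.
Qed.

Section NormalLineField.
Context {R : realType} {m : nat} {M : topologicalType}.
Local Notation C := (R[i]).
Local Notation E := ('M[C]_m.+1).
Local Notation d := (m.*2.-1).
Local Notation V := ('rV[R]_d).
Local Notation e_ j := (delta_mx 0 j : V).
Variable iota : M -> E.
Hypothesis m1 : (1 < m)%N.
Hypothesis hM : real_hypersurface iota.
Variables (U : set M) (N : M -> E).
Hypothesis hN : unit_normal_field iota U N.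
Variables (Om : set V) (c : V -> M).
Hypothesis ch : chart iota Om c.
Implicit Types (u v : V).

Local Notation O := (normal_chart_domain U Om c).
Local Notation dF v u := (mxderive v (iota \o c) u).
Local Notation dN v u := (mxderive v (N \o c) u).
Local Notation P u := (iota (c u)).
Local Notation n u := (N (c u)).
Local Notation J u := (JCP (P u) (n u)).
Local Notation et := (reeb_form iota N c).

Let oO : open O. Proof. exact: (normal_chart_domain_open hN ch). Qed.
Let sF : mxsmooth O (iota \o c). Proof. exact: (immersion_chart_smooth U ch). Qed.
Let sN : mxsmooth O (N \o c). Proof. exact: (normal_chart_smooth hN ch). Qed.

Definition line_field u : E := normal_line (P u) (n u).

Lemma line_field_smooth : mxsmooth O line_field.
Proof. by apply: mxsmoothM => //; exact: mxsmoothM. Qed.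

Lemma line_field_stationary u v : O u -> ruled_at iota N c u -> et v u = 0 ->
  mxderive v line_field u = 0.
Proof.
move=> Ou rul v0.
have cpP := hypersurface_CP hM (c u).
have [tn gnn _] := chart_unit_normal hN Ou.
have hZ := chart_normal_derivative hN ch v Ou.
have dX : holomorphic (P u) (n u) (dF v u) by apply/(frame_hol m1 hM hN ch Ou).
have Z0 Y : holomorphic (P u) (n u) Y -> g (dN v u) Y = 0.
  move=> /(hol_frame m1 hM hN ch Ou)[w -> w0].
  by apply/eqP; rewrite -oppr_eq0; apply/eqP; exact: (rul v w v0 w0).
have e := normal_line_stationary cpP tn gnn dX hZ Z0.
have dF' := mxder_immersion hN ch v Ou; have dN' := mxder_normal hN ch v Ou.
by rewrite -[RHS]e; apply: mxder_mxderive; exact: (mxderM (mxderM dN' dF') dN').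
Qed.

(** The coordinates of [xi] in the chart frame, solved through the Gram matrix so as to be smooth in
    [u]. *)
Definition reeb_coordinates u : V :=
  (\row_j g (- J u) (dF (e_ j) u)) *m invmx (chart_gram iota c u).

Lemma reeb_coordinatesP u : O u ->
  dF (reeb_coordinates u) u = - J u /\ et (reeb_coordinates u) u = 1.
Proof.
move=> Ou; have [e eE e1] := reeb_frame m1 hM hN ch Ou.
have Omu : Om u by case: Ou.
suff -> : reeb_coordinates u = e by [].
rewrite /reeb_coordinates.
have -> : \row_j g (- J u) (dF (e_ j) u) = e *m chart_gram iota c u.
  apply/rowP => j; rewrite [LHS]mxE -eE (chart_frameE ch Omu) g_suml mxE.
  by apply: eq_bigr => k _; rewrite gZl [chart_gram _ _ _ _ _]mxE.
by rewrite mulmxK//; exact: (chart_gram_unit hM ch Omu).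
Qed.

Lemma reeb_coordinates_smooth k j : of_class_C k O (fun u => reeb_coordinates u 0 j).
Proof.
have sX i : mxsmooth O (fun u => dF (e_ i) u) by exact: mxsmooth_mxderive.
have sJ := Jnormal_smooth hN ch.
apply: (@of_class_C_eq _ _ _ _ (fun u => \sum_i g (- J u) (dF (e_ i) u) *
    invmx (chart_gram iota c u) i j)) => //.
  by move=> u _; rewrite [RHS]mxE; apply: eq_bigr => i _; rewrite mxE.
apply: of_class_C_sum => // i _; apply: of_class_CM => //.
  by apply: of_class_C_g => //; exact: mxsmoothN.
apply: of_class_C_invmx => //; first by move=> u [Omu _]; exact: (chart_gram_unit hM ch Omu).
move=> a b; apply: (@of_class_C_eq _ _ _ _ (fun u => g (dF (e_ a) u) (dF (e_ b) u))) => //.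
  by move=> u _; rewrite mxE.
exact: of_class_C_g.
Qed.

Definition line_field_reeb u : E := mxderive (reeb_coordinates u) line_field u.

Lemma line_field_reeb_smooth : mxsmooth O line_field_reeb.
Proof.
have sW := line_field_smooth.
apply: (@mxsmooth_eq _ _ _ _ _ (fun u => \sum_j (reeb_coordinates u 0 j)%:C *:
    mxderive (e_ j) line_field u)) => //.
  by move=> u Ou; rewrite /line_field_reeb (mxderive_sum _ oO sW Ou).
apply: mxsmooth_sum => // j; apply: mxsmoothZ => //; last exact: mxsmooth_mxderive.
by apply: csmooth_real => // k; exact: reeb_coordinates_smooth.
Qed.

Lemma line_field_derive u v : O u -> ruled_at iota N c u ->
  mxderive v line_field u = (et v u)%:C *: line_field_reeb u.
Proof.
move=> Ou rul; have [_ e1] := reeb_coordinatesP Ou.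
apply/eqP; rewrite -subr_eq0; apply/eqP.
rewrite -(mxderive_dirBZ oO line_field_smooth Ou).
by apply: line_field_stationary => //; rewrite (reeb_formBZ hN ch Ou) e1 mulr1 subrr.
Qed.

End NormalLineField.

Section AffineChart.
Context {R : realType} {m : nat} {M : topologicalType}.
Local Notation C := (R[i]).
Local Notation E := ('M[C]_m.+1).
Local Notation d := (m.*2.-1).
Local Notation V := ('rV[R]_d).
Local Notation e_ j := (delta_mx 0 j : V).
Variable iota : M -> E.
Hypothesis hM : real_hypersurface iota.
Variables (Om : set V) (c : V -> M) (u0 : V).
Hypothesis ch : chart iota Om c.
Hypothesis Om0 : Om u0.

Local Notation F := (iota \o c).
Local Notation P0 := (iota (c u0)).
Local Notation X_ j := (mxderive (e_ j) F u0).
Let oOm : open Om. Proof. exact: chart_open ch. Qed.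
Let sF : mxsmooth Om F. Proof. exact: chart_smooth ch. Qed.

(** By [g_affine] these are the real inner products of the affine vector with the frame at [u0].
    Among the directions tangent to CP^m only the normal is forgotten, and the Jacobian at [u0] is
    the invertible Gram matrix. *)
Definition affine_projection (Q : E) : V := \row_j (g Q (X_ j) / affine_weight P0 Q).

Let phi j u := affine_projection (F u) 0 j.

Definition affine_domain : set V := Om `&` [set u | 0 < affine_weight P0 (F u)].

Lemma affine_weight_smooth k : of_class_C k Om (fun u => affine_weight P0 (F u)).
Proof.
apply: of_class_CM => //; first exact: of_class_C_cst.
by apply: of_class_C_g => //; exact: mxsmooth_cst.
Qed.

Lemma affine_domain_open : open affine_domain.
Proof. by apply: open_positive => //; exact: affine_weight_smooth. Qed.

Lemma affine_projection_smooth k j :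
  of_class_C k affine_domain (fun u => affine_projection (F u) 0 j).
Proof.
have oD := affine_domain_open.
apply: (@of_class_C_eq _ _ _ _ (fun u => g (F u) (X_ j) * (affine_weight P0 (F u))^-1)) => //.
  by move=> u _; rewrite mxE.
have sub : affine_domain `<=` Om by move=> u [].
apply: of_class_CM => //.
  by apply: of_class_C_g => //; [exact: mxsmooth_sub sub _|exact: mxsmooth_cst].
apply: of_class_CV => //; first by move=> u [_ h]; rewrite gt_eqF.
exact: of_class_C_sub sub (affine_weight_smooth k).
Qed.

Lemma affine_projection0 : affine_projection (F u0) = 0.
Proof.
apply/rowP => j; rewrite !mxE.
rewrite (g_base_tangent (hypersurface_CP hM _) (chart_tangentCP hM _ ch Om0)).
by rewrite mul0r.
Qed.

Lemma affine_jacobian0 :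
  jacobian_mx (fun u => affine_projection (F u)) u0 = chart_gram iota c u0.
Proof.
apply/matrixP => i j; rewrite [RHS]mxE [LHS]mxE.
have cpP := hypersurface_CP hM (c u0).
have tX k := chart_tangentCP hM (e_ k) ch Om0.
have dF' := mxsmooth_mxder (e_ i) oOm sF Om0.
have d1 := is_derive_g dF' (mxder_cst (X_ j) u0 (e_ i)).
have [/(_ u0 Om0) da _] := affine_weight_smooth 1 (e_ i).
have a1 : affine_weight P0 (F u0) = 1 by exact: affine_weight_base.
have [_ h] : is_derive u0 (e_ i) (phi j) (g (X_ i) (X_ j)).
  have := is_derive_quotient0 d1 da (g_base_tangent cpP (tX j)) a1.
  by apply: is_derive_ext => [t|]; rewrite ?g0r ?addr0// /phi mxE.
exact: h.
Qed.

End AffineChart.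

Lemma cder_real_id {R : realType} (t : R) : cder (fun s : R => s%:C) (t : R^o) 1 1.
Proof. by split=> /=; [exact: is_derive_id|exact: is_derive_cst]. Qed.

Lemma mxder_affine_curve {R : realType} p (z y w : 'cV[R[i]]_p) (f : R -> R) (t f' : R) :
  is_derive t 1 f f' ->
  mxder (fun s : R => z + s%:C *: y + (f s)%:C *: w) (t : R^o) 1 (y + f'%:C *: w).
Proof.
move=> df; have cf : cder (fun s : R => (f s)%:C) (t : R^o) 1 (f'%:C).
  by split=> /=; [exact: df|exact: is_derive_cst].
have d2 := mxderD (mxderD (mxder_cst z (t : R^o) 1)
  (mxderZ (cder_real_id t) (mxder_cst y (t : R^o) 1))) (mxderZ cf (mxder_cst w (t : R^o) 1)).
apply: (mxder_ext _ _ d2) => //.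
by rewrite (scaler0 _ (t%:C)) (scaler0 _ ((f t)%:C)) !addr0 add0r scale1r.
Qed.

(** * The path to a prescribed point of the hyperplane *)

Section LeafPath.
Context {R : realType} {m : nat} {M : topologicalType}.
Local Notation C := (R[i]).
Local Notation E := ('M[C]_m.+1).
Local Notation d := (m.*2.-1).
Local Notation V := ('rV[R]_d).
Local Notation e_ j := (delta_mx 0 j : V).
Variable iota : M -> E.
Hypothesis m1 : (1 < m)%N.
Hypothesis hM : real_hypersurface iota.
Variables (U : set M) (N : M -> E).
Hypothesis hN : unit_normal_field iota U N.
Variables (Om : set V) (c : V -> M).
Hypothesis ch : chart iota Om c.
Implicit Types (u v : V).

Local Notation O := (normal_chart_domain U Om c).
Hypothesis rul : forall u, O u -> ruled_at iota N c u.
Variables (u0 : V) (z0 : 'cV[C]_m.+1).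
Hypothesis Ou0 : O u0.
Hypotheses (zz : z0 ^t* *m z0 = 1%:M) (PE : iota (c u0) = z0 *m z0 ^t*).

Local Notation F := (iota \o c).
Local Notation P0 := (iota (c u0)).
Local Notation n0 := (N (c u0)).
Local Notation w := (n0 *m z0).
Local Notation W0 := (normal_line P0 n0).
Local Notation X_ j := (mxderive (e_ j) F u0).
Local Notation a_ u := (affine_weight P0 (iota (c u))).
Local Notation ze u := (affine_vector P0 z0 (iota (c u))).
Local Notation nu u := (N (c u) *m ze u).
Local Notation ga u := (((nu u) ^t* *m w) 0 0).
Local Notation proj := (affine_projection iota c u0).

Let m0 : (0 < m)%N. Proof. exact: ltnW. Qed.
Let oO : open O. Proof. exact: (normal_chart_domain_open hN ch). Qed.
Let sF : mxsmooth O F. Proof. exact: (immersion_chart_smooth U ch). Qed.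
Let sN : mxsmooth O (N \o c). Proof. exact: (normal_chart_smooth hN ch). Qed.
Let cpP : CP P0. Proof. exact: (hypersurface_CP hM _). Qed.
Let un : unit_normal iota (c u0) n0. Proof. exact: (chart_unit_normal hN Ou0). Qed.
Let tn : tangentCP P0 n0. Proof. by case: un. Qed.
Let gnn : g n0 n0 = 1. Proof. by case: un. Qed.
Let Om0 : Om u0. Proof. by case: Ou0. Qed.

Let ww : w ^t* *m w = 1%:M.
Proof. exact: normal_vector_unit cpP tn gnn zz PE. Qed.

Let Re_comb (a b e : C) (t x x' : R) : complex.Re a = x -> complex.Re b = 0 ->
  complex.Re e = x' -> x = t * x' -> complex.Re (a - b - t%:C * (e - b)) = 0.
Proof. by case: a b e => [a1 a2] [b1 b2] [e1 e2] /= -> -> -> ->; ring. Qed.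

Definition leaf_offset Q (y : 'cV[C]_m.+1) (t : R) : R :=
  complex.Re ((w ^t* *m (affine_vector P0 z0 Q - z0 - t%:C *: y)) 0 0).

(** The remainder [r] is orthogonal to [z0], and by the relation between the projections its tangent
    vector is orthogonal to the frame at [u0]; it is therefore a real multiple of the normal. *)
Lemma affine_vector_offset Q Q' (t : R) :
  CP Q -> 0 < affine_weight P0 Q -> CP Q' -> 0 < affine_weight P0 Q' ->
  proj Q = t *: proj Q' ->
  let y := affine_vector P0 z0 Q' - z0 in
  affine_vector P0 z0 Q = z0 + t%:C *: y + (leaf_offset Q y t)%:C *: w.
Proof.
move=> cpQ a0 cpQ' a0' pE y; rewrite /leaf_offset.
set r := affine_vector P0 z0 Q - z0 - t%:C *: y.
have zr : z0 ^t* *m r = 0.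
  rewrite /r /y !mulmxBr -(scalemxAr t%:C) mulmxBr zz (affine_vector_normalized cpP PE cpQ a0).
  by rewrite (affine_vector_normalized cpP PE cpQ' a0') !subrr scaler0 subr0.
have [tR Rz] := vector_tangentP zz PE zr.
have gR j : g (vector_tangent z0 r) (X_ j) = 0.
  have tX := chart_tangentCP hM (e_ j) ch Om0.
  rewrite gC (g_vectorE PE tX tR) Rz.
  have -> : ((X_ j *m z0) ^t* *m r) 0 0 =
    ((X_ j *m z0) ^t* *m affine_vector P0 z0 Q) 0 0 - ((X_ j *m z0) ^t* *m affine_vector P0 z0 P0) 0 0 -
    t%:C * (((X_ j *m z0) ^t* *m affine_vector P0 z0 Q') 0 0 - ((X_ j *m z0) ^t* *m affine_vector P0 z0 P0) 0 0).
    rewrite (affine_vector_base cpP zz PE) /r /y !mulmxBr -(scalemxAr t%:C) mulmxBr.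
    by rewrite !(addmxE, oppmxE, scalemxE).
  have b0 : g P0 (X_ j) / affine_weight P0 P0 = 0 by rewrite (g_base_tangent cpP tX) mul0r.
  have pj : g Q (X_ j) / affine_weight P0 Q = t * (g Q' (X_ j) / affine_weight P0 Q').
    by move/rowP/(_ j): pE; rewrite !mxE.
  exact (Re_comb (g_affine cpP PE tX cpQ) (etrans (g_affine cpP PE tX cpP) b0)
    (g_affine cpP PE tX cpQ') pj).
have RE := normal_multiple m0 hM un tR (chart_frame_normal ch Om0 gR).
have rE : r = (g n0 (vector_tangent z0 r))%:C *: w.
  by rewrite -{1}Rz {1}RE -scalemxAl.
have -> : complex.Re ((w ^t* *m r) 0 0) = g n0 (vector_tangent z0 r).
  by rewrite {1}rE -scalemxAr ww mxE Re_realCM mxE /= mulr1.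
by rewrite -rE /r -(addrA (affine_vector _ _ _)) -opprD [RHS]addrC subrK.
Qed.

Definition affine_part : set V := O `&` [set u | 0 < a_ u].
(** The added condition, in which the real part equals 1 at [u0], permits the division in
    [leaf_speed]. *)
Definition leaf_part : set V := affine_part `&` [set u | 0 < complex.Re (ga u)].

Lemma affine_part_open : open affine_part.
Proof.
apply: open_positive => //; apply: of_class_CM => //; first exact: of_class_C_cst.
by apply: of_class_C_g => //; exact: mxsmooth_cst.
Qed.

Lemma affine_weight_csmooth : csmooth affine_part (fun u => (a_ u)%:C).
Proof.
apply: csmooth_real; first exact: affine_part_open.
move=> k; apply: (@of_class_C_sub _ _ k O); first by move=> u [].
apply: of_class_CM => //; first exact: of_class_C_cst.
by apply: of_class_C_g => //; exact: mxsmooth_cst.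
Qed.

Lemma affine_vector_smooth : mxsmooth affine_part (fun u => ze u).
Proof.
have oD := affine_part_open; apply: mxsmoothZ => //.
  apply: csmooth_real => // k; apply: of_class_CV => //.
    by move=> u [_ h]; rewrite gt_eqF.
  by have [] := affine_weight_csmooth k.
apply: mxsmoothM => //; last exact: mxsmooth_cst.
by apply: mxsmooth_sub sF => u [].
Qed.

Lemma normal_vector_smooth : mxsmooth affine_part (fun u => nu u).
Proof.
apply: mxsmoothM; [exact: affine_part_open| |exact: affine_vector_smooth].
by apply: mxsmooth_sub sN => u [].
Qed.

Lemma normal_product_csmooth : csmooth affine_part (fun u => ga u).
Proof.
have oD := affine_part_open.
apply: (mxsmoothM oD (mxsmooth_adj oD normal_vector_smooth) (mxsmooth_cst _ _)).
Qed.

Lemma leaf_part_open : open leaf_part.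
Proof.
apply: open_positive; first exact: affine_part_open.
by have [] := normal_product_csmooth 0.
Qed.

Lemma leaf_part0 : leaf_part u0.
Proof.
split; first by split=> //=; rewrite (affine_weight_base cpP).
by rewrite /= (affine_vector_base cpP zz PE) ww mxE.
Qed.

(** The coefficient in [g_product_bound]; by smoothness it is bounded along the path over [[0, 1]],
    which yields the constant for Gronwall's inequality. *)
Definition leaf_rate (y : 'cV[C]_m.+1) u : R :=
  let K := herm_part (leaf_kernel y (a_ u) (nu u) (ga u)) in
  let B := herm_part (line_field_reeb iota N c u) in
  g K K + g B B.

Lemma leaf_rate_smooth y k : of_class_C k leaf_part (leaf_rate y).
Proof.
have oD := leaf_part_open; have sub : leaf_part `<=` affine_part by move=> u [].
have sga : csmooth leaf_part (fun u => ga u) := csmooth_sub sub normal_product_csmooth.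
have sH (G : V -> E) : mxsmooth leaf_part G -> mxsmooth leaf_part (fun u => herm_part (G u)).
  move=> sG; apply: mxsmoothZ => //; first exact: csmooth_cst.
  by apply: mxsmoothD => //; exact: mxsmooth_adj.
have sK : mxsmooth leaf_part (fun u => leaf_kernel y (a_ u) (nu u) (ga u)).
  apply: mxsmoothZ => //.
    apply: csmoothM => //.
      apply: (@csmooth_eq _ _ _ (fun u => (-2)%:C * (a_ u)%:C)) => //.
        by move=> u _; rewrite -rmorphM -rmorphN mulNr.
      by apply: csmoothM => //; [exact: csmooth_cst|exact: csmooth_sub sub affine_weight_csmooth].
    apply: csmoothD => //; first exact: csmooth_cst.
    apply: csmooth_real => // l; apply: of_class_CM => //; first by have [] := sga l.
    apply: of_class_CV => //; first by move=> u [_ h]; rewrite gt_eqF.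
    by have [] := sga l.
  apply: mxsmoothM => //; first exact: mxsmooth_cst.
  by apply: mxsmooth_adj => //; exact: mxsmooth_sub sub normal_vector_smooth.
have sB : mxsmooth leaf_part (line_field_reeb iota N c).
  have subO : leaf_part `<=` O by move=> u [[]].
  exact: (mxsmooth_sub subO (line_field_reeb_smooth hM hN ch)).
have h1 := of_class_C_g oD (sH _ sK) (sH _ sK) k; have h2 := of_class_C_g oD (sH _ sB) (sH _ sB) k.
exact: (of_class_CD oD h1 h2).
Qed.

Section Path.
Variables (Q1 : E) (ut : R -> V).
Hypotheses (cpQ1 : CP Q1) (a1 : 0 < affine_weight P0 Q1) (Q1W0 : Q1 *m W0 = 0).
Hypothesis ut0 : ut 0 = u0.
Hypothesis utP : forall t : R, `|t| < 2 ->
  [/\ leaf_part (ut t), proj (F (ut t)) = t *: proj Q1 & exists v, is_derive t 1 ut v].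

Let y := affine_vector P0 z0 Q1 - z0.
Let f t := leaf_offset (F (ut t)) y t.

Let W0y : W0 *m y = 0.
Proof.
have hW : W0 ^t* = W0 := normal_line_adj cpP tn.
have W0Q : W0 *m Q1 = 0.
  have [hQ _ _] := cpQ1.
  by rewrite -hW -hQ -adjmxM Q1W0; apply/matrixP => i j; rewrite !mxE conjC0.
rewrite /y mulmxBr -(affine_vector_fix P0 z0 cpQ1) mulmxA W0Q mul0mx.
by rewrite -(P_unit_vector zz PE) mulmxA (normal_lineP cpP tn) mul0mx subr0.
Qed.

Let near2 (t : R) : `|t| < 2 -> \forall s \near t, `|s| < 2.
Proof.
move=> t2; apply/nbhs_ballP; exists (2 - `|t|); first by rewrite /= subr_gt0.
move=> s; rewrite -ball_normE /= => h.
have : `|s| <= `|t| + `|t - s| by rewrite -{1}(subKr t s); exact: ler_normB.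
lra.
Qed.

Let zeE t : `|t| < 2 -> ze (ut t) = z0 + t%:C *: y + (f t)%:C *: w.
Proof.
move=> /utP[[[_ a0] _] pE _].
exact: (affine_vector_offset (hypersurface_CP hM _) a0 cpQ1 a1 pE).
Qed.

(** The affine vector is differentiated in two ways: as a quotient, which shows that [f] is
    differentiable, and through [zeE], which gives the form of its velocity. The last equation is
    the derivative of [affine_vector_fix]. *)
Lemma leaf_path_derivative (t : R) : `|t| < 2 -> exists v xi' f',
  [/\ is_derive t 1 ut v, is_derive t 1 f f', xi' = y + f'%:C *: w &
      mxderive v F (ut t) *m ze (ut t) + iota (c (ut t)) *m xi' = xi'].
Proof.
move=> t2; have [[[Out a0] _] _ [v dv]] := utP t2.
have dQ := mxder_comp_curve oO sF Out dv.
have dg := is_derive_g dQ (mxder_cst P0 (t : R^o) 1).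
have da := is_derive_mulf (is_derive_cst (2 : R) (t : R^o) 1) dg.
have dV : derivable (fun s : R => (a_ (ut s))^-1) (t : R^o) 1.
  by apply: derivableV; [rewrite gt_eqF|case: da].
have dc : cder (fun s : R => ((a_ (ut s))^-1)%:C) (t : R^o) 1
    (('D_1 (fun s : R => (a_ (ut s))^-1) (t : R^o))%:C).
  by split=> /=; [exact: derivableP|exact: is_derive_cst].
have dze := mxderZ dc (mxderMr z0 dQ).
set xi' := (X in mxder _ _ _ X) in dze.
have df := mxderMl (w ^t*) (mxderB (mxderB dze (mxder_cst z0 (t : R^o) 1))
   (mxderZ (cder_real_id t) (mxder_cst y (t : R^o) 1))).
have [df1 _] := df 0 0.
set f' := complex.Re _ in df1.
exists v, xi', f'; split; [exact: dv|exact: df1| |].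
- apply: (mxder_unique dze); apply: (mxder_near _ (mxder_affine_curve z0 y w df1)).
  by have := near2 t2; apply: filterS => s /zeE /esym.
- apply/esym; apply: (mxder_unique dze).
  apply: (mxder_ext _ _ (mxderM dQ dze)) => [s|]; last by [].
  exact: (affine_vector_fix P0 z0 (hypersurface_CP hM (c (ut s)))).
Qed.

Let H t : E := line_field iota N c (ut t) - W0.

Let hH t : `|t| < 2 -> (H t) ^t* = H t.
Proof.
move=> /utP[[[Out _] _] _ _]; have [tnt _ _] := chart_unit_normal hN Out.
have hW : W0 ^t* = W0 := normal_line_adj cpP tn.
rewrite /H adjmxB hW; congr (_ - _).
exact (normal_line_adj (hypersurface_CP hM _) tnt).
Qed.

Lemma leaf_path_gronwall (t : R) : `|t| < 2 -> exists dS f',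
  [/\ is_derive t 1 (fun s => 2 * g (H s) (H s)) dS,
      dS <= leaf_rate y (ut t) * (2 * g (H t) (H t)),
      is_derive t 1 f f' & H t = 0 -> f' = 0].
Proof.
move=> t2; have [v [xi' [f' [dv df xi'E dxi]]]] := leaf_path_derivative t2.
have [[[Out a0] ga0] _ _] := utP t2.
have cpQ := hypersurface_CP hM (c (ut t)).
have [tQ gQ _] := chart_unit_normal hN Out.
have [tX nX] := frame_tangent m1 hM hN ch Out v.
have QE := affine_vectorE cpP PE cpQ a0.
have Qxi := affine_vector_fix P0 z0 cpQ.
have reeb := leaf_reeb cpQ tQ gQ tX nX QE Qxi dxi xi'E W0y a0 ga0.
have stop := leaf_speed0 cpQ tQ gQ tX nX QE Qxi dxi xi'E W0y a0 ga0.
have dW := mxder_comp_curve oO (line_field_smooth hN ch) Out dv.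
have dH := mxderB dW (mxder_cst W0 (t : R^o) 1).
have dS := is_derive_mulf (is_derive_cst (2 : R) (t : R^o) 1) (is_derive_g dH dH).
exists (- (4 * (g (H t) (leaf_kernel y (a_ (ut t)) (nu (ut t)) (ga (ut t))) *
   g (H t) (line_field_reeb iota N c (ut t))))), f'; split.
(* The line changes only through the Reeb component of the velocity, which [leaf_reeb] expresses by
   [H t] itself: this makes the derivative quadratic in [H t]. *)
- apply: (is_derive_ext (fun=> erefl _) _ dS).
  rewrite subr0 (line_field_derive m1 hM hN ch v Out (rul Out)) gZl gZr /reeb_form.
  rewrite -/(H t) (gC _ (H t)) reeb.
  by rewrite -/(line_field iota N c (ut t)) -/(H t); rewrite mul0r add0r /cst; ring.
- exact: (g_product_bound _ _ (hH t2)).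
- exact: df.
- by move=> /eqP; rewrite subr_eq0 => /eqP /stop.
Qed.

Lemma leaf_path_end : F (ut 1) = Q1 /\ line_field iota N c (ut 1) = W0.
Proof.
have lt2 (t : R) : t \in `[0, 1] -> `|t| < 2.
  by rewrite in_itv /= => /andP[h0 h1]; rewrite ger0_norm//; lra.
have l1 : `|1 : R| < 2 by rewrite normr1; lra.
have i1 : (1 : R) \in `[0, 1] by rewrite in_itv /= ler01 lexx.
have [b Hb] : exists b, forall t : R, t \in `[0, 1] -> leaf_rate y (ut t) <= b.
  have [|s _ Hs] := @EVT_max R (fun t => leaf_rate y (ut t)) 0 1 ler01.
    apply: derivable_within_continuous => t /lt2 /utP[Lt _ [v dv]].
    by have [] := is_derive_comp_curve leaf_part_open Lt (leaf_rate_smooth y 1) dv.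
  by exists (leaf_rate y (ut s)).
have gr (t : R) : exists k : R * R, `|t| < 2 ->
    [/\ is_derive t 1 (fun s => 2 * g (H s) (H s)) k.1,
      k.1 <= leaf_rate y (ut t) * (2 * g (H t) (H t)),
      is_derive t 1 f k.2 & H t = 0 -> k.2 = 0].
  have [t2|t2] := ltP `|t| 2; last by exists (0, 0).
  by have [dS [f' h]] := leaf_path_gronwall t2; exists (dS, f').
have /choice[k Hk] := gr.
have S0 t : t \in `[0, 1] -> 0 <= 2 * g (H t) (H t).
  by move=> /lt2 /hH /g_ge0 h; rewrite mulr_ge0.
have H00 : H 0 = 0 by rewrite /H ut0 subrr.
have HS : forall t, t \in `[0, 1] -> 2 * g (H t) (H t) = 0.
  apply: (@gronwall_zero R _ (fun t => (k t).1) b) => //.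
  - by move=> t /lt2 /Hk[].
  - move=> t it; have [_ h _ _] := Hk t (lt2 t it).
    by apply: le_trans h _; apply: ler_wpM2r; [exact: S0|exact: Hb].
  - by rewrite H00 g0l mulr0.
have H0 t : t \in `[0, 1] -> H t = 0.
  move=> it; apply: g_eq0; first exact: (hH (lt2 t it)).
  by have /eqP := HS t it; rewrite mulf_eq0 pnatr_eq0 => /eqP.
have f0 : f 0 = 0.
  rewrite /f ut0 /leaf_offset (affine_vector_base cpP zz PE) scale0r subr0 subrr.
  by rewrite mulmx0 mxE.
(* [f] has zero derivative on the path; Gronwall with constant 0 for the nonnegative function
   [f * f] turns this into [f = 0]. *)
have ff : forall t, t \in `[0, 1] -> f t * f t = 0.
  apply: (@gronwall_zero R _ (fun=> 0) 0) => //.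
  - move=> t it; have [_ _ df h] := Hk t (lt2 t it).
    rewrite (h (H0 t it)) in df.
    by have := is_derive_mulf df df; apply: is_derive_ext; rewrite ?mulr0 ?mul0r ?addr0.
  - by move=> t _; rewrite -expr2 sqr_ge0.
  - by move=> t _; rewrite mul0r.
  - by rewrite f0 mulr0.
have f1 : f 1 = 0 by have /eqP := ff 1 i1; rewrite mulf_eq0 orbb => /eqP.
split; last by apply/eqP; rewrite -subr_eq0; apply/eqP; exact: (H0 1 i1).
have [[[_ a0] _] _ _] := utP l1.
apply: (affine_vector_inj cpP PE (hypersurface_CP hM _) cpQ1 a0 a1).
by rewrite (zeE l1) f1 scale0r addr0 scale1r /y addrC subrK.
Qed.

End Path.

End LeafPath.

Section LeafLocal.
Context {R : realType} {m : nat} {M : topologicalType}.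
Local Notation C := (R[i]).
Local Notation E := ('M[C]_m.+1).
Local Notation d := (m.*2.-1).
Local Notation V := ('rV[R]_d).
Local Notation e_ j := (delta_mx 0 j : V).
Variable iota : M -> E.
Hypothesis m1 : (1 < m)%N.
Hypothesis hM : real_hypersurface iota.

Let sqr_small (a k : R) : 0 <= k -> a ^+ 2 <= k ^+ 2 -> `|a| <= k.
Proof. by move=> k0 h; rewrite -ler_sqr ?nnegrE// real_normK ?num_real. Qed.

Lemma affine_weight_near (P0 P : E) : CP P0 -> CP P -> g (P - P0) (P - P0) <= 1 / 8 ->
  1 / 2 <= affine_weight P0 P.
Proof.
move=> cp0 cpP small; have [h0 _ _] := cp0; have [h _ _] := cpP.
have hD : (P - P0) ^t* = P - P0 by rewrite adjmxB h h0.
have w0 : 2 * g P0 P0 = 1 := affine_weight_base cp0.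
have g00 : g P0 P0 = 1 / 2 by lra.
have := g_CauchySchwarz hD h0; rewrite g00 => cs.
(* The square is at most [1 / 8 * (1 / 2) = (1 / 4)^2], so the weight is at least
   [2 * (1 / 2 - 1 / 4)]. *)
have : `|g (P - P0) P0| <= 1 / 4.
  by apply: sqr_small; [lra|apply: (le_trans cs); rewrite expr2; lra].
by rewrite gBl g00 /affine_weight ler_norml => /andP[h1 _]; lra.
Qed.

Section Chart.
Variables (U : set M) (N : M -> E).
Hypothesis hN : unit_normal_field iota U N.
Variables (Om : set V) (c : V -> M).
Hypothesis ch : chart iota Om c.
Local Notation O := (normal_chart_domain U Om c).
Hypothesis rul : forall u, O u -> ruled_at iota N c u.
Variables (u0 : V).
Hypothesis Ou0 : O u0.
Local Notation F := (iota \o c).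
Local Notation P0 := (iota (c u0)).
Local Notation W0 := (normal_line P0 (N (c u0))).
Local Notation X_ j := (mxderive (e_ j) F u0).
Local Notation proj := (affine_projection iota c u0).

Let cpP : CP P0. Proof. exact: (hypersurface_CP hM _). Qed.
Let Om0 : Om u0. Proof. by case: Ou0. Qed.

Lemma affine_projection_near (rho : R) : 0 < rho -> exists2 e : R, 0 < e &
  forall P, CP P -> g (P - P0) (P - P0) < e -> 0 < affine_weight P0 P /\ `|proj P| <= rho.
Proof.
move=> rho0; pose S := \sum_j g (X_ j) (X_ j).
have tX j := chart_tangentCP hM (e_ j) ch Om0.
have hX j : (X_ j) ^t* = X_ j := tangent_hermitian (tX j).
have XS j : g (X_ j) (X_ j) <= S.
  by rewrite /S (bigD1 j)//= lerDl; apply: sumr_ge0 => i _; exact: g_ge0.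
have S0 : 0 <= S by apply: sumr_ge0 => i _; exact: g_ge0.
have S1 : 0 < 1 + S by rewrite ltr_pwDl.
(* The first bound makes the weight at least 1/2, so [rho / 2] suffices for the numerators; [1 + S]
   dominates every squared norm of a frame vector. *)
exists (Num.min (1 / 8) ((rho / 2) ^+ 2 / (1 + S))).
  by rewrite lt_min !divr_gt0// exprn_gt0// divr_gt0.
move=> P cp; rewrite lt_min => /andP[/ltW small1 /ltW small2].
have aP := affine_weight_near cpP cp small1.
have a0 : 0 < affine_weight P0 P by apply: lt_le_trans aP; lra.
split=> //; apply: row_norm_le => [|j]; first exact: ltW.
rewrite mxE normrM normfV (gtr0_norm a0) ler_pdivrMr//.
have [h _ _] := cp; have [h0 _ _] := cpP.
have hD : (P - P0) ^t* = P - P0 by rewrite adjmxB h h0.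
have -> : g P (X_ j) = g (P - P0) (X_ j) by rewrite gBl (g_base_tangent cpP (tX j)) subr0.
apply: (@le_trans _ _ (rho / 2)); last first.
  by rewrite ler_pM2l//; rewrite -[X in X <= _]mul1r.
apply: sqr_small; first by rewrite divr_ge0// ltW.
apply: (le_trans (g_CauchySchwarz hD (hX j))).
have ge0 := g_ge0 hD; have X0 := g_ge0 (hX j).
apply: (@le_trans _ _ ((rho / 2) ^+ 2 / (1 + S) * (1 + S))).
  apply: ler_pM => //; apply: (le_trans (XS j)); lra.
by rewrite divfK// gt_eqF.
Qed.

Lemma leaf_local (O0 : set M) : open O0 -> O0 (c u0) -> exists2 e : R, 0 < e &
  forall P, CP P -> P *m W0 = 0 -> g (P - P0) (P - P0) < e ->
  exists u, [/\ O u, O0 (c u), iota (c u) = P & normal_line P (N (c u)) = W0].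
Proof.
move=> oO0 O0u; have [z0 zz PE] := CP_vector cpP.
pose D1 := leaf_part iota U N Om c u0 z0 `&` (Om `&` c @^-1` O0).
have oD1 : open D1.
  apply: openI; first exact: (leaf_part_open hN ch).
  exact: (chart_preimage_open ch oO0).
have subA : D1 `<=` affine_domain iota Om c u0 by move=> u [[[[h _] h'] _] _].
pose f u := proj (F u).
have sf k j : of_class_C k D1 (fun u => f u 0 j).
  exact: (of_class_C_sub subA (affine_projection_smooth u0 ch k j)).
(* Positivity of the squared determinant states invertibility of the Jacobian in a form to which
   [open_positive] applies. *)
pose D2 := D1 `&` [set u | 0 < \det (jacobian_mx f u) * \det (jacobian_mx f u)].
have oD2 : open D2.
  apply: open_positive => //; apply: of_class_CM => //; apply: of_class_C_det => // i j.
    by have [_ h] := sf 1%N j (e_ i); apply: (@of_class_C_eq _ _ 0 D1 _ _ oD1 _ h) => u _; rewrite [RHS]mxE.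
  by have [_ h] := sf 1%N j (e_ i); apply: (@of_class_C_eq _ _ 0 D1 _ _ oD1 _ h) => u _; rewrite [RHS]mxE.
have D1u0 : D1 u0.
  split; last by split.
  exact: (leaf_part0 hM hN Ou0 zz PE).
have D2u0 : D2 u0.
  split=> //=; rewrite (affine_jacobian0 hM ch Om0) -expr2 exprn_even_gt0//=.
  have := chart_gram_unit hM ch Om0; rewrite unitmxE unitfE.
  by [].
have f0 : f u0 = 0 by exact: (affine_projection0 hM ch Om0).
have sub2 : D2 `<=` D1 by move=> u [].
have uJ u : D2 u -> jacobian_mx f u \in unitmx.
  by move=> [_ /=]; rewrite -expr2 exprn_even_gt0//= unitmxE unitfE.
have [rho rho0 Hrho] := inverse_path oD2 D2u0 (fun j => of_class_C_sub sub2 (sf 1%N j)) f0 uJ.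
have [e e0 He] := affine_projection_near rho0.
exists e => // P cp PW Pe; have [a0 nP] := He P cp Pe.
have [ut [ut0 Hut]] := Hrho _ nP.
have utP (t : R) : `|t| < 2 -> [/\ leaf_part iota U N Om c u0 z0 (ut t),
    proj (F (ut t)) = t *: proj P & exists v, is_derive t 1 ut v].
  by move=> /Hut[[[h _] _] h2 h3].
have [FE WE] := leaf_path_end m1 hM hN ch rul Ou0 zz PE cp a0 PW ut0 utP.
have l1 : `|1 : R| < 2 by rewrite normr1; lra.
have [[[[[h _] _] [_ h']] _] _ _] := Hut 1 l1.
exists (ut 1); split=> //.
by rewrite -FE.
Qed.

End Chart.

Lemma normal_line_opp (P n : E) : normal_line P (- n) = normal_line P n.
Proof. by rewrite /normal_line mulmxN !mulNmx opprK. Qed.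

Lemma normal_line_unique p n n' : unit_normal iota p n -> unit_normal iota p n' ->
  normal_line (iota p) n' = normal_line (iota p) n.
Proof.
by move=> un /(unit_normal_pm (ltnW m1) hM un)[->|->] //; rewrite normal_line_opp.
Qed.

Hypothesis rul : forall U N, unit_normal_field iota U N -> forall Om c, chart iota Om c ->
  forall u, normal_chart_domain U Om c u -> ruled_at iota N c u.

Lemma leaf_open p n (O0 : set M) : unit_normal iota p n -> open O0 -> O0 p ->
  exists2 e : R, 0 < e & forall P, CP P -> P *m normal_line (iota p) n = 0 ->
    g (P - iota p) (P - iota p) < e -> exists q, [/\ O0 q, iota q = P &
      forall n', unit_normal iota q n' ->
        normal_line (iota q) n' = normal_line (iota p) n].
Proof.
move=> un oO0 O0p.
have [U [N [hN Up]]] := unit_normal_field_exists (ltnW m1) hM p.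
have [Om [c [u0 [ch Om0 cu0]]]] := hypersurface_chart hM p.
have Ou0 : normal_chart_domain U Om c u0 by split=> //=; rewrite cu0.
have O0u : O0 (c u0) by rewrite cu0.
have [e e0 He] := leaf_local hN ch (rul hN ch) Ou0 oO0 O0u.
have nE : normal_line (iota p) n = normal_line (iota p) (N p).
  by apply: normal_line_unique => //; case: hN => _ _; apply.
exists e => // P cp; rewrite nE -cu0 => PW Pe.
have [u [Ou Oc PE WE]] := He P cp PW Pe.
exists (c u); split=> // n' un'.
by rewrite (normal_line_unique (chart_unit_normal hN Ou) un') PE.
Qed.

Theorem ruled_of_ruled_at : ruled iota.
Proof.
have m0 : (0 < m)%N := ltnW m1.
move=> p; have [n un] := unit_normal_exists m0 hM p; have [tn gn nX] := un.
have cpP := hypersurface_CP hM p.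
have [z zz PE] := CP_vector cpP.
pose w := n *m z; pose W := normal_line (iota p) n.
have WE : W = w *m w ^t*.
  by rewrite /W /normal_line PE /w adjmxM (tangent_hermitian tn) !mulmxA.
have ww : w ^t* *m w = 1%:M.
  exact: (normal_vector_unit cpP tn gn zz PE).
have wW p' (A : 'M[C]_(p', m.+1)) : A *m w = 0 <-> A *m W = 0.
  rewrite WE; split=> h; first by rewrite mulmxA h mul0mx.
  by rewrite -[LHS]mulmx1 -ww mulmxA -(mulmxA A w (w ^t*)) h mul0mx.
(* [w] spans the line of [W]. The leaf quantifies over both unit normals at [q], which have the same
   line, so no global normal field is chosen. *)
exists w, [set q | forall n', unit_normal iota q n' -> normal_line (iota q) n' = W]; split.
- by apply: contra_eq_neq ww => ->; rewrite mulmx0 eq_sym oner_neq0.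
- by move=> n' un'; exact: normal_line_unique.
- move=> q O Lq oO Oq; have [nq uq] := unit_normal_exists m0 hM q.
  have [e e0 He] := leaf_open uq oO Oq.
  exists e => // P [cp /wW PW] Pe.
  have [|q' [Oq' PE' Wq']] := He P cp _ Pe; first by rewrite (Lq _ uq).
  by exists q' => //; split=> // n' un'; rewrite (Wq' _ un') (Lq _ uq).
- move=> q Lq; have [nq uq] := unit_normal_exists m0 hM q; have [tq gq _] := uq.
  have cq := hypersurface_CP hM q; have Wq := Lq _ uq.
  split; first by split=> //; apply/wW; rewrite -Wq; exact: (P_normal_line cq tq).
  apply/seteqP; split=> X.
    move=> /(DDP m0 hM X uq) dX; have tX : tangentCP (iota q) X by case: dX.
    split=> //; apply/wW; rewrite -Wq.
    exact/(holomorphic_XW cq tq gq tX).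
  move=> [tX /wW XW]; apply/(DDP m0 hM X uq)/(holomorphic_XW cq tq gq tX).
  by rewrite -/(normal_line _ _) Wq.
Qed.

End LeafLocal.

(** * The second fundamental form of a ruled hypersurface *)

Lemma is_derive_near {R : realType} (f : R -> R) (t a e : R) :
  is_derive t 1 f a -> 0 < e -> \forall s \near t, `|f t - f s| < e.
Proof.
move=> [/derivable1_diffP /differentiable_continuous cf _] e0.
by have /cvgrPdist_lt/(_ e e0) := cf.
Qed.

Section ProjectiveCurve.
Context {R : realType} {m : nat}.
Local Notation C := (R[i]).
Local Notation E := ('M[C]_m.+1).
Variables (z x : 'cV[C]_m.+1).
Hypotheses (zz : z ^t* *m z = 1%:M) (zx : z ^t* *m x = 0).

Let s : R := complex.Re ((x ^t* *m x) 0 0).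
Let k (t : R) : R := 1 + s * (t * t).

(** The line of [z + t x], whose squared norm is [k t]: a curve in the CP^(m-1) orthogonal to [w]
    whenever [z] and [x] are, with the tangent vector of [x] as initial velocity. *)
Definition projective_curve (t : R) : E :=
  ((k t)^-1)%:C *: ((z + t%:C *: x) *m (z + t%:C *: x) ^t*).

Let s0 : 0 <= s.
Proof. by have := frobenius_ge0 (x ^t*); rewrite adjmxK trace_mx11. Qed.

Let k0 t : 0 < k t.
Proof. by rewrite ltr_pwDl// mulr_ge0// -expr2 sqr_ge0. Qed.

Let xx : x ^t* *m x = (s%:C)%:M.
Proof.
rewrite [LHS]mx11_scalar; congr (_%:M); rewrite /s.
have e : (x ^t* *m x) ^t* = x ^t* *m x by rewrite adjmxM adjmxK.
have : (((x ^t* *m x) 0 0)^*)%R = (x ^t* *m x) 0 0.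
  by rewrite -[RHS](congr1 (fun A : 'M[C]_1 => A 0 0) e) [RHS]mxE [in RHS]mxE.
case: (_ 0 0) => a b [] /= h; apply/eqP; rewrite eq_complex /= eqxx /=; apply/eqP; lra.
Qed.

Let xz : x ^t* *m z = 0.
Proof.
have := congr1 (fun A : 'M[C]_1 => A ^t*) zx; rewrite adjmxM adjmxK => ->.
by apply/matrixP => i j; rewrite !mxE conjC0.
Qed.

Let norm t : (z + t%:C *: x) ^t* *m (z + t%:C *: x) = ((k t)%:C)%:M.
Proof.
rewrite adjmxD adjmxZ conj_realC mulmxDl !mulmxDr -!scalemxAl -!scalemxAr zz zx xz xx.
rewrite !scaler0 addr0 add0r !scale_scalar_mx -raddfD; congr (_%:M).
by rewrite -!rmorphM -rmorphD /k mulrA mulrC.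
Qed.

Lemma projective_curve_CP t : CP (projective_curve t).
Proof.
have kk : (k t)^-1 * k t = 1 by rewrite mulVf ?gt_eqF.
split.
- by rewrite /projective_curve adjmxZ conj_realC adjmxM adjmxK.
- rewrite /projective_curve -scalemxAl -scalemxAr !mulmxA -(mulmxA _ _ (z + _)) norm.
  rewrite mul_mx_scalar -scalemxAl !scalerA; congr (_ *: _).
  by rewrite -!rmorphM /= kk mulr1.
- by rewrite /projective_curve mxtraceZ mxtrace_mulC norm trace_mx11 mxE /= mulr1n -rmorphM kk.
Qed.

Lemma projective_curve0 : projective_curve 0 = z *m z ^t*.
Proof.
by rewrite /projective_curve /k mul0r mulr0 addr0 invr1 scale0r addr0 scale1r.
Qed.

Lemma mxder_projective_curve : mxder projective_curve (0 : R^o) 1 (x *m z ^t* + z *m x ^t*).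
Proof.
have dk : is_derive (0 : R) 1 k 0.
  have did := is_derive_id (0 : R) 1.
  have := is_derive_addf (is_derive_cst (1 : R) (0 : R) 1)
    (is_derive_mulf (is_derive_cst s (0 : R) 1) (is_derive_mulf did did)).
  by apply: is_derive_ext => //; rewrite /cst; ring.
have dV : is_derive (0 : R) 1 (fun t => (k t)^-1) 0.
  have := is_deriveV (lt0r_neq0 (k0 0)) dk.
  by apply: is_derive_ext => //; rewrite scaler0.
have dc : cder (fun t : R => ((k t)^-1)%:C) (0 : R^o) 1 0.
  by split=> /=; [exact: dV|exact: is_derive_cst].
have dl := mxderD (mxder_cst z (0 : R^o) 1) (mxderZ (cder_real_id 0) (mxder_cst x (0 : R^o) 1)).
have := mxderZ dc (mxderM dl (mxder_adj dl)).
apply: mxder_ext => //.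
have -> : k 0 = 1 by rewrite /k mul0r mulr0 addr0.
by rewrite scale0r add0r invr1 !scale1r scaler0 addr0 add0r scale0r addr0.
Qed.

Lemma projective_curve_kernel (w : 'cV[C]_m.+1) t : z ^t* *m w = 0 -> x ^t* *m w = 0 ->
  projective_curve t *m w = 0.
Proof.
move=> zw xw.
have e : (z + t%:C *: x) ^t* *m w = 0.
  by rewrite adjmxD adjmxZ mulmxDl -scalemxAl zw xw scaler0 addr0.
by rewrite /projective_curve -scalemxAl -mulmxA e mulmx0 scaler0.
Qed.

End ProjectiveCurve.

Section SubspaceNormal.
Context {R : realType} {m : nat}.
Local Notation C := (R[i]).
Local Notation E := ('M[C]_m.+1).
Variable w : 'cV[C]_m.+1.
Hypothesis w0 : w != 0.

Definition hyperplane_proj : E := 1%:M - (\tr (w *m w ^t*))^-1 *: (w *m w ^t*).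
Local Notation Q := hyperplane_proj.

Let tr0 : \tr (w *m w ^t*) != 0.
Proof.
apply: contra_neq w0 => h; apply: frobenius_eq0; by rewrite h.
Qed.

Lemma hyperplane_projw : Q *m w = 0.
Proof.
rewrite /Q mulmxBl mul1mx -scalemxAl -mulmxA [w ^t* *m w]mx11_scalar -trace_mx11 (mxtrace_mulC (w ^t*)).
by rewrite mul_mx_scalar scalerA mulVf// scale1r subrr.
Qed.

Lemma hyperplane_proj_adj : Q ^t* = Q.
Proof.
rewrite /Q adjmxB adjmx1 adjmxZ adjmxM adjmxK; congr (_ - _ *: _).
rewrite fmorphV; congr (_^-1).
by rewrite -[LHS](tr_adjmx (w *m w ^t*)) adjmxM adjmxK.
Qed.

Lemma mul_hyperplane_proj p (X : 'M[C]_(p, m.+1)) : X *m w = 0 -> X *m Q = X.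
Proof.
by move=> Xw; rewrite /Q mulmxBr mulmx1 -scalemxAr mulmxA Xw mul0mx scaler0 subr0.
Qed.

Lemma hyperplane_proj_mul (X : E) : X ^t* = X -> X *m w = 0 -> Q *m X = X.
Proof.
move=> hX /mul_hyperplane_proj/(congr1 (fun A : E => A ^t*)).
by rewrite adjmxM hyperplane_proj_adj hX.
Qed.

Lemma hyperplane_proj_idem : Q *m Q = Q.
Proof. exact: (mul_hyperplane_proj hyperplane_projw). Qed.

(** [Q n Q] is itself tangent to the CP^(m-1), hence orthogonal to [n]; but its product with [n] is
    its own squared norm. *)
Lemma compressed_normal_eq0 (P n : E) : CP P -> P *m w = 0 -> tangentCP P n ->
  (forall X, tangent_subCP w P X -> g n X = 0) -> Q *m n *m Q = 0.
Proof.
move=> [hP PP _] Pw tn nX; have hn := tangent_hermitian tn.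
have PQ := mul_hyperplane_proj Pw; have QP := hyperplane_proj_mul hP Pw.
have hZ : (Q *m n *m Q) ^t* = Q *m n *m Q.
  by rewrite !adjmxM hyperplane_proj_adj hn mulmxA.
have tZ : tangentCP P (Q *m n *m Q).
  split=> //; rewrite -[in RHS](tangent_split tn) mulmxDr mulmxDl !mulmxA PQ QP.
  by rewrite -(mulmxA _ Q P) QP -(mulmxA _ P Q) PQ.
have gZ : g n (Q *m n *m Q) = 0.
  by apply: nX; split=> //; rewrite -mulmxA hyperplane_projw mulmx0.
apply: (g_eq0 hZ); rewrite -[RHS]gZ /g; congr (complex.Re _ / _).
have QZ : Q *m (Q *m n *m Q) = Q *m n *m Q by rewrite !mulmxA hyperplane_proj_idem.
have ZQ : Q *m n *m Q *m Q = Q *m n *m Q by rewrite -mulmxA hyperplane_proj_idem.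
by rewrite -{1}(mulmxA (Q *m n)) QZ -(mulmxA Q n) mxtrace_mulC -(mulmxA n) ZQ.
Qed.

End SubspaceNormal.

Lemma immersion_injective {R : realType} {d n : nat} (Om : set 'rV[R]_d)
    (F : 'rV[R]_d -> 'M[R[i]]_n) u :
  open Om -> mxsmooth Om F -> Om u -> (forall v, mxderive v F u = 0 -> v = 0) ->
  exists2 r : R, 0 < r & forall u1 u2, ball u r u1 -> ball u r u2 -> F u1 = F u2 -> u1 = u2.
Proof.
move=> oOm sF Omu inj; have [G JG] := immersion_left_inverse oOm sF Omu inj.
have half : 0 < 1 / 2 :> R by lra.
have [r r0 Hr] := strict_left_inverse oOm Omu (fun j => realify_smooth 1 j oOm sF) JG half.
exists r => // u1 u2 b1 b2 e; have := Hr u1 u2 b1 b2.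
rewrite e subrr mul0mx sub0r normrN => h.
by apply/eqP; rewrite -subr_eq0 -normr_le0; have := normr_ge0 (u1 - u2); lra.
Qed.

Section RuledSecondForm.
Context {R : realType} {m : nat} {M : topologicalType}.
Local Notation C := (R[i]).
Local Notation E := ('M[C]_m.+1).
Local Notation d := (m.*2.-1).
Local Notation V := ('rV[R]_d).
Variable iota : M -> E.
Hypothesis m1 : (1 < m)%N.
Hypothesis hM : real_hypersurface iota.
Variables (U : set M) (N : M -> E).
Hypothesis hN : unit_normal_field iota U N.
Variables (Om : set V) (c : V -> M).
Hypothesis ch : chart iota Om c.
Hypothesis rul : ruled iota.
Local Notation O := (normal_chart_domain U Om c).
Local Notation F := (iota \o c).

Let m0 : (0 < m)%N. Proof. exact: ltnW. Qed.

Lemma ruled_ruled_at u : O u -> ruled_at iota N c u.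
Proof.
move=> Ou v v' v0 v'0; have Omu : Om u by case: Ou.
have un := chart_unit_normal hN Ou.
have [w [L [w0 Lu Lopen LD]]] := rul (c u).
have [[cpP Pw] Du] := LD _ Lu.
have hol_w x : reeb_form iota N c x u = 0 -> mxderive x F u *m w = 0.
  move=> /(frame_hol m1 hM hN ch Ou)/(DDP m0 hM _ un).
  by rewrite Du => -[].
have Xw := hol_w v v0; have Yw := hol_w v' v'0.
have [tX _] := frame_tangent m1 hM hN ch Ou v; have [tY _] := frame_tangent m1 hM hN ch Ou v'.
have hX := tangent_hermitian tX; have hY := tangent_hermitian tY.
have [z zz PE] := CP_vector cpP.
set X := mxderive v F u in Xw tX hX; set Y := mxderive v' F u in Yw tY hY.
pose x := X *m z.
have zx : z ^t* *m x = 0 by exact: tangent_vector_orth PE _ tX.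
have XE : X = x *m z ^t* + z *m x ^t* := tangent_vectorE PE tX.
have zw : z ^t* *m w = 0.
  by rewrite -(unit_vector_P zz PE) -mulmxA Pw mulmx0.
have xw : x ^t* *m w = 0 by rewrite /x adjmxM hX -mulmxA Xw mulmx0.
pose ga := projective_curve z x.
have dga : mxder ga (0 : R^o) 1 X by rewrite XE; exact: mxder_projective_curve.
have ga0 : ga 0 = iota (c u) by rewrite PE; exact: projective_curve0.
have oOm := chart_open ch; have sF := chart_smooth ch.
have [r0 r00 inj] := immersion_injective oOm sF Omu (fun v h => chart_immersion ch Omu h).
have dist0 (e : R) : 0 < e -> \forall t \near (0 : R), g (ga t - iota (c u)) (ga t - iota (c u)) < e.
  move=> e0; have dd := mxderB dga (mxder_cst (iota (c u)) (0 : R^o) 1).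
  have := is_derive_near (is_derive_g dd dd) e0.
  apply: filterS => t; rewrite ga0 subrr g0l sub0r normrN.
  exact: le_lt_trans (ler_norm _).
(* The leaf being open over the CP^(m-1), the curve lifts to it near [u] for small [t]. Injectivity
   of the immersion on the ball makes the lift unique, so the one function [ut] enters every smaller
   ball. *)
pose S (t : R) : set V := [set u' | [/\ ball u r0 u', Om u', L (c u') & F u' = ga t]].
pose ut (t : R) := xget u (S t).
have utE t u' : S t u' -> ut t = u'.
  move=> Su'; apply: xget_unique => // u'' [b1 _ _ e1]; case: Su' => b2 _ _ e2.
  by apply: inj => //; rewrite e1 e2.
have ut0 : ut 0 = u.
  by apply: utE; split=> //; exact: ballxx.
have near_ut (r : R) : 0 < r -> \forall t \near (0 : R), S t (ut t) /\ ball u r (ut t).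
  move=> r_0; pose B := Om `&` ((ball u r)° `&` (ball u r0)°).
  have oB : open B by apply: openI => //; apply: openI; exact: open_interior.
  have ocB : open (c @` B) by apply: (chart_openmap ch) => // t [].
  have [|e e0 He] := Lopen (c u) (c @` B) Lu ocB.
    by exists u => //; split=> //; split; exact: nbhsx_ballx.
  have := dist0 e e0; apply: filterS => t Ht.
  have [|q' [Lq [u' [Omu' [Bu1 Bu2]] cu']] qE] := He (ga t) _ Ht.
    split; first exact: projective_curve_CP.
    exact: projective_curve_kernel.
  have St : S t u'.
    split=> //; [exact: interior_subset Bu2|by rewrite cu'|by rewrite /= cu'].
  by rewrite (utE _ _ St); split=> //; exact: interior_subset Bu1.
have near_S : \forall t \near (0 : R), S t (ut t).
  by have := near_ut r0 r00; apply: filterS => t [].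
have dFut : mxder (fun t => F (ut t)) (0 : R^o) 1 X.
  apply: (mxder_near _ dga); have := near_S; apply: filterS => t [_ _ _ ->].
  by [].
have [||r r_0|v1 dut XE1] := immersion_lift oOm sF (c := ut) (t := 0) _ _ _ dFut.
- by rewrite ut0.
- by rewrite ut0 => v1; exact: (chart_immersion ch Omu).
- have := near_ut r r_0; apply: filterS => t [_].
  by rewrite ut0 addr0 [t *: (1 : R^o)]mulr1.
rewrite ut0 in XE1.
have vv : v1 = v.
  apply/eqP; rewrite -subr_eq0; apply/eqP; apply: (chart_immersion ch Omu).
  have := mxderive_dirBZ oOm sF Omu 1 v1 v; rewrite !scale1r => ->.
  by rewrite -XE1 subrr.
have Out0 : O (ut 0) by rewrite ut0.
have dN := mxder_comp_curve (normal_chart_domain_open hN ch) (normal_chart_smooth hN ch) Out0 dut.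
rewrite ut0 vv in dN.
have near_O : \forall t \near (0 : R), O (ut t).
  have /nbhs_ballP[e /= e0 He] := near_chart_domain hN ch Ou.
  by have := near_ut e e0; apply: filterS => t [_ /He].
pose Q := hyperplane_proj w.
have QNQ : \forall t \near (0 : R), 0 = Q *m (N (c (ut t))) *m Q.
  apply: filterS2 near_S near_O => t [_ _ Lt FE] Ot.
  have [[cpt Ptw] Dt] := LD _ Lt; have unt := chart_unit_normal hN Ot.
  have [tnt _ nt] := unt.
  apply/esym; apply: (compressed_normal_eq0 w0 cpt Ptw tnt) => X'.
  by rewrite -Dt => -[tX' _]; exact: nt.
have QdNQ : Q *m mxderive v (N \o c) u *m Q = 0.
  apply: (mxder_unique (mxderMr Q (mxderMl Q dN))).
  exact: (mxder_near QNQ (mxder_cst 0 (0 : R^o) 1)).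
rewrite /second_form -/Y.
(* [Y] is its own compression, and inside the trace the compression can be moved to the derivative
   of the normal. *)
have <- : Q *m Y *m Q = Y.
  by rewrite (hyperplane_proj_mul hY Yw) (mul_hyperplane_proj Yw).
apply/eqP; rewrite oppr_eq0; apply/eqP; rewrite /g.
by rewrite !mulmxA mxtrace_mulC !mulmxA QdNQ mul0mx mxtrace0 mul0r.
Qed.

End RuledSecondForm.

(** * Invariance under isometries *)

Section IsometryAction.
Context {R : realType} {m : nat}.
Local Notation C := (R[i]).
Local Notation E := ('M[C]_m.+1).
Implicit Types (P X Y : E).

Let conjM p q r (A : 'M[C]_(p, q)) (B : 'M[C]_(q, r)) :
  map_mx conjc (A *m B) = map_mx conjc A *m map_mx conjc B.
Proof. exact: map_mxM. Qed.

Let conj_adj p q (A : 'M[C]_(p, q)) : map_mx conjc (A ^t*) = (map_mx conjc A) ^t*.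
Proof. by apply/matrixP => i j; rewrite !mxE. Qed.

Variable f : E -> E.
Hypothesis isof : isometryCP f.

Lemma isometry_adj X : (f X) ^t* = f (X ^t*).
Proof.
have [u _ [fE|fE]] := isof; rewrite !fE 2!adjmxM adjmxK mulmxA; first exact: erefl.
by rewrite conj_adj.
Qed.

Lemma isometryD X Y : f (X + Y) = f X + f Y.
Proof.
have [u _ [fE|fE]] := isof; rewrite !fE; first by rewrite mulmxDr mulmxDl.
by rewrite (map_mxD conjc) mulmxDr mulmxDl.
Qed.

Lemma isometryM X Y : f (X *m Y) = f X *m f Y.
Proof.
have [u uU H] := isof; have uu : u ^t* *m u = 1%:M.
  by rewrite -[LHS]mul1mx mulmxA mulmxKtV.
case: H => fE; rewrite !fE ?conjM !mulmxA; congr (_ *m _).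
  by rewrite -!(mulmxA _ (u ^t*)) uu mulmx1.
by rewrite -!(mulmxA _ (u ^t*)) uu mulmx1.
Qed.

Lemma isometry_tr X : complex.Re (\tr (f X)) = complex.Re (\tr X).
Proof.
have [u uU H] := isof; have uu : u ^t* *m u = 1%:M.
  by rewrite -[LHS]mul1mx mulmxA mulmxKtV.
case: H => fE; rewrite !fE mxtrace_mulC mulmxA uu mul1mx //.
have -> : \tr (map_mx conjc X) = ((\tr X)^*)%R.
  by rewrite /mxtrace rmorph_sum; apply: eq_bigr => i _; rewrite mxE.
exact: Re_conj_complex.
Qed.

Lemma isometry_g X Y : g (f X) (f Y) = g X Y.
Proof. by rewrite /g -isometryM isometry_tr. Qed.

Lemma isometry_tangent P X : tangentCP P X -> tangentCP (f P) (f X).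
Proof.
by move=> [hX eX]; split; [rewrite isometry_adj hX|rewrite -!isometryM -isometryD eX].
Qed.

Lemma isometry_eq0 X : f X = 0 -> X = 0.
Proof.
have [u uU H] := isof; have uu : u ^t* *m u = 1%:M.
  by rewrite -[LHS]mul1mx mulmxA mulmxKtV.
have inj Y : u *m Y *m u ^t* = 0 -> Y = 0.
  move=> /(congr1 (fun A => u ^t* *m A *m u)).
  by rewrite !mulmxA uu mul1mx -mulmxA uu mulmx1 mulmx0 mul0mx.
case: H => fE; rewrite !fE => /inj // h; apply/matrixP => i j.
by have /eqP := congr1 (fun A : E => A i j) h; rewrite !mxE conjc_eq0 => /eqP.
Qed.

(** Complex conjugation changes the sign of the scalar [i] in [JCP], whence [e]. *)
Lemma isometryJ : exists2 e : R, e * e = 1 &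
  forall P X, JCP (f P) (f X) = e%:C *: f (JCP P X).
Proof.
have fB X Y : f (X - Y) = f X - f Y.
  apply/eqP; rewrite -subr_eq0; apply/eqP.
  by have := isometryD (X - Y) Y; rewrite subrK => ->; rewrite addrK subrr.
have [u uU [fE|fE]] := isof.
  exists 1 => [|P X]; first by rewrite mulr1.
  rewrite scale1r /JCP -!isometryM -fB !fE.
  by rewrite -scalemxAr -scalemxAl.
exists (-1) => [|P X]; first by rewrite mulrNN mulr1.
rewrite /JCP -!isometryM -fB !fE map_mxZ -scalemxAr -scalemxAl.
rewrite scalerA; congr (_ *: _).
by apply/eqP; rewrite eq_complex /=; apply/andP; split; apply/eqP; ring.
Qed.

Lemma isometry_mxder {V : normedModType R} (F : V -> E) u v Z :
  mxder F u v Z -> mxder (fun t => f (F t)) u v (f Z).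
Proof.
have [a _ [fE|fE]] := isof => dF.
  by apply: (mxder_ext _ _ (mxderMr (a ^t*) (mxderMl a dF))) => [t|]; rewrite fE.
by apply: (mxder_ext _ _ (mxderMr (a ^t*) (mxderMl a (mxder_map_conj dF)))) => [t|]; rewrite fE.
Qed.

Lemma isometry_mxsmooth {d : nat} Om (F : 'rV[R]_d -> E) : open Om ->
  mxsmooth Om F -> mxsmooth Om (fun t => f (F t)).
Proof.
move=> oOm sF; have [a _ [fE|fE]] := isof.
  apply: (@mxsmooth_eq _ _ _ _ _ (fun t => a *m F t *m a ^t*)) => //.
  by do !apply: mxsmoothM => //; exact: mxsmooth_cst.
apply: (@mxsmooth_eq _ _ _ _ _ (fun t => a *m map_mx conjc (F t) *m a ^t*)) => //.
by do !apply: mxsmoothM => //; [exact: mxsmooth_cst|exact: mxsmooth_map_conj|exact: mxsmooth_cst].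
Qed.

End IsometryAction.

Section Transport.
Context {R : realType} {m : nat} {M M' : topologicalType}.
Local Notation C := (R[i]).
Local Notation E := ('M[C]_m.+1).
Local Notation d := (m.*2.-1).
Local Notation V := ('rV[R]_d).
Variables (iota : M -> E) (iota' : M' -> E).
Hypothesis m1 : (1 < m)%N.
Hypotheses (hM : real_hypersurface iota) (hM' : real_hypersurface iota').
Hypothesis cong : locally_congruent iota iota'.
Hypothesis rul' : ruled iota'.
Variables (U : set M) (N : M -> E).
Hypothesis hN : unit_normal_field iota U N.
Variables (Om : set V) (c : V -> M).
Hypothesis ch : chart iota Om c.
Local Notation O := (normal_chart_domain U Om c).

Let m0 : (0 < m)%N. Proof. exact: ltnW. Qed.

Let sign_zero (e a : R) : e * e = 1 -> e * a = 0 -> a = 0.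
Proof. by move=> e1 h; rewrite -[a]mul1r -e1 -mulrA h mulr0. Qed.

(** [j \o c], restricted to the preimage of the neighbourhood, is a chart of the ruled hypersurface.
    Transport multiplies [reeb_form] and [second_form] by signs only, coming from the orientation of
    the normal and from conjugation; vanishing is unaffected. *)
Lemma congruent_ruled_at u : O u -> ruled_at iota N c u.
Proof.
move=> Ou; have Omu : Om u by case: Ou.
have [Uj [f [j [[oUj Uju] isof [jinj jcont] jopen fE]]]] := cong (c u).
pose Om1 := Om `&` c @^-1` Uj; pose F := iota \o c; pose F' := iota' \o (j \o c).
have oOm1 : open Om1 by exact: (chart_preimage_open ch oUj).
have Om1u : Om1 u by split.
have sub : Om1 `<=` Om by move=> t [].
have sF : mxsmooth Om1 F := mxsmooth_sub sub (chart_smooth ch).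
have F'E t : Om1 t -> F' t = f (F t) by move=> [_ /fE].
have nearF t : Om1 t -> \forall s \near t, f (F s) = F' s.
  move=> Ot; have : nbhs t Om1 by exact: open_nbhs_nbhs.
  by apply: filterS => s /F'E ->.
have dF' t v : Om1 t -> mxderive v F' t = f (mxderive v F t).
  move=> Ot; apply: mxder_mxderive; apply: (mxder_near (nearF t Ot)).
  exact: (isometry_mxder isof (mxsmooth_mxder v oOm1 sF Ot)).
have ch' : chart iota' Om1 (j \o c).
  split=> //.
  - by move=> s t [Os Us] [Ot Ut] /(jinj _ _ Us Ut); exact: (chart_inj ch).
  - move=> t [Ot Ut]; apply: continuous_comp; first exact: (chart_cont ch).
    exact: jcont.
  - move=> B oB sB; rewrite -image_comp; apply: jopen.
      by apply: (chart_openmap ch) => // t /sB[].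
    by move=> _ [t /sB[_ Ut] <-].
  split; last first.
    move=> t v Ot; rewrite -/F' (dF' t v Ot) => /(isometry_eq0 isof).
    exact: (chart_immersion ch (sub t Ot)).
  apply/smooth_onE; apply: (mxsmooth_eq oOm1 _ (isometry_mxsmooth isof oOm1 sF)).
  by move=> t Ot; exact: (esym (F'E t Ot)).
have [U' [N' [hN' U'j]]] := unit_normal_field_exists m0 hM' (j (c u)).
have O'u : normal_chart_domain U' Om1 (j \o c) u by split.
have un := chart_unit_normal hN Ou; have [tn gn nX] := un.
have un' := chart_unit_normal hN' O'u.
have unf : unit_normal iota' (j (c u)) (f (N (c u))).
  split.
  - by rewrite fE//; exact: isometry_tangent.
  - by rewrite isometry_g.
  - move=> X /(tangentP X ch' Om1u erefl)[v ->].
    rewrite -/F' dF'// isometry_g//; apply: nX.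
    by exists Om, c, u, v.
have [e e1 nE] : exists2 e : R, e * e = 1 & N' (j (c u)) = e%:C *: f (N (c u)).
  case: (unit_normal_pm m0 hM' unf un') => /= ->.
    by exists 1; rewrite ?mulr1// scale1r.
  by exists (-1); rewrite ?mulrNN ?mulr1// rmorphN /= scaleN1r.
have [k k1 Jf] := isometryJ isof.
have etE v : reeb_form iota' N' (j \o c) v u = e * k * reeb_form iota N c v u.
  rewrite /reeb_form /= nE -/F' (dF' u v Om1u) fE// JCPZ Jf !gZr isometry_g//.
  by rewrite mulrN mulrA.
(* The two normals are compared at one point only, so their derivatives are traded for second
   derivatives of the immersions. *)
have hhE v w : second_form iota' N' (j \o c) v w u = e * second_form iota N c v w u.
  have ddF : mxderive v (mxderive w F') u = f (mxderive v (mxderive w F) u).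
    have sD := mxsmooth_mxderive w oOm1 sF.
    apply: mxder_mxderive; apply: (mxder_near _ (isometry_mxder isof (mxsmooth_mxder v oOm1 sD Om1u))).
    have : nbhs u Om1 by exact: open_nbhs_nbhs.
    by apply: filterS => s Os; rewrite (dF' s w Os).
  have h' := etrans (congr1 -%R (g_dnormal_tangent hN' ch' v w O'u)) (opprK _).
  have h := etrans (congr1 -%R (g_dnormal_tangent hN ch v w Ou)) (opprK _).
  apply: (etrans h'); rewrite nE ddF gZl (isometry_g isof).
  by congr (e * _); exact: (esym h).
move=> v w v0 w0; apply: (sign_zero e1); rewrite -hhE.
apply: (ruled_ruled_at m1 hM' hN' ch' rul' O'u); rewrite etE ?v0 ?w0 mulr0 //.
Qed.

Lemma ruled_at_commutation u X Y : O u -> ruled_at iota N c u ->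
  DD iota (c u) X -> DD iota (c u) Y ->
  A_F iota N (c u) (Defs.phi iota N (c u) X) Y = Defs.phi iota N (c u) (A_F iota N (c u) X Y).
Proof.
move=> Ou rul; have un := chart_unit_normal hN Ou; have [tn gn _] := un.
have cpP := hypersurface_CP hM (c u).
move=> /(DDP m0 hM X un) dX /(DDP m0 hM Y un) dY.
set P := iota (c u) in cpP tn dX dY *; set n := N (c u) in un tn gn dX dY *.
have phi0 (Z : E) : Z = (g Z (JCP P n))%:C *: JCP P n -> Defs.phi iota N (c u) Z = 0.
  move=> ZE; rewrite /Defs.phi /Defs.eta /Defs.xi -/P -/n gNr rmorphN scaleNr opprK.
  by rewrite {1}ZE JCPZ (JCPK cpP tn) scalerN addNr.
have shape0 : Defs.shape iota N (c u) 0 = 0.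
  have := shapeZ hN ch 0 (0 : V) Ou; by rewrite !scale0r.
have shapeD (Z : E) : holomorphic P n Z ->
    Defs.phi iota N (c u) (Defs.shape iota N (c u) Z) = 0.
  move=> /(hol_frame m1 hM hN ch Ou)[v -> v0]; apply: phi0.
  set S := Defs.shape _ _ _ _.
  have /(tangent_normalP m0 hM _ un)[tS nS] : tangent iota (c u) S.
    exact: (shape_tangent m0 hM hN ch).
  (* The squared norm of the holomorphic part of the shape operator's value is itself a value of the
     second fundamental form on [D], hence 0. *)
  have hp := holomorphic_part cpP tn gn tS.
  have [tB gB jB] := (holomorphicP cpP tn _).1 hp.
  rewrite nS scale0r subr0 in hp tB jB.
  apply/eqP; rewrite -subr_eq0; apply/eqP; apply: (g_eq0 (tangent_hermitian tB)).
  rewrite {1}gBl gZl [g (JCP P n) _]gC jB mulr0 subr0.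
  have [w wE w0] := hol_frame m1 hM hN ch Ou hp.
  by rewrite wE (shape_frame m1 hM hN ch Ou) (rul v w v0 w0).
have F0 (Z W : E) : holomorphic P n Z -> F_op iota N (c u) Z W = 0.
  by move=> dZ; rewrite /F_op shapeD// g0l scale0r scaler0 subrr.
have AF0 (Z W : E) : holomorphic P n Z -> A_F iota N (c u) Z W = 0.
  by move=> dZ; rewrite /A_F !F0// shape0 subrr.
have phiX : Defs.phi iota N (c u) X = JCP P X.
  have [_ _ e] := (holomorphicP cpP tn X).1 dX.
  by rewrite /Defs.phi /Defs.eta /Defs.xi -/P -/n gNr e oppr0 scale0r subr0.
rewrite phiX !AF0//; last exact: holomorphicJ.
by apply/esym; apply: phi0; rewrite g0l scale0r.
Qed.

End Transport.

Lemma locally_congruent_refl {R : realType} {m : nat} {M : topologicalType}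
  (iota : M -> 'M[R[i]]_m.+1) : locally_congruent iota iota.
Proof.
move=> p; exists setT, (fun P => 1%:M *m P *m 1%:M ^t*), id; split=> //.
- by split=> //; exact: openT.
- exists 1%:M; last by left.
  by apply/unitarymxP; rewrite mul1mx adjmx1.
- by split=> // q _; exact: cvg_id.
- by move=> B oB _; rewrite image_id.
- by move=> q _; rewrite mul1mx adjmx1 mulmx1.
Qed.

Theorem theorem3 (R : realType) (m : nat) (hm : (3 <= m)%N)
    (M : topologicalType) (iota : M -> 'M[complex R]_m.+1)
    (hM : real_hypersurface iota) :
  (forall (U : set M) (N : M -> 'M[complex R]_m.+1),
     unit_normal_field iota U N ->
     forall p : M, U p ->
     forall X Y : 'M[complex R]_m.+1, DD iota p X -> DD iota p Y ->
       A_F iota N p (phi iota N p X) Y = phi iota N p (A_F iota N p X Y))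
  <->
  (exists (M' : topologicalType) (iota' : M' -> 'M[complex R]_m.+1),
     [/\ real_hypersurface iota', ruled iota' & locally_congruent iota iota']).
Proof.
have m1 : (1 < m)%N by apply: leq_trans hm.
split=> [comm|[M' [iota' [hM' rul' cong]]] U N hN p Up X Y dX dY].
  (* The hypersurface is itself ruled, and the identity is the local congruence. *)
  exists M, iota; split=> //; last exact: locally_congruent_refl.
  apply: (ruled_of_ruled_at m1 hM) => U N hN Om c ch u Ou.
  exact: (commuting_ruled_at m1 hM hN ch (comm U N hN) Ou).
have [Om [c [u [ch Omu cu]]]] := hypersurface_chart hM p.
have Ou : normal_chart_domain U Om c u by split=> //=; rewrite cu.
have rul : ruled_at iota N c u := congruent_ruled_at m1 hM' cong rul' hN ch Ou.
rewrite -cu in dX dY *.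
exact: (ruled_at_commutation m1 hM hN ch Ou rul dX dY).
Qed.
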